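(* The modular completion $\underline{\mathrm M}\mathrm{od}(\underline{\mathcal O}\mathcal C)$ of the cyclic hybrid $\underline{\mathcal O}\mathcal C$ is the following modular hybrid. Components. For a multicycle $\mathsf O\neq\varnothing$, $C\in\mathtt{Fin}$ and $G\in\frac12\mathbb N$, the set $\underline{\mathrm M}\mathrm{od}(\underline{\mathcal O}\mathcal C)(\mathsf O,C;G)$ is the set of all symbols $$[\,V(\mathsf O_1;G_1)\cdots V(\mathsf O_a;G_a)\,;\,g\,;\,C\,],\quad\text{abbreviated } [V_1\cdots V_a;g;C],$$ where (i) $g\in\mathbb N$; (ii) $\mathsf O_1,\dots,\mathsf O_a$ is a decomposition of $\mathsf O$; (iii) $G_i\in\mathbb N$, $1\le i\le a$, are such that $\mathcal Q\underline{\mathcal O}(\mathsf O_i;G_i)$ is non-empty; (iv) $V_i=V(\mathsf O_i;G_i)$ is the unique element of $\mathcal Q\underline{\mathcal O}(\mathsf O_i;G_i)$; and $G=\sum_{i=1}^aG_i+2g+a-1+|C|/2$. (The order in which the nests $V_1,\dots,V_a$ are listed is irrelevant.) For $g\in\mathbb N$ with $G=2g-1+|C|/2$ one has $\underline{\mathrm M}\mathrm{od}(\underline{\mathcal O}\mathcal C)(\varnothing,C;G)=\{[\varnothing;g;C]\}$. In all remaining cases the component is empty. Structure operations (the symbol $[\varnothing;g;C]$ being treated as the case $a=0$). (1) If $u$ is an open input of $V'_i$ and $v$ an open input of $V''_j$, then $$[V'_1\cdots V'_{a'};g';C']\ {}_u\circ_v\ [V''_1\cdots V''_{a''};g'';C'']=[(V'_i\,{}_u\circ_v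 V''_j)\,V'_1\cdots\widehat{V'_i}\cdots V'_{a'}\,V''_1\cdots\widehat{V''_j}\cdots V''_{a''}\,;\,g'+g''\,;\,C'\sqcup C''].$$ (2) If $u\in C'$, $v\in C''$, then $$[V'_1\cdots V'_{a'};g';C']\ {}_u\circ_v\ [V''_1\cdots V''_{a''};g'';C'']=[V'_1\cdots V'_{a'}V''_1\cdots V''_{a''};g'+g'';(C'\sqcup C'')\setminus\{u,v\}].$$ (3) If $u$ is an open input of $V_i$ and $v$ an open input of $V_j$ with $i\ne j$, then $$\circ_{uv}[V_1\cdots V_a;g;C]=[(V_i\,{}_u\circ_vV_j)\,V_1\cdots\widehat{V_i}\cdots\widehat{V_j}\cdots V_a;g+1;C].$$ (4) If $u,v$ are open inputs of the same $V_i$, then $$\circ_{uv}[V_1\cdots V_a;g;C]=[(\circ_{uv}V_i)\,V_1\cdots\widehat{V_i}\cdots V_a;g;C].$$ (5) If $u,v\in C$, then $\circ_{uv}[V_1\cdots V_a;g;C]=[V_1\cdots V_a;g+1;C\setminus\{u,v\}]$. The universal morphism (unit of the adjunction) $e:\underline{\mathcal O}\mathcal C\to\underline{\mathrm M}\mathrm{od}(\underline{\mathcal O}\mathcal C)$ is $$e([\mathsf o_1\cdots\mathsf o_a;0;C])=[\,[\mathsf o_1;0]\cdots[\mathsf o_a;0]\,;0;C]\ \ (a\ge1),\qquad e([\varnothing;0;C])=[\varnothing;0;C].$$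
   Context: Cycles and multicycles. A cycle on a finite set $O=\{o_1,\dots,o_n\}$ is an equivalence class of total orders on $O$ modulo $(o_1,o_2,\dots,o_n)\equiv(o_2,\dots,o_n,o_1)$; it is written $((o_1,\dots,o_n))$ (commas may be omitted). The empty set has a unique cycle $(())$. A multicycle $\mathsf O=\mathsf o_1\cdots\mathsf o_b$ on a finite set $O$ is a disjoint unordered decomposition $O=o_1\sqcup\cdots\sqcup o_b$ into $b\ge0$ possibly empty sets together with a cycle $\mathsf o_i$ on each $o_i$; $b=0$ is possible only for $O=\emptyset$ and gives the trivial multicycle $\varnothing$. An isomorphism $\mathsf o'_1\cdots\mathsf o'_{b'}\to\mathsf o''_1\cdots\mathsf o''_{b''}$ is a bijection $u:\{1,\dots,b'\}\to\{1,\dots,b''\}$ with cyclic-order-preserving bijections $\mathsf o'_i\to\mathsf o''_{u(i)}$; $\mathtt{MultCyc}$ is the resulting groupoid. $\mathsf O'\mathsf O''$ denotes the union of multicycles on disjoint sets. Merging of cycles: $((o'_1,\dots,o'_m))\,{}_{o'_m}\circ_{o''_1}((o''_1,\dots,o''_n))=((o'_1,\dots,o'_{m-1},o''_2,\dots,o''_n))$, extended to all pairs of elements by rotation. Cutting of a cycle: $\circ_{o_1o_i}((o_1,\dots,o_n))=((o_2,\dots,o_{i-1}))((o_{i+1},\dots,o_n))$ for $1<i\le n$, extended by rotation. For multicycles, $\mathsf O'\,{}_a\circ_b\mathsf O''$ merges the cycle of $\mathsf O'$ containing $a$ with the cycle of $\mathsf O''$ containing $b$ and keeps all other cycles; $\circ_{uv}\mathsf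 O$ cuts the cycle containing both $u,v$ if they lie in the same cycle, and merges the two cycles containing $u$ and $v$ if they lie in different cycles, keeping all other cycles. Hybrids. $\mathtt{Fin}$ is the category of finite sets (and bijections), $\frac12\mathbb N=\{n/2: n\in\mathbb N\}$, $0\in\mathbb N$. A cyclic hybrid $\mathcal H$ is a functor $\mathtt{MultCyc}\times\mathtt{Fin}\times\frac12\mathbb N\to\mathtt{Set}$ ($\frac12\mathbb N$ discrete), $(\mathsf O,C,G)\mapsto\mathcal H(\mathsf O,C;G)$; elements of the underlying set $O$ of $\mathsf O$ are open inputs, those of $C$ closed inputs, $G$ is the operadic genus. It carries operations (for disjoint input sets) - open: ${}_u\circ_v:\mathcal H(\mathsf O',C';G')\times\mathcal H(\mathsf O'',C'';G'')\to\mathcal H(\mathsf O'\,{}_u\circ_v\mathsf O'',C'\sqcup C'';G'+G'')$ for $u\in O'$, $v\in O''$; - closed: ${}_u\circ_v:\mathcal H(\mathsf O',C'\sqcup\{u\};G')\times\mathcal H(\mathsf O'',C''\sqcup\{v\};G'')\to\mathcal H(\mathsf O'\mathsf O'',C'\sqcup C'';G'+G'')$, equivariant under isomorphisms and satisfying $x\,{}_u\circ_v y=y\,{}_v\circ_u x$ and $(x\,{}_a\circ_by)\,{}_c\circ_dz=x\,{}_a\circ_b(y\,{}_c\circ_dz)$ for $c\neq b$ an input of $y$. No units are required. A modular hybrid is a cyclic hybrid with in addition contractions $\circ_{uv}=\circ_{vu}$: - open: $\mathcal H(\mathsf O,C;G)\to\mathcal H(\circ_{uv}\mathsf O,C;G+1)$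 for distinct $u,v\in O$; - closed: $\mathcal H(\mathsf O,C\sqcup\{u,v\};G)\to\mathcal H(\mathsf O,C;G+1)$, equivariant and satisfying $\circ_{uv}\circ_{cd}=\circ_{cd}\circ_{uv}$; $\circ_{uv}(x\,{}_a\circ_by)=(\circ_{uv}x)\,{}_a\circ_by$ for $u,v$ inputs of $x$; and $\circ_{ab}(x\,{}_c\circ_dy)=\circ_{cd}(x\,{}_a\circ_by)$ for $a,c$ inputs of $x$ and $b,d$ inputs of $y$. Morphisms are natural transformations commuting with all operations. The modular completion $\underline{\mathrm M}\mathrm{od}$ is the left adjoint of the functor from modular hybrids to cyclic hybrids forgetting contractions: $\underline{\mathrm M}\mathrm{od}(\mathcal H)$ is a modular hybrid with a morphism of cyclic hybrids $e:\mathcal H\to\underline{\mathrm M}\mathrm{od}(\mathcal H)$ such that each morphism of cyclic hybrids from $\mathcal H$ to a modular hybrid factors uniquely through $e$ by a morphism of modular hybrids. The cyclic hybrid $\underline{\mathcal O}\mathcal C$. For $\mathsf O=\mathsf o_1\cdots\mathsf o_b$, $b\ge 0$, and $G\in\frac12\mathbb N$, $\underline{\mathcal O}\mathcal C(\mathsf O,C;G)=\{[\mathsf O;0;C]\}$ if $G=b-1+|C|/2$ and is empty otherwise. Operations: $[\mathsf O';0;C']\,{}_a\circ_b[\mathsf O'';0;C'']=[\mathsf O'\,{}_a\circ_b\mathsf O'';0;C'\sqcup C'']$ for open $a,b$ and $=[\mathsf O'\mathsf O'';0;(C'\sqcup C'')\setminus\{a,b\}]$ for closed $a,b$; isomorphisms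 relabel. Nests. For $\mathsf O=\mathsf o_1\cdots\mathsf o_b$ with $b\ge1$, and $G\in\mathbb N$, put $\mathcal Q\underline{\mathcal O}(\mathsf O;G)=\{[\mathsf O;g]\mid g\in\mathbb N,\ G=2g+b-1\}$ (at most one element); other components are empty. The operations are $[\mathsf O';g']\,{}_a\circ_b[\mathsf O'';g'']=[\mathsf O'\,{}_a\circ_b\mathsf O'';g'+g'']$, and $\circ_{uv}[\mathsf O;g]=[\circ_{uv}\mathsf O;g]$ if $u,v$ lie in the same cycle of $\mathsf O$, $=[\circ_{uv}\mathsf O;g+1]$ if in different cycles. Elements of $\mathcal Q\underline{\mathcal O}$ are called nests. A decomposition of $\mathsf O=\mathsf o_1\cdots\mathsf o_b$, $b\ge1$, is a disjoint decomposition $\{1,\dots,b\}=B_1\cup\cdots\cup B_a$ into nonempty subsets, identified with the multicycles $\mathsf O_i=\{\mathsf o_j\mid j\in B_i\}$, $1\le i\le a$. A hat denotes omission. *)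

(* Defs.v *)
From HB Require Import structures.
From mathcomp Require Import all_boot finmap zify.

Set Implicit Arguments.
Unset Strict Implicit.
Unset Printing Implicit Defensive.

Local Open Scope fset_scope.

Section Multicycles.
Variable K : choiceType.
Implicit Types (u v x y z : K) (p q : seq K).

(* Multicycles on finite subsets of a set K of labels. A multicycle M is given
   by a permutation [nxt M] of a finite set [pts M] of points, together with the
   subset [inputs M] of points that are its elements. Its cycles o_1, ..., o_b
   are the orbits of [nxt M], so b = #|` mcycles M|; the cycle carried by an
   orbit is the cyclic order induced on the inputs it contains ([mnext] is the
   successor). The points which are not inputs carry no information: they give
   names to the cycles, which is needed for empty cycles (orbits without
   inputs), since isomorphisms of multicycles may permute these. Isomorphisms
   ([relabels] below) see only the inputs, the set of cycles and [mnext], so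
   multicycles in this form are a groupoid equivalent to MultCyc. *)
Definition mcyc_ok (m : {fset K} * {fset K} * {fsfun K -> K}) : bool :=
  [&& m.1.2 `<=` m.1.1, finsupp m.2 `<=` m.1.1
    & [fset m.2 x | x in m.1.1] == m.1.1].

Record mcyc := Mcyc { mcyc_val : {fset K} * {fset K} * {fsfun K -> K};
                      _ : mcyc_ok mcyc_val }.

HB.instance Definition _ := [isSub for mcyc_val].
HB.instance Definition _ := [Choice of mcyc by <:].

Definition pts (M : mcyc) : {fset K} := (val M).1.1.
Definition inputs (M : mcyc) : {fset K} := (val M).1.2.
Definition nxt (M : mcyc) : {fsfun K -> K} := (val M).2.

Definition mcycle (M : mcyc) (x : K) : {fset K} :=
  [fset y in traject (nxt M) x #|` pts M|].

Definition mcycles (M : mcyc) : {fset {fset K}} := [fset mcycle M x | x in pts M].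

Definition mnext (M : mcyc) (x : K) : K :=
  head x [seq y <- traject (nxt M) (nxt M x) #|` pts M| | y \in inputs M].

Implicit Types M N : mcyc.

Lemma mcycP M : [/\ inputs M `<=` pts M, finsupp (nxt M) `<=` pts M
  & [fset nxt M x | x in pts M] = pts M].
Proof. by case: M => m ok; case/and3P: (ok) => ? ? /eqP. Qed.

Lemma inputs_pts M : {subset inputs M <= pts M}.
Proof. by apply/fsubsetP; case: (mcycP M). Qed.

Lemma nxt_out M x : x \notin pts M -> nxt M x = x.
Proof.
move=> xM; apply: fsfun_dflt; apply: contra xM.
by case: (mcycP M) => _ /fsubsetP + _; apply.
Qed.

Lemma nxt_pts M x : (nxt M x \in pts M) = (x \in pts M).
Proof.
case: (boolP (x \in pts M)) => xM; last by rewrite nxt_out // (negPf xM).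
by case: (mcycP M) => _ _ eF; rewrite -[X in _ \in X]eF; apply: in_imfset.
Qed.

Lemma nxt_inj M : injective (nxt M).
Proof.
have injM : {in pts M &, injective (nxt M)}.
  by apply/card_in_imfsetP; case: (mcycP M) => _ _ ->.
move=> x y e; case: (boolP (x \in pts M)) => xM.
  have yM : y \in pts M by rewrite -nxt_pts -e nxt_pts.
  exact: injM.
have yM : y \notin pts M by rewrite -nxt_pts -e nxt_pts.
by move: e; rewrite !nxt_out.
Qed.

Lemma mcyc_okP (F O : {fset K}) (f : {fsfun K -> K}) :
  O `<=` F -> finsupp f `<=` F -> {homo f : x / x \in F} ->
  {in F &, injective f} -> mcyc_ok (F, O, f).
Proof.
move=> OF fF homf injf; rewrite /mcyc_ok /= OF fF /= eqEfcard.
apply/andP; split; last by rewrite card_in_imfset.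
by apply/fsubsetP => y /imfsetP [x /= xF ->]; apply: homf.
Qed.

Lemma mcyc_eq M N : pts M = pts N -> inputs M = inputs N -> nxt M =1 nxt N -> M = N.
Proof.
move=> eF eO /fsfunP eS; apply: val_inj.
by move: eF eO eS; rewrite /pts /inputs /nxt; case: (val M) (val N) => [[? ?] ?] [[? ?] ?] /= -> -> ->.
Qed.

Fact munion_ok M N :
  mcyc_ok (pts M `|` pts N, inputs M `|` inputs N, fsfun_comp (nxt M) (nxt N)).
Proof.
apply: mcyc_okP.
- by apply: fsetUSS; apply/fsubsetP; apply: inputs_pts.
- apply/fsubsetP => x; rewrite mem_finsupp fscompE /= inE; apply: contraR.
  rewrite negb_or => /andP [xM xN]; by rewrite (nxt_out xN) (nxt_out xM) eqxx.
- move=> x; rewrite !fscompE /= !inE !nxt_pts.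
  case: (boolP (x \in pts N)) => xN; last by rewrite (nxt_out xN) orbF => ->.
  move=> _; case: (boolP (nxt N x \in pts M)) => // nM.
  by rewrite nxt_out // nxt_pts xN orbT.
- by move=> x y _ _; rewrite !fscompE /= => /nxt_inj /nxt_inj.
Qed.

(* As the supports are disjoint whenever this is used, the composite is the
   permutation acting as [nxt M] on [pts M] and as [nxt N] on [pts N]. *)
Definition munion M N : mcyc := Mcyc (munion_ok M N).

Definition fstperm u v : {fsfun K -> K} :=
  [fsfun x in [fset u; v] => if x == u then v else u].

Lemma fstpermE u v x :
  fstperm u v x = if x == u then v else if x == v then u else x.
Proof. by rewrite fsfunE !inE; case: (x == u); case: (x == v). Qed.

Lemma fstpermK u v : involutive (fstperm u v).
Proof.
move=> x; rewrite !fstpermE; have [->|xu] := eqVneq x u.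
  by rewrite eqxx; case: eqP.
have [->|xv] := eqVneq x v; first by rewrite eqxx.
by rewrite (negPf xu) (negPf xv).
Qed.

Fact mcontr_ok M u v :
  mcyc_ok (pts M `|` [fset u; v], inputs M `\` [fset u; v],
           fsfun_comp (nxt M) (fstperm u v)).
Proof.
have homt x : (fstperm u v x \in pts M `|` [fset u; v]) = (x \in pts M `|` [fset u; v]).
  rewrite fstpermE; have [->|xu] := eqVneq x u; first by rewrite !inE !eqxx !orbT.
  by have [->|] := eqVneq x v; first by rewrite !inE !eqxx !orbT.
have homn x : x \in pts M `|` [fset u; v] -> nxt M x \in pts M `|` [fset u; v].
  case: (boolP (x \in pts M)) => xM; last by rewrite nxt_out.
  by move=> _; rewrite inE nxt_pts xM.
apply: mcyc_okP.
- apply/fsubsetP => x; rewrite !inE => /andP [_ /inputs_pts ->] //.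
- apply/fsubsetP => x; rewrite mem_finsupp fscompE /=; apply: contraR => xF.
  move: (xF); rewrite !inE !negb_or => /and3P [xM xu xv].
  by rewrite fstpermE (negPf xu) (negPf xv) nxt_out // eqxx.
- by move=> x xF; rewrite fscompE /=; apply: homn; rewrite homt.
- by move=> x y _ _; rewrite !fscompE /= => /nxt_inj /(can_inj (fstpermK u v)).
Qed.

(* For inputs u <> v, [mcontr M u v] is the multicycle o_{uv} M: it cuts the
   cycle containing both u and v, or merges the two cycles containing them. In
   both cases one precomposes the successor with the transposition (u v) and
   stops regarding u and v as inputs; see [mcontr_cut] and [mcontr_merge]. They
   survive as points, so the two parts of a cut cycle are named by u and v even
   when they are empty. If M' and M'' have disjoint points, then
   [mcontr (munion M' M'') u v] is the merging M' u_o_v M''. *)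
Definition mcontr M u v : mcyc := Mcyc (mcontr_ok M u v).

Lemma looping_nxt M x : x \in pts M -> looping (nxt M) x #|` pts M|.
Proof.
move=> xM; apply: contraT; rewrite -looping_uniq => un.
have sub : {subset traject (nxt M) x #|` pts M|.+1 <= pts M}.
  move=> y /trajectP [i _ ->]; elim: i => //= i IH; by rewrite nxt_pts.
by have := uniq_leq_size un sub; rewrite size_traject ltnn.
Qed.

Lemma mcycleP M x y : x \in pts M ->
  reflect (exists n, y = iter n (nxt M) x) (y \in mcycle M x).
Proof.
move=> xM; rewrite inE /=; apply: (iffP idP).
  by case/trajectP => i _ ->; exists i.
by case=> n ->; apply/loopingP/looping_nxt.
Qed.

Lemma mem_mcycle M x : x \in pts M -> x \in mcycle M x.
Proof. by move=> xM; apply/mcycleP => //; exists 0. Qed.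

Lemma iter_pts M n x : (iter n (nxt M) x \in pts M) = (x \in pts M).
Proof. by elim: n => //= n IH; rewrite nxt_pts. Qed.

Lemma mcycle_sub M x : x \in pts M -> mcycle M x `<=` pts M.
Proof. by move=> xM; apply/fsubsetP => y /mcycleP - /(_ xM) [n ->]; rewrite iter_pts. Qed.

Lemma nxt_period M x : x \in pts M -> exists m, iter m.+1 (nxt M) x = x.
Proof.
move=> xM; have /trajectP [i lti e] := looping_nxt xM.
exists (#|` pts M| - i).-1; rewrite prednK ?subn_gt0 //.
have iter_inj : injective (iter i (nxt M)).
  by elim: i {lti e} => // i IH y z /= /nxt_inj /IH.
by apply: iter_inj; rewrite -iterD subnKC // ltnW.
Qed.

Lemma mcycle_nxt M x : mcycle M (nxt M x) = mcycle M x.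
Proof.
case: (boolP (x \in pts M)) => xM; last by rewrite nxt_out.
have nM : nxt M x \in pts M by rewrite nxt_pts.
have [m em] := nxt_period xM.
apply/fsetP => y; apply/mcycleP/mcycleP => // -[n ->].
  by exists n.+1; rewrite iterSr.
by exists (n + m)%N; rewrite -{1}em iterD iterSr.
Qed.

Lemma mcycle_eq M x y : x \in pts M -> y \in mcycle M x -> mcycle M y = mcycle M x.
Proof.
move=> xM /mcycleP - /(_ xM) [n ->]; elim: n => //= n IH.
by rewrite mcycle_nxt.
Qed.

Fact msub_ok M (B : {fset {fset K}}) (F := [fset x in pts M | mcycle M x \in B]) :
  mcyc_ok (F, inputs M `&` F, [fsfun x in F => nxt M x]).
Proof.
apply: mcyc_okP; first exact: fsubsetIr.
- exact: finsupp_sub.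
- by move=> x xF; rewrite fsfunE xF; move: xF; rewrite !inE /= nxt_pts mcycle_nxt.
- by move=> x y xF yF; rewrite !fsfunE xF yF => /nxt_inj.
Qed.

(* The multicycle formed by the cycles of M that belong to B. *)
Definition msub M B : mcyc := Mcyc (msub_ok M B).

Lemma mcycle_fcycle M (c : seq K) x : {subset c <= pts M} ->
  fcycle (nxt M) c -> x \in c -> mcycle M x = [fset y in c].
Proof.
move=> cM fc xc; apply/fsetP => y; have -> : (y \in [fset z in c]) = (y \in c) by rewrite inE.
have xM := cM x xc; apply/mcycleP/idP => // [[n ->]|yc].
  by elim: n => //= n IH; apply: (mem_fcycle fc).
have [i r e] := rot_to xc.
have : fcycle (nxt M) (x :: r) by rewrite -e rot_cycle.
rewrite /= rcons_path => /andP [/fpathP [m er] _].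
have : y \in x :: r by rewrite -e mem_rot.
rewrite er -[x :: _](trajectS (nxt M)) => /trajectP [j _ ->]; by exists j.
Qed.

Lemma fcycle_exists M u : u \in pts M ->
  exists p, fcycle (nxt M) (u :: p) /\ uniq (u :: p).
Proof.
move=> uM; have ex : exists m, iter m.+1 (nxt M) u == u.
  by have [m em] := nxt_period uM; exists m; rewrite em.
case: (ex_minnP ex) => m /eqP em min_m; exists (traject (nxt M) (nxt M u) m); split.
  by rewrite /= rcons_path fpath_traject /= last_traject -iterS em /=.
rewrite -[u :: _](trajectS (nxt M)) looping_uniq; apply/negP => /trajectP [i lti e].
have iter_inj : injective (iter i (nxt M)).
  by elim: i {lti e} => // i IH y z /= /nxt_inj /IH.
have e2 : iter (m - i) (nxt M) u = u.
  by apply: iter_inj; rewrite -iterD subnKC // ltnW.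
have := min_m (m - i).-1; rewrite prednK ?subn_gt0 // e2 eqxx => /(_ isT).
by move: lti; clear; lia.
Qed.

Lemma eq_fpath_rcons (f g : K -> K) x y p z :
  f x = g y -> {in p, f =1 g} -> fpath f x (rcons p z) = fpath g y (rcons p z).
Proof.
elim: p x y => [|a p IH] x y e ep /=; first by rewrite e.
rewrite e (IH a a) // => [|b bp]; by apply: ep; rewrite inE ?eqxx ?bp ?orbT.
Qed.

Lemma mcontr_id M u v x : x != u -> x != v -> nxt (mcontr M u v) x = nxt M x.
Proof. by move=> /negPf xu /negPf xv; rewrite /nxt /= fscompE /= fstpermE xu xv. Qed.

Lemma mcontr_l M u v : nxt (mcontr M u v) u = nxt M v.
Proof. by rewrite /nxt /= fscompE /= fstpermE eqxx. Qed.

Lemma mcontr_r M u v : nxt (mcontr M u v) v = nxt M u.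
Proof. by rewrite /nxt /= fscompE /= fstpermE eqxx; case: eqP => [->|]. Qed.

(* o_{uv} ((u p v q)) = ((p)) ((q)) *)
Lemma mcontr_cut M u v p q : uniq (u :: p ++ v :: q) ->
  fcycle (nxt M) (u :: p ++ v :: q) ->
  fcycle (nxt (mcontr M u v)) (v :: p) /\ fcycle (nxt (mcontr M u v)) (u :: q).
Proof.
rewrite /= mem_cat inE cat_uniq /= !negb_or.
move=> /and5P[/and3P[up uv uq] _ /andP[vp _] vq _].
rewrite -cats1 -catA cat_path /= => /and3P[fp lp fq].
have idp a : a \in p -> nxt (mcontr M u v) a = nxt M a.
  by move=> ap; apply: mcontr_id; apply: contraTneq ap => ->.
have idq a : a \in q -> nxt (mcontr M u v) a = nxt M a.
  by move=> aq; apply: mcontr_id; apply: contraTneq aq => ->.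
split.
  rewrite (@eq_fpath_rcons _ (nxt M) v u) //; last exact: mcontr_r.
  by rewrite -cats1 cat_path /= fp lp.
by rewrite (@eq_fpath_rcons _ (nxt M) u v) -?cats1 //; last exact: mcontr_l.
Qed.

(* o_{uv} ((u p)) ((v q)) = ((q p)) *)
Lemma mcontr_merge M u v p q : uniq (u :: p ++ v :: q) ->
  fcycle (nxt M) (u :: p) -> fcycle (nxt M) (v :: q) ->
  fcycle (nxt (mcontr M u v)) (u :: q ++ v :: p).
Proof.
rewrite /= mem_cat inE cat_uniq /= !negb_or.
move=> /and5P[/and3P[up uv uq] _ /andP[vp _] vq _] fp fq.
have idp a : a \in p -> nxt (mcontr M u v) a = nxt M a.
  by move=> ap; apply: mcontr_id; apply: contraTneq ap => ->.
have idq a : a \in q -> nxt (mcontr M u v) a = nxt M a.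
  by move=> aq; apply: mcontr_id; apply: contraTneq aq => ->.
rewrite -cats1 -catA cat_cons -cat_rcons cat_path last_rcons cats1.
rewrite (@eq_fpath_rcons _ (nxt M) u v) ?fq //; last exact: mcontr_l.
by rewrite (@eq_fpath_rcons _ (nxt M) v u) ?fp //; last exact: mcontr_r.
Qed.

Lemma nxt_munion M N x : nxt (munion M N) x = nxt M (nxt N x).
Proof. by rewrite /nxt /= fscompE. Qed.

Lemma nxt_munionl M N x : [disjoint pts M & pts N] -> x \in pts M ->
  nxt (munion M N) x = nxt M x.
Proof.
by move=> /fdisjointP dMN xM; rewrite nxt_munion [nxt N x]nxt_out ?dMN.
Qed.

Lemma nxt_munionr M N x : [disjoint pts M & pts N] -> x \in pts N ->
  nxt (munion M N) x = nxt N x.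
Proof.
rewrite fdisjoint_sym => /fdisjointP dMN xN.
by rewrite nxt_munion nxt_out // dMN // nxt_pts.
Qed.

Lemma mcycle_pts M x c : x \in pts M -> c \in mcycles M -> x \in c -> c = mcycle M x.
Proof. by move=> xM /imfsetP [y /= yM ->] xc; rewrite (mcycle_eq yM xc). Qed.

Lemma mcyclesP M x : x \in pts M -> mcycle M x \in mcycles M.
Proof. by move=> xM; apply: in_imfset. Qed.

Lemma mcycle_agree M N x : x \in pts M -> x \in pts N ->
  {in mcycle M x, nxt M =1 nxt N} -> mcycle M x = mcycle N x.
Proof.
move=> xM xN e; have it n : iter n (nxt N) x = iter n (nxt M) x.
  elim: n => //= n ->; rewrite e //; by apply/mcycleP => //; exists n.
by apply/fsetP => y; apply/mcycleP/mcycleP => // -[n ->]; exists n; rewrite it.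
Qed.

Lemma mcycles_union M N : [disjoint pts M & pts N] ->
  mcycles (munion M N) = mcycles M `|` mcycles N.
Proof.
move=> d; rewrite /mcycles imfsetU; congr (_ `|` _); apply: eq_in_imfset => //= x xM.
  apply/esym/mcycle_agree => //; first by rewrite inE xM.
  by move=> y /(fsubsetP (mcycle_sub xM)) yM; rewrite nxt_munionl.
apply/esym/mcycle_agree => //; first by rewrite inE xM orbT.
by move=> y /(fsubsetP (mcycle_sub xM)) yM; rewrite nxt_munionr.
Qed.

Lemma card_mcycles_union M N : [disjoint pts M & pts N] ->
  #|` mcycles (munion M N)| = (#|` mcycles M| + #|` mcycles N|)%N.
Proof.
move=> d; rewrite mcycles_union // cardfsU.
suff -> : mcycles M `&` mcycles N = fset0 by rewrite cardfs0 subn0.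
apply/fsetP => c; rewrite !inE; apply/negP => /andP[/imfsetP[x /= xM ->] cN].
have /imfsetP[y /= yN e] := cN.
have := mem_mcycle xM; rewrite e => /(fsubsetP (mcycle_sub yN)) xN.
by move/fdisjointP: d => /(_ x xM); rewrite xN.
Qed.

Lemma card_mcycles_merge M u v : u \in pts M -> v \in pts M ->
  v \notin mcycle M u -> #|` mcycles (mcontr M u v)|.+1 = #|` mcycles M|.
Proof.
move=> uM vM vu; set N := mcontr M u v.
have eN : pts N = pts M.
  by apply/fsetP => x; rewrite !inE; case: eqP => [->|]; case: eqP => [->|]; rewrite ?orbF ?uM ?vM.
have [p [fp un_p]] := fcycle_exists uM; have [q [fq un_q]] := fcycle_exists vM.
have subM w r : w \in pts M -> fcycle (nxt M) (w :: r) -> {subset w :: r <= pts M}.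
  move=> wM /= ; rewrite rcons_path => /andP[/fpathP[m ->] _].
  move=> y; rewrite -[_ :: _](trajectS (nxt M)) => /trajectP[i _ ->].
  by rewrite iter_pts.
have eu : mcycle M u = [fset y in u :: p].
  by apply: mcycle_fcycle (mem_head _ _) => //; apply: subM.
have ev : mcycle M v = [fset y in v :: q].
  by apply: mcycle_fcycle (mem_head _ _) => //; apply: subM.
have uvn : mcycle M u != mcycle M v.
  by apply: contraNneq vu => ->; apply: mem_mcycle.
have dpq y : y \in u :: p -> y \notin v :: q.
  move=> yp; apply/negP => yq; case/eqP: uvn.
  have <- : mcycle M y = mcycle M u by apply: mcycle_eq => //; rewrite eu in_fset.
  by apply: mcycle_eq => //; rewrite ev in_fset.
have un : uniq (u :: p ++ v :: q).
  rewrite -cat_cons cat_uniq un_p un_q andbT andTb; apply/hasPn => y.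
  by apply: contraL; apply: dpq.
have fN : fcycle (nxt N) (u :: q ++ v :: p) by apply: mcontr_merge.
have mcN x : x \in pts M -> mcycle N x =
    if (x \in mcycle M u) || (x \in mcycle M v) then mcycle M u `|` mcycle M v
    else mcycle M x.
  move=> xM; case: ifP => [xuv|/norP[xu xv]].
    have -> : mcycle N x = [fset y in u :: q ++ v :: p].
      apply: mcycle_fcycle fN _ => [y|].
        rewrite eN inE mem_cat inE => yy.
        have : (y \in u :: p) || (y \in v :: q).
          by rewrite !inE; case/or4P: yy => ->; rewrite ?orbT.
        by case/orP; apply: subM.
      move: xuv; rewrite eu ev !inE /= mem_cat inE.
      by case: eqP; case: eqP; case: (x \in p); case: (x \in q).
    apply/fsetP => y; rewrite eu ev in_fsetU !in_fset /= !(inE, mem_cat).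
    by case: (y == u); case: (y == v); case: (y \in p); case: (y \in q).
  apply/esym/mcycle_agree => //; first by rewrite eN.
  move=> y yx; rewrite mcontr_id //.
    apply: contraNneq xu => e; rewrite -e (mcycle_eq xM yx); exact: mem_mcycle.
  apply: contraNneq xv => e; rewrite -e (mcycle_eq xM yx); exact: mem_mcycle.
have -> : mcycles N = (mcycle M u `|` mcycle M v)
    |` (mcycles M `\ mcycle M u `\ mcycle M v).
  apply/fsetP => c; apply/imfsetP/fset1UP => /=.
    case=> x; rewrite eN => xM ->; rewrite mcN //; case: ifP => [_|/norP[xu xv]]; first by left.
    right; rewrite !inE mcyclesP // andbT; apply/andP; split.
      by apply: contraNneq xv => <-; apply: mem_mcycle.
    by apply: contraNneq xu => <-; apply: mem_mcycle.
  case=> [->|]; first by exists u; rewrite ?eN // mcN // mem_mcycle.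
  rewrite !inE => /and3P[cv cu /imfsetP[x /= xM e]]; exists x; rewrite ?eN // mcN //.
  case: ifP => // /orP[]xx; first by rewrite e (mcycle_eq uM xx) eqxx in cu.
  by rewrite e (mcycle_eq vM xx) eqxx in cv.
rewrite cardfsU1 (cardfsD1 (mcycle M u) (mcycles M)) mcyclesP //.
have vD : mcycle M v \in mcycles M `\ mcycle M u.
  by rewrite in_fsetD1 eq_sym uvn mcyclesP.
rewrite (cardfsD1 (mcycle M v) (mcycles M `\ _)) vD.
suff cM : mcycle M u `|` mcycle M v \notin mcycles M.
  by rewrite !in_fsetD1 (negPf cM) !andbF.
apply/negP => cM; case/eqP: uvn.
have <- : mcycle M u `|` mcycle M v = mcycle M u.
  by apply: mcycle_pts => //; rewrite in_fsetU mem_mcycle.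
by apply: mcycle_pts => //; rewrite in_fsetU mem_mcycle // orbT.
Qed.

End Multicycles.

Section Hybrids.
Variable K : choiceType.
Implicit Types (u v a b c d : K).

Inductive kind := Open | Closed.

(* The index (O, C; G) of a component: [mc] is the multicycle O, [clo] is C, and
   [gen2] is 2G, a natural number since G ranges over half-integers n/2. *)
Record arity := Arity { mc : mcyc K; clo : {fset K}; gen2 : nat }.
Implicit Types (s t : arity) (k l : kind).

Definition ports k t : {fset K} :=
  match k with Open => inputs (mc t) | Closed => clo t end.

(* The effect of gluing the inputs u and v of one object, without the change of
   the operadic genus. *)
Definition tglue k u v t : arity :=
  match k with
  | Open => Arity (mcontr (mc t) u v) (clo t) (gen2 t)
  | Closed => Arity (mc t) (clo t `\` [fset u; v]) (gen2 t)
  end.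

Definition tunion s t : arity :=
  Arity (munion (mc s) (mc t)) (clo s `|` clo t) (gen2 s + gen2 t).

Definition tjoin k u v s t : arity := tglue k u v (tunion s t).

Definition tcontr k u v t : arity :=
  tglue k u v (Arity (mc t) (clo t) (gen2 t).+2).

Definition joinable k u v s t : bool :=
  [&& [disjoint pts (mc s) & pts (mc t)]%fset, [disjoint clo s & clo t]%fset,
      u \in ports k s & v \in ports k t].

Definition contractible k u v t : bool :=
  [&& u != v, u \in ports k t & v \in ports k t].

(* The data of an isomorphism (O', C') -> (O'', C''): the bijections of the open
   inputs, of the sets of cycles and of the closed inputs. The functions are
   total, but only their values on these finite sets matter. *)
Record relabeling := Relabeling {
  on_open : K -> K;
  on_cycle : {fset K} -> {fset K};
  on_closed : K -> K }.
Implicit Types r : relabeling.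

Definition on_port k r : K -> K :=
  match k with Open => on_open r | Closed => on_closed r end.

Definition bij_fset (A B : choiceType) (f : A -> B) (X : {fset A}) (Y : {fset B}) :=
  {in X &, injective f} /\ [fset f x | x in X] = Y.

Record relabels s t r : Prop := Relabels {
  relabels_open : bij_fset (on_open r) (inputs (mc s)) (inputs (mc t));
  relabels_cycle : bij_fset (on_cycle r) (mcycles (mc s)) (mcycles (mc t));
  relabels_mem : {in inputs (mc s), forall x,
    on_cycle r (mcycle (mc s) x) = mcycle (mc t) (on_open r x)};
  relabels_next : {in inputs (mc s), forall x,
    on_open r (mnext (mc s) x) = mnext (mc t) (on_open r x)};
  relabels_closed : bij_fset (on_closed r) (clo s) (clo t);
  relabels_gen2 : gen2 s = gen2 t }.

Definition rel_union s r r' : relabeling :=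
  Relabeling
    (fun x => if x \in inputs (mc s) then on_open r x else on_open r' x)
    (fun c : {fset K} => if c \in mcycles (mc s) then on_cycle r c else on_cycle r' c)
    (fun x => if x \in clo s then on_closed r x else on_closed r' x).

(* The isomorphism induced by r after gluing u and v, with M the target
   multicycle of r. A cycle produced by an open gluing passes through u or v
   (as points), and it goes to the cycle through the image of u or v. *)
Definition rel_glue k u v (M : mcyc K) r : relabeling :=
  match k with
  | Open =>
      let u' := on_open r u in
      let v' := on_open r v in
      Relabeling (on_open r)
        (fun c : {fset K} => if u \in c then mcycle (mcontr M u' v') u'
                  else if v \in c then mcycle (mcontr M u' v') v'
                  else on_cycle r c)
        (on_closed r)
  | Closed => r
  end.

(* Cyclic hybrid structures on a family of sets H. Both sides of the last two
   axioms lie in components with equal indices; the equations are stated in the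
   total space of H. The condition "c <> b is an input of y" in [hjoinA] is
   implied by [j2] and [j3]. *)
Record cyclic_str (H : arity -> Type) := CyclicStr {
  hmap : forall s t r, relabels s t r -> H s -> H t;
  hjoin : forall k u v s t, joinable k u v s t -> H s -> H t -> H (tjoin k u v s t);
  hmap_id : forall t r (hr : relabels t t r) (x : H t),
    {in inputs (mc t), on_open r =1 id} ->
    {in mcycles (mc t), on_cycle r =1 id} ->
    {in clo t, on_closed r =1 id} ->
    hmap hr x = x;
  hmap_comp : forall s t w r r' r'' (hr : relabels s t r) (hr' : relabels t w r')
      (hr'' : relabels s w r'') (x : H s),
    {in inputs (mc s), on_open r'' =1 on_open r' \o on_open r} ->
    {in mcycles (mc s), on_cycle r'' =1 on_cycle r' \o on_cycle r} ->
    {in clo s, on_closed r'' =1 on_closed r' \o on_closed r} ->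
    hmap hr'' x = hmap hr' (hmap hr x);
  hjoin_map : forall k u v s t s' t' r r'
      (hr : relabels s s' r) (hr' : relabels t t' r')
      (j : joinable k u v s t)
      (j' : joinable k (on_port k r u) (on_port k r' v) s' t')
      (hj : relabels (tjoin k u v s t)
              (tjoin k (on_port k r u) (on_port k r' v) s' t')
              (rel_glue k u v (munion (mc s') (mc t')) (rel_union s r r')))
      (x : H s) (y : H t),
    hmap hj (hjoin j x y) = hjoin j' (hmap hr x) (hmap hr' y);
  hjoinC : forall k u v s t
      (j : joinable k u v s t) (j' : joinable k v u t s) (x : H s) (y : H t),
    existT H _ (hjoin j x y) = existT H _ (hjoin j' y x);
  hjoinA : forall k l a b c d s t w
      (j1 : joinable k a b s t) (j2 : joinable l c d (tjoin k a b s t) w)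
      (j3 : joinable l c d t w) (j4 : joinable k a b s (tjoin l c d t w))
      (x : H s) (y : H t) (z : H w),
    existT H _ (hjoin j2 (hjoin j1 x y) z) = existT H _ (hjoin j4 x (hjoin j3 y z)) }.

(* Modular hybrid structures extending S. In [hcontr_join], [q'] says that u and
   v are inputs of x; in [hcontr_join2], [j] and [j'] say that a, c are inputs
   of x and b, d inputs of y. *)
Record modular_str (H : arity -> Type) (S : cyclic_str H) := ModularStr {
  hcontr : forall k u v t, contractible k u v t -> H t -> H (tcontr k u v t);
  hcontr_map : forall k u v s t r (hr : relabels s t r)
      (q : contractible k u v s)
      (q' : contractible k (on_port k r u) (on_port k r v) t)
      (hq : relabels (tcontr k u v s) (tcontr k (on_port k r u) (on_port k r v) t)
              (rel_glue k u v (mc t) r))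
      (x : H s),
    hmap S hq (hcontr q x) = hcontr q' (hmap S hr x);
  hcontr_sym : forall k u v t
      (q : contractible k u v t) (q' : contractible k v u t) (x : H t),
    existT H _ (hcontr q x) = existT H _ (hcontr q' x);
  hcontrC : forall k l u v c d t
      (q1 : contractible l c d t) (q2 : contractible k u v (tcontr l c d t))
      (q3 : contractible k u v t) (q4 : contractible l c d (tcontr k u v t))
      (x : H t),
    existT H _ (hcontr q2 (hcontr q1 x)) = existT H _ (hcontr q4 (hcontr q3 x));
  hcontr_join : forall k l u v a b s t
      (j : joinable l a b s t) (q : contractible k u v (tjoin l a b s t))
      (q' : contractible k u v s) (j' : joinable l a b (tcontr k u v s) t)
      (x : H s) (y : H t),
    existT H _ (hcontr q (hjoin S j x y)) = existT H _ (hjoin S j' (hcontr q' x) y);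
  hcontr_join2 : forall k l a b c d s t
      (j : joinable l c d s t) (q : contractible k a b (tjoin l c d s t))
      (j' : joinable k a b s t) (q' : contractible l c d (tjoin k a b s t))
      (x : H s) (y : H t),
    existT H _ (hcontr q (hjoin S j x y)) = existT H _ (hcontr q' (hjoin S j' x y)) }.

Definition cyclic_hom H H' (S : cyclic_str H) (S' : cyclic_str H')
    (f : forall t, H t -> H' t) : Prop :=
  (forall s t r (hr : relabels s t r) (x : H s),
     f t (hmap S hr x) = hmap S' hr (f s x)) /\
  (forall k u v s t (j : joinable k u v s t) (x : H s) (y : H t),
     f _ (hjoin S j x y) = hjoin S' j (f s x) (f t y)).

Definition modular_hom H H' (S : cyclic_str H) (T : modular_str S)
    (S' : cyclic_str H') (T' : modular_str S') (f : forall t, H t -> H' t) : Prop :=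
  cyclic_hom S S' f /\
  (forall k u v t (q : contractible k u v t) (x : H t),
     f _ (hcontr T q x) = hcontr T' q (f t x)).

Definition modular_completion H H' (S : cyclic_str H) (S' : cyclic_str H')
    (T' : modular_str S') (e : forall t, H t -> H' t) : Prop :=
  cyclic_hom S S' e /\
  forall (P : arity -> Type) (SP : cyclic_str P) (TP : modular_str SP)
    (f : forall t, H t -> P t), cyclic_hom S SP f ->
  exists h : forall t, H' t -> P t,
    [/\ modular_hom T' TP h, forall t x, h t (e t x) = f t x
      & forall h' : forall t, H' t -> P t, modular_hom T' TP h' ->
          (forall t x, h' t (e t x) = f t x) -> forall t x, h' t x = h t x].

(* G = b - 1 + |C| / 2, multiplied by 2 and without subtraction. *)
Definition OC_ok t : bool :=
  (gen2 t + 2 == 2 * #|` mcycles (mc t)| + #|` clo t|)%N.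

Definition OC_mem t (x : mcyc K * nat * {fset K}) : bool :=
  (x == (mc t, 0, clo t)) && OC_ok t.

Definition OC t : Type := {x | OC_mem t x}.

Lemma OC_okP t : OC t -> OC_ok t.
Proof. by case=> x /andP[]. Qed.

Fact OC_elt_subproof t : OC_ok t -> OC_mem t (mc t, 0, clo t).
Proof. by rewrite /OC_mem eqxx. Qed.

Definition OC_elt t (ok : OC_ok t) : OC t := exist (OC_mem t) _ (OC_elt_subproof ok).

Lemma OC_eq t (x y : OC t) : x = y.
Proof. by apply: val_inj; case: x y => x /= /andP[/eqP-> _] [y /= /andP[/eqP-> _]]. Qed.

Lemma OC_heq s t (x : OC s) (y : OC t) : s = t -> existT OC s x = existT OC t y.
Proof. by move=> e; case: t / e y => y; rewrite (OC_eq x y). Qed.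

Lemma bij_fset_card (A B : choiceType) (f : A -> B) X Y :
  bij_fset f X Y -> #|` X| = #|` Y|.
Proof. by case=> injf <-; rewrite card_in_imfset. Qed.

Lemma OC_ok_map s t r : relabels s t r -> OC_ok s -> OC_ok t.
Proof.
case=> _ /bij_fset_card bB _ _ /bij_fset_card bC bG.
by rewrite /OC_ok bB bC bG.
Qed.

Lemma arith_open (gs gt bs bt cs ct b : nat) :
  (gs + 2 = 2 * bs + cs -> gt + 2 = 2 * bt + ct -> b.+1 = bs + bt ->
   gs + gt + 2 = 2 * b + (cs + ct))%N.
Proof. lia. Qed.

Lemma arith_closed (gs gt bs bt cs ct : nat) :
  (gs + 2 = 2 * bs + cs -> gt + 2 = 2 * bt + ct -> 0 < cs -> 0 < ct ->
   gs + gt + 2 = 2 * (bs + bt) + (cs + ct - 2))%N.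
Proof. lia. Qed.

Lemma OC_ok_join k u v s t : joinable k u v s t -> OC_ok s -> OC_ok t ->
  OC_ok (tjoin k u v s t).
Proof.
case/and4P => dO dC us vt /eqP os /eqP ot; apply/eqP.
have dOp := card_mcycles_union dO.
have dCl : #|` clo s `|` clo t| = (#|` clo s| + #|` clo t|)%N.
  by move: dC; rewrite -fsetI_eq0 => /eqP e; rewrite cardfsU e cardfs0 subn0.
case: k us vt => us vt /=.
  have us' := inputs_pts us; have vt' := inputs_pts vt.
  have uU : u \in pts (munion (mc s) (mc t)) by rewrite inE us'.
  have vU : v \in pts (munion (mc s) (mc t)) by rewrite inE vt' orbT.
  have := @card_mcycles_merge _ _ _ _ uU vU; rewrite dOp dCl => H.
  suff /H e : v \notin mcycle (munion (mc s) (mc t)) u.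
    by apply: (@arith_open _ _ _ _ _ _ _ os ot e).
  have -> : mcycle (munion (mc s) (mc t)) u = mcycle (mc s) u.
    apply/esym/mcycle_agree => // y yu; rewrite nxt_munionl //.
    exact: (fsubsetP (mcycle_sub us')).
  apply/negP => /(fsubsetP (mcycle_sub us')) vs.
  by move/fdisjointP: dO => /(_ v vs); rewrite vt'.
have uv : u != v by apply: contraTneq vt => <-; move/fdisjointP: dC; apply.
rewrite cardfsDS; last by apply/fsubsetP => y; rewrite !inE => /orP[]/eqP->; rewrite ?us ?vt ?orbT.
rewrite cardfs2 uv dOp dCl; apply: (arith_closed os ot).
  by rewrite cardfs_gt0; apply/fset0Pn; exists u.
by rewrite cardfs_gt0; apply/fset0Pn; exists v.
Qed.

Lemma arity_eq s t : mc s = mc t -> clo s = clo t -> gen2 s = gen2 t -> s = t.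
Proof. by case: s t => ? ? ? [? ? ?] /= -> -> ->. Qed.


Implicit Types M N L : mcyc K.

Lemma nxt_mcontr M u v x : nxt (mcontr M u v) x = nxt M (fstperm u v x).
Proof. by rewrite /nxt /= fscompE. Qed.

Lemma munionC M N : [disjoint pts M & pts N] -> munion M N = munion N M.
Proof.
move=> d; apply: mcyc_eq => [||x]; [exact: fsetUC|exact: fsetUC|].
case: (boolP (x \in pts M)) => xM.
  by rewrite nxt_munionl // nxt_munionr // fdisjoint_sym.
rewrite [RHS]nxt_munion (nxt_out xM).
case: (boolP (x \in pts N)) => xN; first by rewrite nxt_munionr.
by rewrite nxt_munion !nxt_out.
Qed.

Lemma munionA M N L : munion (munion M N) L = munion M (munion N L).
Proof.
apply: mcyc_eq => [||x]; [exact/esym/fsetUA|exact/esym/fsetUA|].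
by rewrite !nxt_munion.
Qed.

Lemma mcontr_swap M u v : mcontr M u v = mcontr M v u.
Proof.
have e : [fset u; v] = [fset v; u] by apply/fsetP => x; rewrite !inE orbC.
apply: mcyc_eq => [||x]; rewrite ?nxt_mcontr; [congr (_ `|` _)|congr (_ `\` _)|] => //.
congr (nxt M _); rewrite !fstpermE.
by case: (x =P u) => [->|_]; [case: eqP => [->|]|case: eqP].
Qed.

Lemma nxt_fstperm_out M u v x : u \notin pts M -> v \notin pts M ->
  nxt M (fstperm u v x) = fstperm u v (nxt M x).
Proof.
move=> uM vM; rewrite !fstpermE.
have ne w : w \notin pts M -> x != w -> nxt M x != w.
  move=> wM xw; case: (boolP (x \in pts M)) => xM; last by rewrite nxt_out.
  by apply: contraNneq wM => <-; rewrite nxt_pts.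
have [->|xu] := eqVneq x u; first by rewrite !nxt_out // eqxx.
have [->|xv] := eqVneq x v; first by rewrite !nxt_out // eqxx; case: eqP => [->|].
by rewrite (negPf (ne _ uM xu)) (negPf (ne _ vM xv)).
Qed.

Lemma mcontr_munionl M N u v : u \notin pts N -> v \notin pts N ->
  munion (mcontr M u v) N = mcontr (munion M N) u v.
Proof.
move=> uN vN; have iN w : w \notin pts N -> w \notin inputs N by apply: contra; apply: inputs_pts.
apply: mcyc_eq => [||x]; last first.
- by rewrite nxt_munion !nxt_mcontr nxt_munion (nxt_fstperm_out _ uN vN).
- apply/fsetP => x; rewrite !inE; have [->|_] /= := eqVneq x u; first by rewrite (negPf (iN _ uN)).
  by have [->|_] //= := eqVneq x v; first by rewrite (negPf (iN _ vN)).
- by rewrite /pts /= fsetUAC.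
Qed.

Lemma mcontr_munionr M N u v : u \notin pts M -> v \notin pts M ->
  munion M (mcontr N u v) = mcontr (munion M N) u v.
Proof.
move=> uM vM; have iM w : w \notin pts M -> w \notin inputs M by apply: contra; apply: inputs_pts.
apply: mcyc_eq => [||x]; last first.
- by rewrite nxt_munion !nxt_mcontr nxt_munion.
- apply/fsetP => x; rewrite !inE; have [->|_] /= := eqVneq x u; first by rewrite (negPf (iM _ uM)).
  by have [->|_] //= := eqVneq x v; first by rewrite (negPf (iM _ vM)).
- exact: fsetUA.
Qed.

Lemma fstpermC a b c d x : a != c -> a != d -> b != c -> b != d ->
  fstperm a b (fstperm c d x) = fstperm c d (fstperm a b x).
Proof.
move=> ac ad bc bd; rewrite !fstpermE.
have [->|xa] := eqVneq x a.
  by rewrite (negPf ac) (negPf ad) eqxx (negPf bc) (negPf bd).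
have [->|xb] := eqVneq x b.
  by rewrite (negPf bc) (negPf bd) (negPf ac) (negPf ad) eqxx; case: eqP.
have [_|xc] := eqVneq x c; first by rewrite eq_sym (negPf ad) eq_sym (negPf bd).
have [_|xd] := eqVneq x d; first by rewrite eq_sym (negPf ac) eq_sym (negPf bc).
by rewrite (negPf xa) (negPf xb).
Qed.

Lemma mcontrC M a b c d : a != c -> a != d -> b != c -> b != d ->
  mcontr (mcontr M a b) c d = mcontr (mcontr M c d) a b.
Proof.
move=> ac ad bc bd; apply: mcyc_eq => [||x].
- by rewrite /pts /= fsetUAC.
- by apply/fsetP => x; rewrite !inE; do 4!case: (x == _) => //=.
- by rewrite !nxt_mcontr fstpermC.
Qed.

Lemma tjoinC k u v s t : joinable k u v s t -> tjoin k u v s t = tjoin k v u t s.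
Proof.
case/and4P => dO dC _ _; have e : [fset u; v] = [fset v; u].
  by apply/fsetP => x; rewrite !inE orbC.
case: k; apply: arity_eq; rewrite /= ?(fsetUC (clo t)) ?(addnC (gen2 t)) //.
- by rewrite mcontr_swap munionC.
- exact: munionC.
- by rewrite e.
Qed.

Lemma fdisjoint_at (A B : {fset K}) x :
  [disjoint A & B] -> ~~ ((x \in A) && (x \in B)).
Proof. by move=> /fdisjointP d; apply/negP => /andP[/d/negP]. Qed.

Lemma mem_at (A : {fset K}) a x : a \in A -> (x == a) ==> (x \in A).
Proof. by move=> aA; apply/implyP => /eqP->. Qed.

Lemma pts_tjoin k u v s t :
  u \in ports k s -> v \in ports k t ->
  pts (mc (tjoin k u v s t)) = pts (mc s) `|` pts (mc t).
Proof.
case: k => //= /inputs_pts us /inputs_pts vt; apply/fsetP => x.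
by move: (mem_at x us) (mem_at x vt); rewrite !inE; do 4!case: (_ \in _) || case: (_ == _).
Qed.

Lemma tjoinA k l a b c d s t w :
  joinable k a b s t -> joinable l c d (tjoin k a b s t) w ->
  joinable l c d t w -> joinable k a b s (tjoin l c d t w) ->
  tjoin l c d (tjoin k a b s t) w = tjoin k a b s (tjoin l c d t w).
Proof.
move=> /and4P[dO1 dC1 a1 b1] /and4P[dO2 dC2 c2 _] /and4P[dO3 dC3 c3 d3] /and4P[_ dC4 _ b4].
have dO4 : [disjoint pts (mc s) & pts (mc w)].
  apply/fdisjointP => x xs; move/fdisjointP: dO2 => /(_ x); apply.
  by rewrite pts_tjoin // inE xs.
have nin A B x : [disjoint pts A & pts B] -> x \in inputs A -> x \notin pts B.
  by move=> /fdisjointP + /inputs_pts; apply.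
have nin' A B x : [disjoint pts A & pts B] -> x \in inputs B -> x \notin pts A.
  by rewrite fdisjoint_sym; apply: nin.
have gE : (gen2 s + gen2 t + gen2 w)%N = (gen2 s + (gen2 t + gen2 w))%N by rewrite addnA.
case: k a1 b1 c2 dC2 dO2 b4 dC4; case: l c3 d3 => /= c3 d3 a1 b1 c2 dC2 dO2 b4 dC4;
  apply: arity_eq => //=.
- have [aW bW] : a \notin pts (mc w) /\ b \notin pts (mc w).
    by split; [apply: nin dO4 a1|apply: nin dO3 b1].
  have [cS dS] : c \notin pts (mc s) /\ d \notin pts (mc s).
    by split; [apply: nin' dO1 c3|apply: nin' dO4 d3].
  have [uc vc] : a != c /\ b != c.
    by move: c2; rewrite !inE negb_or -!andbA => /and3P[ca cb _]; rewrite ![_ == c]eq_sym.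
  rewrite mcontr_munionl // mcontr_munionr // munionA mcontrC //.
    by apply: contraTneq d3 => <-; apply: contra aW; apply: inputs_pts.
  by apply: contraTneq d3 => <-; apply: contra bW; apply: inputs_pts.
- exact/esym/fsetUA.
- have [aW bW] : a \notin pts (mc w) /\ b \notin pts (mc w).
    by split; [apply: nin dO4 a1|apply: nin dO3 b1].
  by rewrite mcontr_munionl // munionA.
- apply/fsetP => x; move: (fdisjoint_at x dC1) (fdisjoint_at x dC2) (fdisjoint_at x dC3).
  move: (mem_at x c3) (mem_at x d3); rewrite !inE.
  by case: (x == c); case: (x == d); case: (x \in clo s); case: (x \in clo t); case: (x \in clo w).
- have [cS dS] : c \notin pts (mc s) /\ d \notin pts (mc s).
    by split; [apply: nin' dO1 c3|apply: nin' dO4 d3].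
  by rewrite mcontr_munionr // munionA.
- apply/fsetP => x; move: (fdisjoint_at x dC1) (fdisjoint_at x dC3) (fdisjoint_at x dC4).
  move: (mem_at x a1) (mem_at x b1); rewrite !inE.
  by case: (x == a); case: (x == b); case: (x \in clo s); case: (x \in clo t); case: (x \in clo w).
- exact: munionA.
- apply/fsetP => x; move: (fdisjoint_at x dC1) (fdisjoint_at x dC3) (fdisjoint_at x dC4).
  move: (fdisjoint_at x dC2).
  move: (mem_at x a1) (mem_at x b1) (mem_at x c3) (mem_at x d3); rewrite !inE.
  by case: (x == a); case: (x == b); case: (x == c); case: (x == d);
     case: (x \in clo s); case: (x \in clo t); case: (x \in clo w).
Qed.

Definition OC_cyclic : cyclic_str OC.
Proof.
unshelve refine (@CyclicStr OC
  (fun s t r hr x => OC_elt (OC_ok_map hr (OC_okP x)))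
  (fun k u v s t j x y => OC_elt (OC_ok_join j (OC_okP x) (OC_okP y))) _ _ _ _ _).
- by move=> *; apply: OC_eq.
- by move=> *; apply: OC_eq.
- by move=> *; apply: OC_eq.
- by move=> *; apply: OC_heq; apply: tjoinC.
- by move=> *; apply: OC_heq; apply: tjoinA.
Defined.

(* The pair (O, g) is the nest [O; g], the element of QO(O; G) with
   G = 2g + b - 1 = nestG; V(O; G) denotes this element. It requires b >= 1,
   which is imposed in [decomposition]. *)
Definition nest : Type := (mcyc K * nat)%type.
Implicit Types V W : nest.

Definition nestG V : nat := (2 * V.2 + #|` mcycles V.1| - 1)%N.

Definition njoin u v V W : nest := (mcontr (munion V.1 W.1) u v, (V.2 + W.2)%N).

Definition ncontr u v V : nest :=
  (mcontr V.1 u v, if v \in mcycle V.1 u then V.2 else V.2.+1).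

(* The underlying multicycles of the nests in D are the O_i = {o_j | j in B_i}
   for a decomposition of the set of cycles of M into nonempty subsets B_i. *)
Definition decomposition M (D : {fset nest}) : bool :=
  [&& all (fun V => (V.1 == msub M (mcycles V.1)) && (mcycles V.1 != fset0)) D,
      all (fun V => all (fun W =>
        (V == W) || [disjoint mcycles V.1 & mcycles W.1]%fset) D) D
    & \bigcup_(V <- D) mcycles V.1 == mcycles M].

(* The symbol [V_1 ... V_a; g; C], with the unordered V_1, ..., V_a as a set:
   they are distinct since their sets of cycles are disjoint and nonempty. *)
Definition symbol : Type := ({fset nest} * nat * {fset K})%type.

(* The equation is G = \sum_i G_i + 2g + a - 1 + |C| / 2, multiplied by 2 and
   without subtraction; for the multicycle with no cycle it forces a = 0. *)
Definition ModOC_mem t (x : symbol) : bool :=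
  let: (D, g, C) := x in
  [&& decomposition (mc t) D, C == clo t
    & (gen2 t + 2 == 2 * (\sum_(V <- D) nestG V) + 4 * g + 2 * #|` D| + #|` C|)%N].

Definition ModOC t : Type := {x : symbol | ModOC_mem t x}.

Definition symb t (x : ModOC t) : symbol := val x.
Definition nests t (x : ModOC t) : {fset nest} := (symb x).1.1.
Definition genus t (x : ModOC t) : nat := (symb x).1.2.

Record ModOC_formulas (S : cyclic_str ModOC) (T : modular_str S) : Prop := ModOCFormulas {
  ModOC_relabel : forall s t r (hr : relabels s t r) (x : ModOC s),
    symb (hmap S hr x) =
      ([fset (msub (mc t) [fset on_cycle r c | c in mcycles V.1], V.2) | V in nests x],
       genus x, clo t);
  ModOC_join_open : forall u v s t (j : joinable Open u v s t)
      (x : ModOC s) (y : ModOC t) V W,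
    V \in nests x -> W \in nests y -> u \in inputs V.1 -> v \in inputs W.1 ->
    symb (hjoin S j x y) =
      (njoin u v V W |` ((nests x `\ V) `|` (nests y `\ W)),
       (genus x + genus y)%N, clo s `|` clo t);
  ModOC_join_closed : forall u v s t (j : joinable Closed u v s t)
      (x : ModOC s) (y : ModOC t),
    symb (hjoin S j x y) =
      (nests x `|` nests y, (genus x + genus y)%N, (clo s `|` clo t) `\` [fset u; v]);
  ModOC_contr_diff : forall u v t (q : contractible Open u v t) (x : ModOC t) V W,
    V \in nests x -> W \in nests x -> V != W ->
    u \in inputs V.1 -> v \in inputs W.1 ->
    symb (hcontr T q x) =
      (njoin u v V W |` (nests x `\ V `\ W), (genus x).+1, clo t);
  ModOC_contr_same : forall u v t (q : contractible Open u v t) (x : ModOC t) V,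
    V \in nests x -> u \in inputs V.1 -> v \in inputs V.1 ->
    symb (hcontr T q x) = (ncontr u v V |` (nests x `\ V), genus x, clo t);
  ModOC_contr_closed : forall u v t (q : contractible Closed u v t) (x : ModOC t),
    symb (hcontr T q x) = (nests x, (genus x).+1, clo t `\` [fset u; v]) }.

Definition ModOC_unit_formula (e : forall t, OC t -> ModOC t) : Prop :=
  forall t (x : OC t),
    symb (e t x) = ([fset (msub (mc t) [fset c], 0) | c in mcycles (mc t)], 0, clo t).

End Hybrids.

(* Main.v *)
(** A nest of operadic genus G = 2g + b - 1 is encoded by the block (A, G), where A
    is the set of points of its multicycle. In these terms an open contraction,
    whether it cuts or merges cycles, unites the blocks of the two inputs and adds
    their weights, plus 1 if the blocks coincide. The genus of a symbol is then
    determined by the index of the component, and the axioms of a modular hybrid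
    reduce to the commutativity of unions.

    For the universal property, every symbol is an iterated contraction of unit
    elements, since contractions can be undone after inserting new points. The value
    that a morphism f must take on it does not depend on the presentation, by
    induction on the number of contractions: after inserting further inputs, the last
    contractions uv and ab of two presentations are made on one multicycle z. Either
    both presentations come from an element x over z, and the two contractions of x
    commute, or z decomposes into two parts with u, a in one and v, b in the other,
    and the axiom comparing o_ab (x u_o_v y) with o_uv (x a_o_b y) applies. Which case
    occurs depends on the weight of the blocks involved. *)

Require Import Defs.
From Stdlib Require Import IndefiniteDescription.
From HB Require Import structures.
From mathcomp Require Import all_boot finmap zify.

Set Implicit Arguments.
Unset Strict Implicit.
Unset Printing Implicit Defensive.

Local Open Scope fset_scope.

(** * Multicycles and their relabelings *)

(** The number of contractions in a presentation is an invariant, the total weight of the blocks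
    plus the genus g of the symbol, so induction on it is possible. It suffices to compare an
    arbitrary presentation with one chosen last contraction: a closed one if g > 0, an open one only
    if g = 0. In the latter case every last contraction acts inside one block, because closed
    contractions and open ones between different blocks raise g.

    The weight enters as follows. Suppose that uv, made inside a block, yields b cycles and weight
    2h + b - 1. A block of weight one less on the same points of z exists if and only if its cycles
    there allow a genus. If uv cuts a cycle, z has b - 1 cycles and the genus h works. If uv merges
    two, z has b + 1 cycles and the genus must be h - 1, which fails exactly for h = 0; then the
    block comes from two blocks of genus 0.

    Presentations of one element live over different multicycles, and isomorphisms see only inputs
    whereas gluing acts on points. Bringing two presentations onto one multicycle takes fresh
    points, hence the assumption that [K] is infinite. *)

Section Points.
Variable K : choiceType.
Implicit Types (M N T : mcyc K) (u v x y : K) (A B O : {fset K}) (r : relabeling K).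

Lemma fdisjointF A B x : [disjoint A & B] -> x \in A -> x \in B -> False.
Proof. by move=> /fdisjointP d /d /negP. Qed.

Lemma iter_mcycle M x n : x \in pts M -> iter n (nxt M) x \in mcycle M x.
Proof. by move=> xM; apply/mcycleP => //; exists n. Qed.

Lemma nxt_mcycle M x : x \in pts M -> nxt M x \in mcycle M x.
Proof. exact: (@iter_mcycle M x 1). Qed.

Lemma mcycle_sym M x y : x \in pts M -> y \in mcycle M x -> x \in mcycle M y.
Proof. by move=> xM yx; rewrite (mcycle_eq xM yx) mem_mcycle. Qed.

Lemma mem_mcycle_pts M x y : x \in pts M -> y \in mcycle M x -> y \in pts M.
Proof. by move=> /mcycle_sub /fsubsetP s /s. Qed.

Lemma mem_mcycles M c x : c \in mcycles M -> x \in c -> x \in pts M /\ c = mcycle M x.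
Proof.
move=> /imfsetP[y /= yM ->] xy; have xM := mem_mcycle_pts yM xy.
by split=> //; rewrite (mcycle_eq yM xy).
Qed.

Lemma mcyclesE M c : c \in mcycles M -> exists2 x, x \in pts M & c = mcycle M x.
Proof. by case/imfsetP => x /= xM ->; exists x. Qed.

Lemma mcycle_closed M A x : x \in pts M -> x \in A ->
  {in A, forall y, nxt M y \in A} -> mcycle M x `<=` A.
Proof.
move=> xM xA cA; apply/fsubsetP => y /mcycleP - /(_ xM)[n ->].
by elim: n => //= n; apply: cA.
Qed.

(** [mnext] scans only as many steps as there are points. This suffices: a first return after more
    steps would repeat an iterate already known not to be an input, by [looping_nxt]. *)
Lemma mnext_iter M x k : x \in pts M -> iter k.+1 (nxt M) x \in inputs M ->
  (forall i, i < k -> iter i.+1 (nxt M) x \notin inputs M) ->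
  mnext M x = iter k.+1 (nxt M) x.
Proof.
move=> xM ik nk; rewrite /mnext.
have xM' : nxt M x \in pts M by rewrite nxt_pts.
have ltk : k < #|` pts M|.
  rewrite ltnNge; apply/negP => lek.
  have /loopingP/(_ k)/trajectP[i lti e] := looping_nxt xM'.
  have := nk i (leq_trans lti lek); rewrite iterSr -e -iterSr.
  by rewrite ik.
have := ltk; rewrite -subn_gt0; case e: (_ - _) => [//|m] _.
have -> : #|` pts M| = (k + m.+1)%N by lia.
rewrite trajectD filter_cat (_ : [seq y <- _ | _] = [::]).
  by rewrite trajectS /= -iterSr ik.
apply/eqP; rewrite -[_ == _]negbK -has_filter; apply/hasPn => y /trajectP[i lti ->].
by rewrite -iterSr nk.
Qed.

Lemma mnextP M x y : x \in pts M -> y \in mcycle M x -> y \in inputs M ->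
  exists k, [/\ mnext M x = iter k.+1 (nxt M) x, iter k.+1 (nxt M) x \in inputs M
    & forall i, i < k -> iter i.+1 (nxt M) x \notin inputs M].
Proof.
move=> xM yx yM; have ex : exists k, iter k.+1 (nxt M) x \in inputs M.
  case/mcycleP: yx => // -[|n] ey; last by exists n; rewrite -ey.
  by have [m em] := nxt_period xM; exists m; rewrite em -[x]/(iter 0 (nxt M) x) -ey.
case: (ex_minnP ex) => k ik mink; exists k.
have nk i : i < k -> iter i.+1 (nxt M) x \notin inputs M.
  by move=> lti; apply/negP => /mink; rewrite leqNgt lti.
by split=> //; apply: mnext_iter.
Qed.

Lemma mnext_inputs M x : x \in inputs M -> mnext M x \in inputs M.
Proof.
move=> xM; have xp := inputs_pts xM.
by have [k [-> ? _]] := mnextP xp (mem_mcycle xp) xM.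
Qed.

Lemma mnext_mcycle M x : x \in inputs M -> mnext M x \in mcycle M x.
Proof.
move=> xM; have xp := inputs_pts xM.
by have [k [-> ? _]] := mnextP xp (mem_mcycle xp) xM; apply: iter_mcycle.
Qed.

Lemma mcycle_mnext M x : x \in inputs M -> mcycle M (mnext M x) = mcycle M x.
Proof. by move=> xM; apply: mcycle_eq; [apply: inputs_pts|apply: mnext_mcycle]. Qed.

Lemma mnext_orbit M x y : x \in inputs M -> y \in inputs M -> y \in mcycle M x ->
  exists m, y = iter m (mnext M) x.
Proof.
move=> xM yM /mcycleP - /(_ (inputs_pts xM))[n].
elim/ltn_ind: n x xM => n IH x xM e; case: n => [|n] in e IH *; first by exists 0.
have xp := inputs_pts xM; have [k [ek ik nk]] := mnextP xp (mem_mcycle xp) xM.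
have lek : k <= n.
  by rewrite leqNgt; apply/negP => /nk; rewrite -e yM.
have [||m ->] := IH (n - k) _ (mnext M x) (mnext_inputs xM).
- by lia.
- by rewrite ek -iterD (_ : (n - k + k.+1 = n.+1)%N) //; lia.
by exists m.+1; rewrite iterSr.
Qed.

Lemma iter_mnext M x m : x \in inputs M ->
  iter m (mnext M) x \in inputs M /\ iter m (mnext M) x \in mcycle M x.
Proof.
move=> xM; elim: m => [|m [IH1 IH2]] /=; first by rewrite xM mem_mcycle // inputs_pts.
split; first exact: mnext_inputs.
by rewrite -(mcycle_eq (inputs_pts xM) IH2) mnext_mcycle.
Qed.

(** On a finite set surjectivity suffices: [y] is an iterate of its own successor by [mnext_orbit],
    and the iterate just before it is a preimage. *)
Lemma mnext_inj M : {in inputs M &, injective (mnext M)}.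
Proof.
have card_img : [fset mnext M x | x in inputs M] = inputs M.
  apply/eqP; rewrite eqEfsubset; apply/andP; split.
    by apply/fsubsetP => y /imfsetP[x /= xM ->]; apply: mnext_inputs.
  apply/fsubsetP => y yM; have nM := mnext_inputs yM.
  have yn : y \in mcycle M (mnext M y).
    by rewrite mcycle_mnext // mem_mcycle // inputs_pts.
  have [[|m] e] := mnext_orbit nM yM yn.
    by apply/imfsetP; exists y.
  apply/imfsetP; exists (iter m (mnext M) (mnext M y)) => //=.
  by case: (iter_mnext m nM).
by move=> x y; apply: (card_in_imfsetP _ _ _) x y; rewrite card_img.
Qed.

(** [mset] keeps the permutation and changes only which points count as inputs. It serves both to
    demote inputs to mere points and to promote points to inputs. *)
Fact mset_ok M O : mcyc_ok (pts M, O `&` pts M, nxt M).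
Proof.
by rewrite /mcyc_ok /= fsubsetIr; case: (mcycP M) => _ -> ->; rewrite eqxx.
Qed.
Definition mset M O : mcyc K := Mcyc (mset_ok M O).

Lemma inputs_mset M O : O `<=` pts M -> inputs (mset M O) = O.
Proof. by move/fsetIidPl. Qed.

(* The transfer principle: only the successors of points which are not inputs
   matter between x and [mnext M x]. *)
Lemma mnext_transfer M N x x' y : x \in pts M -> x' \in pts N ->
  y \in mcycle M x -> y \in inputs M ->
  nxt N x' = nxt M x ->
  (forall w, w \in mcycle M x -> w \notin inputs M ->
     nxt N w = nxt M w /\ w \notin inputs N) ->
  mnext M x \in inputs N -> mnext N x' = mnext M x.
Proof.
move=> xM xN yx yM e h; have [k [-> ik nk]] := mnextP xM yx yM => iN.
have it i : i <= k -> iter i.+1 (nxt N) x' = iter i.+1 (nxt M) x.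
  elim: i => [|i IH] lti; first by rewrite /= e.
  rewrite iterS IH 1?ltnW //; case: (h (iter i.+1 (nxt M) x)) => //.
    exact: iter_mcycle.
  exact: nk.
rewrite (@mnext_iter _ _ k) ?it // => i lti.
by rewrite it 1?ltnW //; case: (h _ (iter_mcycle i.+1 xM) (nk _ lti)).
Qed.

End Points.

(** * Bijections between finite sets *)

Lemma bij_fsetI (S T : choiceType) (f : S -> T) X Y :
  {in X, forall x, f x \in Y} -> {in X &, injective f} ->
  (forall y, y \in Y -> exists2 x, x \in X & y = f x) -> bij_fset f X Y.
Proof.
move=> fX injf surj; split=> //; apply/fsetP => y; apply/imfsetP/idP => /=.
  by case=> x xX ->; apply: fX.
by case/surj => x xX ->; exists x.
Qed.

Section BijFset.
Variables (S T : choiceType) (f : S -> T) (X : {fset S}) (Y : {fset T}).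
Hypothesis bf : bij_fset f X Y.

Lemma bij_fset_in x : x \in X -> f x \in Y.
Proof. by case: bf => _ <- xX; apply: in_imfset. Qed.

Lemma bij_fset_surj y : y \in Y -> exists2 x, x \in X & y = f x.
Proof. by case: bf => _ <- /imfsetP[x /= xX ->]; exists x. Qed.

Lemma bij_fset_inv (x0 : S) : exists g, [/\ bij_fset g Y X, {in X, cancel f g} & {in Y, cancel g f}].
Proof.
case: (bf) => injf _; pose g y := head x0 [seq x <- X | f x == y].
have gK : {in X, cancel f g}.
  move=> x xX; rewrite /g; have : x \in [seq z <- X | f z == f x] by rewrite mem_filter eqxx.
  case e : [seq _ <- _ | _] => [//|z s] _ /=; have : z \in [seq z <- X | f z == f x].
    by rewrite e mem_head.
  by rewrite mem_filter => /andP[/eqP ez zX]; apply: injf.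
exists g; split=> //; last by move=> y /bij_fset_surj[x xX ->]; rewrite gK.
apply: bij_fsetI => [y /bij_fset_surj[x xX ->]|y z /bij_fset_surj[x xX ->] /bij_fset_surj[x' xX' ->]|x xX].
- by rewrite gK.
- by rewrite !gK // => ->.
- by exists (f x); rewrite ?gK //; apply: bij_fset_in.
Qed.

End BijFset.

Lemma bij_fset_eq (S T : choiceType) (f g : S -> T) X Y :
  {in X, f =1 g} -> bij_fset f X Y -> bij_fset g X Y.
Proof.
move=> e b; case: (b) => injf _; apply: bij_fsetI => [x xX|x y xX yX|y].
- by rewrite -e //; apply: bij_fset_in b _ xX.
- by rewrite -!e //; apply: injf.
- by case/(bij_fset_surj b) => x xX ->; exists x; rewrite ?e.
Qed.

Lemma bij_fset_comp (S T U : choiceType) (f : S -> T) (g : T -> U) X Y Z :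
  bij_fset f X Y -> bij_fset g Y Z -> bij_fset (g \o f) X Z.
Proof.
move=> bf bg; apply: bij_fsetI => [x xX|x y xX yX /= e|z /(bij_fset_surj bg)[y]].
- by apply: (bij_fset_in bg); apply: (bij_fset_in bf).
- by case: (bf) (bg) => injf _ [injg _]; apply/injf/injg => //; apply: (bij_fset_in bf).
- by case/(bij_fset_surj bf) => x xX -> ->; exists x.
Qed.

Lemma bij_fset_id (S : choiceType) (f : S -> S) X : {in X, f =1 id} -> bij_fset f X X.
Proof.
move=> e; apply: bij_fsetI => [x xX|x y xX yX|x xX]; rewrite ?e //.
by exists x; rewrite ?e.
Qed.

(** * Isomorphisms of multicycles; contraction as a twist followed by demotions *)

Section Relabelings.
Variable K : choiceType.
Implicit Types (M N T : mcyc K) (u v x y : K) (A B O : {fset K}) (r : relabeling K).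

(** The conditions of [relabels] on the multicycles alone, so that they can be composed, inverted
    and glued apart from closed inputs and genus. *)
Record mrel M N r : Prop := MRel {
  mrel_open : bij_fset (on_open r) (inputs M) (inputs N);
  mrel_cycle : bij_fset (on_cycle r) (mcycles M) (mcycles N);
  mrel_mem : {in inputs M, forall x, on_cycle r (mcycle M x) = mcycle N (on_open r x)};
  mrel_next : {in inputs M, forall x, on_open r (mnext M x) = mnext N (on_open r x)} }.

Lemma relabelsE (s t : arity K) r : relabels s t r <->
  [/\ mrel (mc s) (mc t) r, bij_fset (on_closed r) (clo s) (clo t) & gen2 s = gen2 t].
Proof. by split=> [[]|[[]]]. Qed.

Lemma mrel_ext M N r r' : {in inputs M, on_open r =1 on_open r'} ->
  {in mcycles M, on_cycle r =1 on_cycle r'} -> mrel M N r -> mrel M N r'.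
Proof.
move=> eo ec [bo bc mm nn]; split.
- exact: bij_fset_eq bo.
- exact: bij_fset_eq bc.
- by move=> x xM; rewrite -ec ?mcyclesP ?inputs_pts // -eo // mm.
- by move=> x xM; rewrite -!eo ?mnext_inputs // nn.
Qed.

Lemma mrel_id M r : {in inputs M, on_open r =1 id} -> {in mcycles M, on_cycle r =1 id} ->
  mrel M M r.
Proof.
move=> eo ec; split; [exact: bij_fset_id|exact: bij_fset_id| |].
- by move=> x xM; rewrite ec ?mcyclesP ?inputs_pts // eo.
- by move=> x xM; rewrite !eo ?mnext_inputs.
Qed.

Definition rel_comp r' r : relabeling K :=
  Relabeling (on_open r' \o on_open r) (on_cycle r' \o on_cycle r) (on_closed r' \o on_closed r).

Definition rel_id : relabeling K := Relabeling id id id.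

Lemma mrel_comp M N T r r' : mrel M N r -> mrel N T r' -> mrel M T (rel_comp r' r).
Proof.
case=> bo bc mm nn [bo' bc' mm' nn']; split.
- exact: bij_fset_comp bo bo'.
- exact: bij_fset_comp bc bc'.
- by move=> x xM /=; rewrite mm // mm' //; apply: (bij_fset_in bo).
- by move=> x xM /=; rewrite nn // nn' //; apply: (bij_fset_in bo).
Qed.

Lemma mrel_inv M N r : mrel M N r ->
  exists r', [/\ mrel N M r',
    {in inputs M, cancel (on_open r) (on_open r')},
    {in mcycles M, cancel (on_cycle r) (on_cycle r')},
    {in inputs N, cancel (on_open r') (on_open r)} &
    {in mcycles N, cancel (on_cycle r') (on_cycle r)}].
Proof.
case=> bo bc mm nn.
(* The inverse needs a default element of [K]. An input supplies one; without inputs the identity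
   will do. *)
have [g [bg fK gK]] : exists g, [/\ bij_fset g (inputs N) (inputs M),
    {in inputs M, cancel (on_open r) g} & {in inputs N, cancel g (on_open r)}].
  case: (fset_0Vmem (inputs M)) => [e|[x0 _]]; last exact: (bij_fset_inv bo x0).
  have e' : inputs N = fset0 by case: bo => _ <-; rewrite e imfset0.
  by exists id; rewrite e e'; split; [exact: bij_fset_id| |]; move=> ?; rewrite inE.
have [h [bh hK Kh]] := bij_fset_inv bc fset0.
exists (Relabeling g h id); split=> //; split=> //= x xN; have [y yM ex] := bij_fset_surj bo xN; subst x.
  by rewrite fK // -mm // hK // mcyclesP // inputs_pts.
by rewrite fK // -nn // fK // mnext_inputs.
Qed.

Definition demote M x := mset M (inputs M `\ x).

Lemma inputs_demote M x : inputs (demote M x) = inputs M `\ x.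
Proof.
apply: inputs_mset; apply/fsubsetP => y; rewrite !inE => /andP[_]; exact: inputs_pts.
Qed.

Lemma mnext_fix M x m : mnext M x = x -> iter m (mnext M) x = x.
Proof. by move=> e; elim: m => //= m ->. Qed.

Lemma mnext_demote M a x : x \in inputs M -> x != a ->
  mnext (demote M a) x = if mnext M x == a then mnext M a else mnext M x.
Proof.
move=> xM xa; have xp := inputs_pts xM.
case: eqP => [ea|/eqP na]; last first.
  apply: (mnext_transfer xp _ (mem_mcycle xp) xM) => //.
    by move=> w _ wM; rewrite inputs_demote !inE (negPf wM) andbF.
  by rewrite inputs_demote !inE na mnext_inputs.
have aM : a \in inputs M by rewrite -ea mnext_inputs.
have nam : mnext M a != a.
  apply: contra_neq xa => e.
  have xam : x \in mcycle M a by rewrite -ea mcycle_mnext // mem_mcycle.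
  by have [m ->] := mnext_orbit aM xM xam; rewrite mnext_fix.
have [k [ek ik nk]] := mnextP xp (mem_mcycle xp) xM.
have [k' [ek' ik' nk']] := mnextP (inputs_pts aM) (mem_mcycle (inputs_pts aM)) aM.
(* The next input after [x] other than [a] is reached by the return time from [x] to [a] followed by
   that from [a]. *)
have shift i : iter (i + k.+1) (nxt M) x = iter i (nxt M) a by rewrite iterD -ek ea.
have -> : mnext M a = iter (k' + k.+1).+1 (nxt M) x by rewrite -addSn shift.
apply: mnext_iter => //.
  by rewrite -addSn shift inputs_demote !inE -ek' nam mnext_inputs.
move=> i lti; rewrite inputs_demote !inE negb_and negbK; case: (ltngtP i k) => ik0.
- by rewrite [_ \in _](negPf (nk _ ik0)) orbT.
- have -> : i.+1 = ((i - k.+1).+1 + k.+1)%N by lia.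
  by rewrite shift [_ \in _](negPf (nk' _ _)) ?orbT //; lia.
- by rewrite ik0 -ek ea eqxx.
Qed.

Lemma mrel_demote M N r a : a \in inputs M -> mrel M N r ->
  mrel (demote M a) (demote N (on_open r a)) r.
Proof.
move=> aM [bo bc mm nn]; have [injo _] := bo.
split=> //; rewrite ?inputs_demote.
- apply: bij_fsetI => [x|x y|y].
  + rewrite !inE => /andP[xa xM]; rewrite (bij_fset_in bo) // andbT.
    by apply: contra_neq xa => e; apply: injo.
  + by rewrite !inE => /andP[_ ?] /andP[_ ?]; apply: injo.
  + rewrite !inE => /andP[ya yN]; have [x xM e] := bij_fset_surj bo yN.
    by exists x; rewrite // !inE xM andbT; apply: contraNneq ya => <-; rewrite e.
- by move=> x; rewrite inE => /andP[_]; apply: mm.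
- move=> x; rewrite !inE => /andP[xa xM].
  have rxa : on_open r x != on_open r a by apply: contra_neq xa => e; apply: injo.
  rewrite !mnext_demote ?(bij_fset_in bo) // -!nn //.
  have -> : (on_open r (mnext M x) == on_open r a) = (mnext M x == a).
    apply/eqP/eqP => [e|->//]; apply: injo => //; exact: mnext_inputs.
  by case: ifP.
Qed.

(** [mcontr] without the loss of the inputs [u] and [v]. Splitting a contraction into a twist and
    two demotions separates the change of cycles from the change of inputs, and the twist is an
    involution ([twistK]), which turns statements about merges into statements about cuts. *)
Definition twist M u v := mset (mcontr M u v) (inputs M).

Lemma pts_twist M u v : u \in pts M -> v \in pts M -> pts (twist M u v) = pts M.
Proof.
move=> uM vM; apply/fsetP => x; rewrite !inE.
by case: eqP => [->|]; case: eqP => [->|]; rewrite ?uM ?vM ?orbF ?orbT.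
Qed.

Lemma pts_mcontr M u v : u \in pts M -> v \in pts M -> pts (mcontr M u v) = pts M.
Proof. exact: pts_twist. Qed.

Lemma inputs_twist M u v : inputs (twist M u v) = inputs M.
Proof.
apply: inputs_mset; apply/fsubsetP => x xM; by rewrite !inE inputs_pts.
Qed.

Lemma mcontr_demote M u v : u \in pts M -> v \in pts M ->
  mcontr M u v = demote (demote (twist M u v) u) v.
Proof.
move=> uM vM; apply: mcyc_eq => //.
rewrite !inputs_demote inputs_twist; apply/fsetP => x; rewrite !inE.
by case: (x == u); case: (x == v).
Qed.

Lemma nxt_twist M u v x : nxt (twist M u v) x = nxt M (fstperm u v x).
Proof. exact: nxt_mcontr. Qed.

Lemma twistK M u v : u \in pts M -> v \in pts M -> twist (twist M u v) u v = M.
Proof.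
move=> uM vM; apply: mcyc_eq; rewrite ?inputs_twist //.
  by rewrite !pts_twist.
by move=> x; rewrite !nxt_twist fstpermK.
Qed.

(** The first step from [x] is the step of [M] from the transposed point; the later ones, up to the
    next input, meet neither [u] nor [v], since these are inputs. *)
Lemma mnext_twist M u v x : u \in inputs M -> v \in inputs M -> x \in inputs M ->
  mnext (twist M u v) x = mnext M (fstperm u v x).
Proof.
move=> uM vM xM; have tM : fstperm u v x \in inputs M.
  by rewrite fstpermE; case: eqP => // _; case: eqP.
apply: (mnext_transfer (inputs_pts tM) _ (mem_mcycle (inputs_pts tM)) tM); rewrite ?inputs_pts ?inputs_twist //.
- exact: nxt_twist.
- move=> w _ wM; split=> //; rewrite nxt_twist fstpermE.
  have -> : (w == u) = false by apply: contraNF wM => /eqP->.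
  by have -> : (w == v) = false by apply: contraNF wM => /eqP->.
- exact: mnext_inputs.
Qed.

Lemma mcycle_twist_out M u v x : x \in pts M ->
  u \notin mcycle M x -> v \notin mcycle M x -> mcycle (mcontr M u v) x = mcycle M x.
Proof.
move=> xM ux vx; apply/esym/mcycle_agree => //; first by rewrite inE xM.
move=> y yx; rewrite mcontr_id //; first by apply: contraNneq ux => <-.
by apply: contraNneq vx => <-.
Qed.

Lemma mcycles_twist_out M u v c : u \in pts M -> v \in pts M -> u \notin c -> v \notin c ->
  (c \in mcycles (mcontr M u v)) = (c \in mcycles M).
Proof.
move=> uM vM uc vc.
have half M' : u \in pts M' -> v \in pts M' -> c \in mcycles M' -> c \in mcycles (mcontr M' u v).
  move=> uM' vM' /mcyclesE[x xM e]; move: uc vc; rewrite e => uc vc.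
  by rewrite -(mcycle_twist_out xM uc vc); apply: mcyclesP; rewrite pts_mcontr.
apply/idP/idP; last exact: half.
move=> h; have := half _ _ _ h; rewrite !pts_mcontr // => /(_ uM vM).
by rewrite -[X in _ -> _ \in mcycles X](twistK uM vM).
Qed.

(** The right-hand union is closed under the twisted permutation, which gives one inclusion; the
    other is the same inclusion for the twisted multicycle. Cuts and merges are thus treated at
    once. *)
Lemma mcycle_twistU M u v : u \in pts M -> v \in pts M ->
  mcycle (mcontr M u v) u `|` mcycle (mcontr M u v) v = mcycle M u `|` mcycle M v.
Proof.
move=> uM vM.
have half M' : u \in pts M' -> v \in pts M' ->
    mcycle (mcontr M' u v) u `|` mcycle (mcontr M' u v) v `<=` mcycle M' u `|` mcycle M' v.
  move=> uM' vM'; have cl y : y \in mcycle M' u `|` mcycle M' v ->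
      nxt (mcontr M' u v) y \in mcycle M' u `|` mcycle M' v.
    have cln z : z \in mcycle M' u `|` mcycle M' v -> nxt M' z \in mcycle M' u `|` mcycle M' v.
      rewrite !in_fsetU => /orP[] zz.
        have := nxt_mcycle (mem_mcycle_pts uM' zz).
        by rewrite (mcycle_eq uM' zz) => ->.
      have := nxt_mcycle (mem_mcycle_pts vM' zz).
      by rewrite (mcycle_eq vM' zz) => ->; rewrite orbT.
    move=> yy; rewrite nxt_mcontr; apply: cln; rewrite fstpermE; case: eqP => _.
      by rewrite in_fsetU mem_mcycle ?orbT.
    by case: eqP => // _; rewrite in_fsetU mem_mcycle.
  by rewrite fsubUset; apply/andP; split; apply: mcycle_closed => //;
     rewrite ?pts_mcontr // in_fsetU !mem_mcycle ?orbT.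
apply/eqP; rewrite eqEfsubset half //=.
have := @half (mcontr M u v); rewrite pts_mcontr // => /(_ uM vM).
by rewrite -[mcycle (mcontr (mcontr M u v) u v)]/(mcycle (twist (twist M u v) u v)) twistK.
Qed.

Lemma mcycle_cut M u v : u \in pts M -> u != v -> v \in mcycle M u ->
  v \notin mcycle (mcontr M u v) u.
Proof.
move=> uM uv vu; have vM := mem_mcycle_pts uM vu.
have [p [fp un]] := fcycle_exists uM.
have cM : {subset u :: p <= pts M}.
  move: fp; rewrite /= rcons_path => /andP[/fpathP[m ->] _] y.
  by rewrite -[_ :: _](trajectS (nxt M)) => /trajectP[i _ ->]; rewrite iter_pts.
have /splitPr evp : v \in p.
  by move: vu; rewrite (mcycle_fcycle cM fp (mem_head _ _)) in_fset !inE eq_sym (negPf uv).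
case: evp fp un cM => p1 p2 fp un cM.
have [_ fc] := mcontr_cut un fp.
rewrite (mcycle_fcycle _ fc (mem_head _ _)).
  rewrite in_fset inE eq_sym (negPf uv) /=; move: un.
  by rewrite /= mem_cat cat_uniq /= => /and5P[_ _ _ ? _].
move=> y yq; rewrite pts_mcontr //; apply: cM.
by move: yq; rewrite !inE mem_cat inE => /orP[->|->] //; rewrite !orbT.
Qed.

End Relabelings.

Lemma bij_fsetU (S U : choiceType) (f g : S -> U) X X' Y Y' :
  [disjoint X & X'] -> [disjoint Y & Y'] -> bij_fset f X Y -> bij_fset g X' Y' ->
  bij_fset (fun x => if x \in X then f x else g x) (X `|` X') (Y `|` Y').
Proof.
move=> dX dY bf bg.
have e x : x \in X' -> (if x \in X then f x else g x) = g x.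
  by move=> xX'; case: ifP => // xX; case: (fdisjointF dX xX xX').
apply: bij_fsetI => [x|x y|y].
- rewrite !inE => /orP[xX|xX]; first by rewrite xX (bij_fset_in bf).
  by rewrite e // (bij_fset_in bg) ?orbT.
- rewrite !inE => /orP[xX|xX] /orP[yX|yX]; rewrite ?xX ?yX ?(e x) ?(e y) // => h.
  + by case: bf => inj _; apply: inj.
  + by case: (fdisjointF dY (bij_fset_in bf xX)); rewrite h (bij_fset_in bg).
  + by case: (fdisjointF dY (bij_fset_in bf yX)); rewrite -h (bij_fset_in bg).
  + by case: bg => inj _; apply: inj.
- rewrite !inE => /orP[yY|yY].
    by have [x xX ->] := bij_fset_surj bf yY; exists x; rewrite ?inE xX.
  by have [x xX ->] := bij_fset_surj bg yY; exists x; rewrite ?inE ?xX ?orbT // e.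
Qed.

(** * Gluing, unions and insertion of points under isomorphisms *)

Section Glue.
Variable K : choiceType.
Implicit Types (M N T : mcyc K) (u v x y : K) (A B O : {fset K}) (r : relabeling K).

Section Twist.
Variables (M N : mcyc K) (r : relabeling K) (u v : K).
Hypotheses (rMN : mrel M N r) (uM : u \in inputs M) (vM : v \in inputs M).
Let M' := twist M u v.
Let u' := on_open r u.
Let v' := on_open r v.
Let N' := twist N u' v'.
Let r' := rel_glue Open u v N r.

Let uN : u' \in inputs N. Proof. exact: (bij_fset_in (mrel_open rMN)). Qed.
Let vN : v' \in inputs N. Proof. exact: (bij_fset_in (mrel_open rMN)). Qed.
Let injr : {in inputs M &, injective (on_open r)}. Proof. by case: (mrel_open rMN). Qed.
Let uMp := inputs_pts uM.
Let vMp := inputs_pts vM.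
Let uNp := inputs_pts uN.
Let vNp := inputs_pts vN.
Let ptsM' : pts M' = pts M. Proof. by rewrite pts_twist. Qed.
Let ptsN' : pts N' = pts N. Proof. by rewrite pts_twist. Qed.

Let next : {in inputs M, forall x, on_open r (mnext M' x) = mnext N' (on_open r x)}.
Proof.
move=> x xM; rewrite !mnext_twist ?(bij_fset_in (mrel_open rMN)) //.
have -> : fstperm u' v' (on_open r x) = on_open r (fstperm u v x).
  rewrite !fstpermE (inj_in_eq injr) // [_ == v'](inj_in_eq injr) //.
  by case: ifP => // _; case: ifP.
rewrite -(mrel_next rMN) // fstpermE; by case: ifP => // _; case: ifP.
Qed.

Let next_iter x m : x \in inputs M ->
  on_open r (iter m (mnext M') x) = iter m (mnext N') (on_open r x).
Proof.
move=> xM; elim: m => //= m <-; rewrite next //.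
have xM' : x \in inputs M' by rewrite inputs_twist.
by case: (iter_mnext m xM'); rewrite inputs_twist.
Qed.

(** Two inputs share a cycle if and only if one is an iterate of the other under [mnext], and
    [on_open r] commutes with [mnext] also after the twist. *)
Let same_cycle x y : x \in inputs M -> y \in inputs M ->
  (on_open r y \in mcycle N' (on_open r x)) = (y \in mcycle M' x).
Proof.
move=> xM yM.
have [xM' yM'] : x \in inputs M' /\ y \in inputs M' by rewrite inputs_twist.
have [xN' yN'] : on_open r x \in inputs N' /\ on_open r y \in inputs N'.
  by rewrite inputs_twist !(bij_fset_in (mrel_open rMN)).
apply/idP/idP => h.
  have [m] := mnext_orbit xN' yN' h; rewrite -next_iter // => /injr e.
  have [i1 i2] := iter_mnext m xM'.
  by rewrite e // -(inputs_twist M u v).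
have [m ->] := mnext_orbit xM' yM' h; rewrite next_iter //.
by case: (iter_mnext m xN').
Qed.

Let cycM' x : x \in pts M -> mcycle M' x \in mcycles M'.
Proof. by move=> xM; apply: mcyclesP; rewrite ptsM'. Qed.
Let cycN' x : x \in pts N -> mcycle N' x \in mcycles N'.
Proof. by move=> xM; apply: mcyclesP; rewrite ptsN'. Qed.

Let mem_r x c : x \in inputs M -> c \in mcycles M ->
  (on_open r x \in on_cycle r c) = (x \in c).
Proof.
move=> xM cM; have xMp := inputs_pts xM.
have rc := bij_fset_in (mrel_cycle rMN) cM.
have rx := bij_fset_in (mrel_open rMN) xM.
apply/idP/idP => h.
  have [_ e] := mem_mcycles rc h; rewrite -(mrel_mem rMN) // in e.
  case: (mrel_cycle rMN) => inj _; rewrite (inj _ _ cM _ e) ?mcyclesP //.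
  exact: mem_mcycle.
have [_ ->] := mem_mcycles cM h; rewrite (mrel_mem rMN) //.
by apply: mem_mcycle; apply: inputs_pts.
Qed.

(** The image of a cycle is controlled through the inputs on it. A cycle through neither [u] nor [v]
    is already a cycle of [M]; its image avoids [u'] and [v'], hence survives in [N']. *)
Lemma glue_cases c : c \in mcycles M' -> on_cycle r' c \in mcycles N' /\
  forall x, x \in inputs M -> (on_open r x \in on_cycle r' c) = (x \in c).
Proof.
move=> cM'; rewrite /r' /= -/u' -/v' -/(twist N u' v') .
case: ifP => uc.
  have [_ ->] := mem_mcycles cM' uc.
  split=> [|x xM]; [exact: cycN'|exact: same_cycle].
case: ifP => vc.
  have [_ ->] := mem_mcycles cM' vc.
  split=> [|x xM]; [exact: cycN'|exact: same_cycle].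
have cM : c \in mcycles M by rewrite -(@mcycles_twist_out _ M u v) ?uc ?vc.
split=> [|x xM]; last exact: mem_r.
rewrite (@mcycles_twist_out _ N u' v') ?mem_r ?uc ?vc //.
exact: bij_fset_in (mrel_cycle rMN) _ cM.
Qed.

(** The delicate point is bijectivity on cycles, since cycles without inputs cannot be told apart by
    inputs. But such cycles avoid [u] and [v], and there [rel_glue] still uses the bijection
    [on_cycle r]. *)
Lemma mrel_twist : mrel M' N' r'.
Proof.
have cyc_eq c d x : c \in mcycles N' -> d \in mcycles N' -> x \in c -> x \in d -> c = d.
  by move=> cN dN xc xd; rewrite (mem_mcycles cN xc).2 (mem_mcycles dN xd).2.
split=> //=; rewrite ?inputs_twist //; first by case: rMN.
- apply: bij_fsetI => [c cM'|c d cM' dM' e|d dN'].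
  + by case: (glue_cases cM').
  + have [cN hc] := glue_cases cM'; have [dN hd] := glue_cases dM'.
    have hcd x : x \in inputs M -> (x \in c) = (x \in d) by move=> xM; rewrite -hc // -hd // /r' /= e.
    case: (boolP (u \in c)) => [uc|uc].
      have ud : u \in d by rewrite -hcd.
      by rewrite (mem_mcycles cM' uc).2 (mem_mcycles dM' ud).2.
    case: (boolP (v \in c)) => [vc|vc].
      have vd : v \in d by rewrite -hcd.
      by rewrite (mem_mcycles cM' vc).2 (mem_mcycles dM' vd).2.
    have [ud vd] : u \notin d /\ v \notin d by rewrite -!hcd.
    move: e; rewrite (negPf uc) (negPf vc) (negPf ud) (negPf vd); case: (mrel_cycle rMN) => inj _; apply: inj.
      by rewrite -(@mcycles_twist_out _ M u v).
    by rewrite -(@mcycles_twist_out _ M u v).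
  + have hit w : w \in inputs M -> on_open r w \in d ->
        exists2 c, c \in mcycles M' & d = on_cycle r' c.
      move=> wM wd; exists (mcycle M' w); first by rewrite cycM' ?inputs_pts.
      have [cN hc] := glue_cases (cycM' (inputs_pts wM)).
      by apply: cyc_eq wd _ => //; rewrite hc // mem_mcycle // ptsM' inputs_pts.
    case: (boolP (u' \in d)) => [|ud]; first exact: hit.
    case: (boolP (v' \in d)) => [|vd]; first exact: hit.
    have dN : d \in mcycles N by rewrite -(@mcycles_twist_out _ N u' v').
    have [c cM e] := bij_fset_surj (mrel_cycle rMN) dN.
    have [uc vc] : u \notin c /\ v \notin c by rewrite -![_ \in c]mem_r // -e.
    exists c; first by rewrite (@mcycles_twist_out _ M u v).
    by rewrite /r' /= (negPf uc) (negPf vc).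
- move=> x xM; have [cN hc] := glue_cases (cycM' (inputs_pts xM)).
  have rx := bij_fset_in (mrel_open rMN) xM.
  apply: (cyc_eq _ _ (on_open r x)) => //; rewrite ?cycN' ?inputs_pts //.
    by rewrite hc // mem_mcycle // ptsM' inputs_pts.
  by rewrite mem_mcycle // ptsN' inputs_pts.
Qed.

Lemma mrel_contr : u != v -> mrel (mcontr M u v) (mcontr N u' v') r'.
Proof.
move=> uv; rewrite !mcontr_demote //.
have h1 : mrel (demote M' u) (demote N' u') r'.
  by apply: mrel_demote mrel_twist; rewrite inputs_twist.
by apply: (mrel_demote _ h1); rewrite inputs_demote inputs_twist !inE eq_sym uv.
Qed.

End Twist.

Lemma mcycle_munionl M N x : [disjoint pts M & pts N] -> x \in pts M ->
  mcycle (munion M N) x = mcycle M x.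
Proof.
move=> d xM; apply/esym/mcycle_agree => //; first by rewrite inE xM.
by move=> y yx; rewrite nxt_munionl // (mem_mcycle_pts xM yx).
Qed.

Lemma mcycle_munionr M N x : [disjoint pts M & pts N] -> x \in pts N ->
  mcycle (munion M N) x = mcycle N x.
Proof.
by move=> d xN; rewrite munionC // mcycle_munionl // fdisjoint_sym.
Qed.

Lemma inputs_munion M N : inputs (munion M N) = inputs M `|` inputs N.
Proof. by []. Qed.

Lemma mnext_munionl M N x : [disjoint pts M & pts N] -> x \in inputs M ->
  mnext (munion M N) x = mnext M x.
Proof.
move=> d xM; have xp := inputs_pts xM.
apply: (mnext_transfer xp _ (mem_mcycle xp) xM); first by rewrite inE xp.
- exact: nxt_munionl.
- move=> w wx wM; have wp := mem_mcycle_pts xp wx.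
  rewrite nxt_munionl // inE (negPf wM) /=; split=> //.
  by apply/negP => /inputs_pts; apply: fdisjointF d wp.
- by rewrite inE mnext_inputs.
Qed.

Lemma mnext_munionr M N x : [disjoint pts M & pts N] -> x \in inputs N ->
  mnext (munion M N) x = mnext N x.
Proof.
by move=> d xN; rewrite munionC // mnext_munionl // fdisjoint_sym.
Qed.

Lemma mcycles_disj M N c : [disjoint pts M & pts N] ->
  c \in mcycles N -> (c \in mcycles M) = false.
Proof.
move=> d /mcyclesE[x xN ->]; apply/negP => /mem_mcycles - /(_ x (mem_mcycle xN))[xM _].
exact: fdisjointF d xM xN.
Qed.

Lemma disjoint_inputs M N : [disjoint pts M & pts N] -> [disjoint inputs M & inputs N].
Proof.
move=> d; apply/fdisjointP => x xM; apply/negP => /inputs_pts; apply: fdisjointF d _.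
exact: inputs_pts.
Qed.

Lemma disjoint_mcycles M N : [disjoint pts M & pts N] -> [disjoint mcycles M & mcycles N].
Proof.
by move=> d; apply/fdisjointP => c cM; apply/negP => /(mcycles_disj d); rewrite cM.
Qed.

Lemma mrel_union (s : arity K) M' N N' r r' : let M := mc s in
  [disjoint pts M & pts N] -> [disjoint pts M' & pts N'] ->
  mrel M M' r -> mrel N N' r' -> mrel (munion M N) (munion M' N') (rel_union s r r').
Proof.
move=> M d d' h h'.
have e x : x \in inputs N -> x \notin inputs M.
  by move=> xN; apply/negP => xM; apply: fdisjointF (disjoint_inputs d) xM xN.
have io x := bij_fset_in (mrel_open h) (x := x).
have io' x := bij_fset_in (mrel_open h') (x := x).
split.
- apply: bij_fsetU; [exact: disjoint_inputs|exact: disjoint_inputs| |].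
    exact: mrel_open.
  exact: mrel_open.
- rewrite !mcycles_union //.
  apply: bij_fsetU; [exact: disjoint_mcycles|exact: disjoint_mcycles| |].
    exact: mrel_cycle.
  exact: mrel_cycle.
- move=> x; rewrite inputs_munion in_fsetU => /orP[] xM /=; have xp := inputs_pts xM.
    rewrite xM mcycle_munionl // mcyclesP // (mrel_mem h) //.
    by rewrite mcycle_munionl //; apply/inputs_pts/io.
  rewrite (negPf (e _ xM)) mcycle_munionr // (mcycles_disj d) ?mcyclesP // (mrel_mem h') //.
  by rewrite mcycle_munionr //; apply/inputs_pts/io'.
- move=> x; rewrite inputs_munion in_fsetU => /orP[] xM /=.
    by rewrite mnext_munionl // !ifT ?mnext_inputs // (mrel_next h) // mnext_munionl // io.
  rewrite mnext_munionr // !(ifN _ _ (e _ _)) ?mnext_inputs // (mrel_next h') //.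
  by rewrite mnext_munionr // io'.
Qed.

(* When a is not a point of M, contracting x and a puts a between x and its
   successor. *)
Definition ins M x a := mset (mcontr M x a) (a |` inputs M).

Section Insert.
Variables (M : mcyc K) (x a : K).
Hypotheses (xM : x \in pts M) (aM : a \notin pts M).

Lemma pts_ins : pts (ins M x a) = a |` pts M.
Proof.
by apply/fsetP => y; rewrite !inE; case: (eqVneq y x) => [->|]; rewrite ?xM ?orbT ?orbF // orbC.
Qed.

Lemma inputs_ins : inputs (ins M x a) = a |` inputs M.
Proof.
apply: inputs_mset; apply/fsubsetP => y; rewrite !inE => /orP[->|/inputs_pts->] //; by rewrite !orbT.
Qed.

Lemma ins_neq y : y \in pts M -> y == a = false.
Proof. by move=> yM; apply: contraNF aM => /eqP<-. Qed.

Lemma nxt_ins y : y \in pts M -> y != x -> nxt (ins M x a) y = nxt M y.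
Proof. by move=> yM yx; rewrite -(@mcontr_id _ M x a) // ins_neq. Qed.

Lemma nxt_ins_x : nxt (ins M x a) x = a.
Proof. by rewrite -[RHS](nxt_out aM) -(@mcontr_l _ M x a). Qed.

Lemma nxt_ins_a : nxt (ins M x a) a = nxt M x.
Proof. by rewrite -(@mcontr_r _ M x a). Qed.

Lemma mcycle_ins_a : mcycle (ins M x a) a = a |` mcycle M x.
Proof.
have aI : a \in pts (ins M x a) by rewrite pts_ins !inE eqxx.
have xI : x \in pts (ins M x a) by rewrite pts_ins !inE xM orbT.
apply/eqP; rewrite eqEfsubset; apply/andP; split.
  apply: mcycle_closed => //; first by rewrite !inE eqxx.
  move=> y /fset1UP[->|yx]; first by rewrite nxt_ins_a in_fset1U nxt_mcycle ?orbT.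
  have yM := mem_mcycle_pts xM yx; have [->|yx'] := eqVneq y x.
    by rewrite nxt_ins_x in_fset1U eqxx.
  by rewrite nxt_ins // in_fset1U -(mcycle_eq xM yx) nxt_mcycle ?orbT.
apply/fsubsetP => y /fset1UP[->|]; first exact: mem_mcycle.
suff /fsubsetP/(_ y) : mcycle M x `<=` mcycle (ins M x a) a by [].
have xa : x \in mcycle (ins M x a) a.
  by have := nxt_mcycle xI; rewrite nxt_ins_x => /(mcycle_sym xI).
apply: mcycle_closed => // z za; have [->|zx] := eqVneq z x.
  by have := nxt_mcycle aI; rewrite nxt_ins_a.
have [zM|zM] := boolP (z \in pts M); last by rewrite nxt_out.
by rewrite -nxt_ins // -(mcycle_eq aI za) nxt_mcycle // pts_ins inE zM orbT.
Qed.

Lemma mcycle_ins y : y \in pts M ->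
  mcycle (ins M x a) y = if x \in mcycle M y then a |` mcycle M y else mcycle M y.
Proof.
move=> yM; case: ifP => [xy|/negbT xy].
  have aI : a \in pts (ins M x a) by rewrite pts_ins !inE eqxx.
  rewrite -(mcycle_eq yM xy) -mcycle_ins_a; apply: mcycle_eq => //.
  by rewrite mcycle_ins_a in_fset1U mcycle_sym ?orbT.
apply: mcycle_twist_out => //; apply: contra aM; exact: mem_mcycle_pts.
Qed.

Definition addpt (c : {fset K}) := if x \in c then a |` c else c.

Lemma addptK : {in mcycles M, cancel addpt (fun c => c `\ a)}.
Proof.
move=> c /mcyclesE[y yM ->]; have ay : a \notin mcycle M y.
  by apply: contra aM; apply: mem_mcycle_pts.
rewrite /addpt; case: ifP => _; first by rewrite fsetU1K.
by apply/fsetP => z; rewrite in_fsetD1; case: eqP => // ->; rewrite (negPf ay).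
Qed.

Lemma bij_addpt : bij_fset addpt (mcycles M) (mcycles (ins M x a)).
Proof.
have e y : y \in pts M -> mcycle (ins M x a) y = addpt (mcycle M y) := @mcycle_ins y.
have yI y : y \in pts M -> y \in pts (ins M x a) by move=> yM; rewrite pts_ins inE yM orbT.
apply: bij_fsetI => [c /mcyclesE[y yM ->]|c d cM dM h|c /mcyclesE[y + ->]].
- by rewrite -e // mcyclesP // yI.
- by rewrite -[LHS]addptK // h addptK.
rewrite pts_ins => /fset1UP[->|yM]; last by exists (mcycle M y); rewrite ?mcyclesP // e.
by exists (mcycle M x); rewrite ?mcyclesP // mcycle_ins_a /addpt mem_mcycle.
Qed.

Lemma mnext_step N y : y \in pts N -> nxt N y \notin inputs N ->
  (exists2 z, z \in mcycle N y & z \in inputs N) -> mnext N y = mnext N (nxt N y).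
Proof.
move=> yN ny [z zy zN]; have nyN : nxt N y \in pts N by rewrite nxt_pts.
have zy' : z \in mcycle N (nxt N y) by rewrite mcycle_nxt.
have [k [-> ik nk]] := mnextP nyN zy' zN.
rewrite -iterSr; apply: mnext_iter => //; first by rewrite iterSr.
by case=> //= i /nk; rewrite -iterSr.
Qed.

(** Induction on the number of steps to the next input. Passing [x] costs one extra step through
    [a], which is not an input of the demoted multicycle. *)
Lemma mnext_ins y : y \in inputs M -> mnext (demote (ins M x a) a) y = mnext M y.
Proof.
move=> yI; have yM := inputs_pts yI.
have [k [-> ik nk]] := mnextP yM (mem_mcycle yM) yI.
set N := demote _ _.
have iN : inputs N = inputs M.
  by rewrite inputs_demote inputs_ins fsetU1K //; apply: contra aM; apply: inputs_pts.
have aN : a \notin inputs N by rewrite iN; apply: contra aM; apply: inputs_pts.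
have ptsN z : z \in pts M -> z \in pts N.
  by move=> zM; rewrite -[pts N]/(pts (ins M x a)) pts_ins inE zM orbT.
have {}nk i : i < k -> iter i.+1 (nxt M) y \notin inputs N by rewrite iN; apply: nk.
have {}ik : iter k.+1 (nxt M) y \in inputs N by rewrite iN.
have {yI} : exists2 z, z \in mcycle M y & z \in inputs N.
  by exists y; rewrite ?mem_mcycle ?iN.
elim: k y yM ik nk => [|k IH] y yM ik nk [z zy zN].
  have [ey|yx] := eqVneq y x; last first.
    have e : nxt N y = nxt M y := nxt_ins yM yx.
    by rewrite /= -e; apply: (@mnext_iter _ N y 0) => //=; rewrite ?e ?ptsN.
  have := @mnext_iter _ N y 1 (ptsN _ yM); rewrite /= ey nxt_ins_x nxt_ins_a -ey.
  by apply=> // -[|//] _ /=; rewrite ey nxt_ins_x.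
have zyN : z \in mcycle N y.
  by rewrite -[mcycle N y]/(mcycle (ins M x a) y) mcycle_ins //; case: ifP => // _; rewrite in_fset1U zy orbT.
have yN := ptsN y yM; have ny := nk 0 isT.
have {}IH : mnext N (nxt M y) = iter k.+2 (nxt M) y.
  rewrite IH ?nxt_pts -?iterSr // => [i lti|]; first by rewrite -iterSr nk.
  by exists z; rewrite ?mcycle_nxt.
have [ey|yx] := eqVneq y x; last first.
  by rewrite mnext_step //; rewrite ?nxt_ins //; exists z.
have ea : nxt N y = a by rewrite ey nxt_ins_x.
rewrite mnext_step ?ea //; last by exists z.
rewrite mnext_step //; rewrite ?nxt_ins_a -?ey //.
  by rewrite -ea nxt_pts.
by exists z => //; rewrite -ea mcycle_nxt.
Qed.

(** Points that are not inputs carry no information, so inserting one gives an isomorphic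
    multicycle; [addpt] is the renaming of cycles as sets of points. *)
Lemma mrel_ins : mrel M (demote (ins M x a) a) (Relabeling id addpt id).
Proof.
have iN : inputs (demote (ins M x a) a) = inputs M.
  by rewrite inputs_demote inputs_ins fsetU1K //; apply: contra aM; apply: inputs_pts.
split=> /=; rewrite ?iN; [exact: bij_fset_id|exact: bij_addpt| |].
  by move=> y /inputs_pts yM /=; rewrite -[RHS]/(mcycle (ins M x a) y) mcycle_ins.
by move=> y yI /=; rewrite mnext_ins.
Qed.

End Insert.

Section Promote.
Variables (M T : mcyc K) (r : relabeling K) (a a' : K).
Hypotheses (aM : a \in inputs M) (aT : a' \notin pts T) (rT : mrel (demote M a) T r).

Let prom x := Relabeling (fun y => if y == a then a' else on_open r y)
  (fun c => addpt x a' (on_cycle r c)) (on_closed r).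

(** An isomorphism defined after forgetting the input [a] extends to [M] once a new input [a'] is
    put in the right place of [T]: directly after the image of the input [p] that precedes [a]. The
    predicate [A] lists what is required of that place. *)
Lemma mrel_promote : exists2 x, x \in pts T & mrel M (ins T x a') (prom x).
Proof.
have ir y : y \in inputs M -> y != a -> on_open r y \in inputs T.
  by move=> yM ya; apply: (bij_fset_in (mrel_open rT)); rewrite inputs_demote !inE ya.
have aM' := inputs_pts aM.
have [p pM pa] : exists2 p, p \in inputs M & mnext M p = a.
  have : a \in [fset mnext M x | x in inputs M].
    suff -> : [fset mnext M x | x in inputs M] = inputs M by [].
    apply/eqP; rewrite eqEfcard card_in_imfset; last exact: mnext_inj.
    by rewrite leqnn andbT; apply/fsubsetP => y /imfsetP[x /= xM ->]; apply: mnext_inputs.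
  by case/imfsetP => p /= pM ->; exists p.
have cM y : y \in pts M -> mcycle M y \in mcycles (demote M a) by apply: mcyclesP.
pose A x := [/\ x \in pts T, x \in on_cycle r (mcycle M a),
  p != a -> mnext (ins T x a') (on_open r p) = a' &
  mnext (ins T x a') a' = if p == a then a' else on_open r (mnext M a)].
have [x [xT xa nextp nexta]] : exists x, A x.
  (* If [a] is the only input of its cycle, any point of the image cycle will do: a second input on
     that cycle would come from an input [y] on the cycle of [a]. *)
  have [ep|pna] := eqVneq p a.
    have /mcyclesE[x xT ex] := bij_fset_in (mrel_cycle rT) (cM a aM').
    exists x; split=> //; rewrite ?ex ?mem_mcycle ?ep ?eqxx //.
    have aI : a' \in inputs (ins T x a') by rewrite inputs_ins // !inE eqxx.
    have := mnext_inputs aI; have := mnext_mcycle aI.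
    rewrite inputs_ins // mcycle_ins_a // => nc /fset1UP[//|nT].
    move: nc; rewrite in_fset1U => /orP[/eqP//|nx].
    have [y] := bij_fset_surj (mrel_open rT) nT.
    rewrite inputs_demote !inE => /andP[ya yM] ey.
    have yM' : y \in inputs (demote M a) by rewrite inputs_demote !inE ya.
    have := mrel_mem rT yM'; rewrite -ey (mcycle_eq xT nx) -ex => eca.
    case: (mrel_cycle rT) => inj _; have {}eca := inj _ _ (cM y (inputs_pts yM)) (cM a aM') eca.
    have yca : y \in mcycle M a by rewrite -eca mem_mcycle // inputs_pts.
    have [m] := mnext_orbit aM yM yca; rewrite mnext_fix => [e|]; last by rewrite -{1}ep.
    by rewrite e eqxx in ya.
  have pT := ir p pM pna; have pT' := inputs_pts pT.
  have np : mnext (ins T (on_open r p) a') (on_open r p) = a'.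
    have e := nxt_ins_x (on_open r p) aT; rewrite -[in RHS]e.
    apply: (@mnext_iter _ _ _ 0) => //.
      by rewrite pts_ins // inE pT' orbT.
    by rewrite /= e inputs_ins // !inE eqxx.
  have pD : p \in inputs (demote M a) by rewrite inputs_demote !inE pna.
  exists (on_open r p); split=> //.
    rewrite -pa mcycle_mnext // (mrel_mem rT) //; exact: mem_mcycle.
  have := mnext_ins pT' aT pT; rewrite mnext_demote ?np ?eqxx => [->||].
  - rewrite (negPf pna) -(mrel_next rT) // mnext_demote // pa eqxx //.
  - by rewrite inputs_ins // inE pT orbT.
  - by rewrite (ins_neq aT).
exists x => //; have xI := inputs_ins T x a'.
have injo : {in inputs M &, injective (on_open (prom x))}.
  move=> y z yM zM /=; case: eqP => [->|/eqP ya]; case: eqP => [->|/eqP za] //.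
  - by move=> e; move: aT; rewrite e inputs_pts // ir.
  - by move=> e; move: aT; rewrite -e inputs_pts // ir.
  - by case: (mrel_open rT) => inj _; apply: inj; rewrite inputs_demote !inE ?ya ?za.
split.
- apply: bij_fsetI => // [y yM|y]; rewrite xI.
    by rewrite in_fset1U /=; have [_|ya] := eqVneq y a; rewrite ?eqxx ?ir ?orbT.
  case/fset1UP => [->|yT]; first by exists a; rewrite //= eqxx.
  have [z + ->] := bij_fset_surj (mrel_open rT) yT; rewrite inputs_demote !inE => /andP[za zM].
  by exists z; rewrite //= (negPf za).
- by apply: bij_fset_comp (mrel_cycle rT) _; apply: bij_addpt.
- move=> y yM /=; case: eqP => [->|/eqP ya].
    have /mcyclesE[z zT ez] := bij_fset_in (mrel_cycle rT) (cM a aM').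
    rewrite /addpt xa mcycle_ins_a //; congr (_ |` _); rewrite ez in xa *.
    by rewrite (mcycle_eq zT xa).
  have yD : y \in inputs (demote M a) by rewrite inputs_demote !inE ya.
  by rewrite [in LHS](mrel_mem rT) // mcycle_ins // inputs_pts // ir.
- move=> y yM /=; have [->|ya] := eqVneq y a.
    rewrite nexta; case: (eqVneq p a) => [ep|pna]; first by rewrite -{1}ep pa eqxx.
    rewrite ifN //; apply: contra_neq pna => e; apply: (mnext_inj pM aM); by rewrite pa.
  have [ey|yp] := eqVneq y p.
    by rewrite ey pa eqxx nextp // -ey.
  have nya : mnext M y != a.
    by apply: contra_neq yp => e; apply: (mnext_inj yM pM); rewrite pa.
  have yD : y \in inputs (demote M a) by rewrite inputs_demote !inE ya.
  have yT := ir y yM ya; have yI : on_open r y \in inputs (ins T x a').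
    by rewrite xI inE yT orbT.
  have aI : a' \in inputs (ins T x a') by rewrite xI !inE eqxx.
  rewrite (negPf nya); have := mrel_next rT yD; rewrite mnext_demote // (negPf nya) => ->.
  rewrite -(mnext_ins xT aT yT) mnext_demote //; last by rewrite (ins_neq aT) // inputs_pts.
  case: eqP => // e; case: (eqVneq p a) => [ep|pna].
    have h : mnext (ins T x a') a' = a' by rewrite nexta ep eqxx.
    by have := mnext_inj yI aI; rewrite e h => /(_ erefl) e2; move: aT; rewrite -e2 inputs_pts.
  have pI : on_open r p \in inputs (ins T x a') by rewrite xI inE ir ?orbT.
  have := mnext_inj yI pI; rewrite e nextp // => /(_ erefl) /eqP.
  by have := inj_in_eq injo yM pM; rewrite /= (negPf ya) (negPf pna) (negPf yp) => ->.
Qed.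

End Promote.
End Glue.

(** * Blocks *)

(* The block (A, G) stands for the nest of operadic genus G = 2g + b - 1 whose
   multicycle has the set of points A. *)
Definition block (K : choiceType) : Type := ({fset K} * nat)%type.
HB.instance Definition _ (K : choiceType) := Choice.on (block K).

HB.lock Definition blk (K : choiceType) (D : {fset block K}) (x : K) : block K :=
  head ((fset0, 0) : block K) [seq X : block K <- D | x \in X.1].

Definition mblock (K : choiceType) (X Y : block K) : block K :=
  (X.1 `|` Y.1, if X == Y then X.2.+1 else (X.2 + Y.2)%N).

(* The weight G makes all open contractions alike: a cut or a merge inside a
   nest increases 2g + b - 1 by 1, and a merge of two nests adds these numbers. *)
HB.lock Definition bmerge (K : choiceType) (u v : K) (D : {fset block K}) : {fset block K} :=
  mblock (blk D u) (blk D v) |` (D `\ blk D u `\ blk D v).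

Section Blocks.
Variable K : choiceType.
Local Notation block := (block K).

Implicit Types (M N T : mcyc K) (u v x y : K) (A B O : {fset K}) (r : relabeling K)
  (X Y Z U V W C : block) (D E : {fset block}).

Definition cycs M A := [fset mcycle M x | x in A].

(** Decompositions as partitions of the points into blocks closed under the permutation. [part_gen]
    expresses that the block is a nest: G + 1 = 2g + b for some natural g. *)
Record part M D : Prop := Part {
  part_sub : forall X x, X \in D -> x \in X.1 -> x \in pts M;
  part_ne : forall X, X \in D -> X.1 != fset0;
  part_closed : forall X x, X \in D -> x \in X.1 -> nxt M x \in X.1;
  part_gen : forall X, X \in D -> exists g : nat, (X.2.+1 = 2 * g + #|` cycs M X.1|)%N;
  part_disj : forall X Y x, X \in D -> Y \in D -> x \in X.1 -> x \in Y.1 -> X = Y;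
  part_cover : forall x, x \in pts M -> exists2 X, X \in D & x \in X.1 }.

Lemma blk_in M D x : part M D -> x \in pts M -> blk D x \in D /\ x \in (blk D x).1.
Proof.
move=> pD /(part_cover pD)[X XD xX]; rewrite blk.unlock.
have : X \in [seq X : block <- D | x \in X.1] by rewrite mem_filter xX.
case e : [seq _ <- _ | _] => [//|Y s] _ /=.
have : Y \in [seq X : block <- D | x \in X.1] by rewrite e mem_head.
by rewrite mem_filter => /andP[].
Qed.

Lemma blk_eq M D X x : part M D -> X \in D -> x \in X.1 -> blk D x = X.
Proof.
move=> pD XD xX; have [bD xb] := blk_in pD (part_sub pD XD xX).
exact: part_disj pD _ _ _ bD XD xb xX.
Qed.

Lemma block_pt M D X : part M D -> X \in D -> exists2 x, x \in pts M & X = blk D x.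
Proof.
move=> pD XD; have /fset0Pn[x xX] := part_ne pD XD.
by exists x; [apply: part_sub pD _ _ XD xX|rewrite (blk_eq pD XD xX)].
Qed.

Lemma part_ext M N D E : part M D -> part N E -> pts M = pts N ->
  (forall x, x \in pts M -> blk D x = blk E x) -> D = E.
Proof.
move=> pD pE eMN e; apply/fsetP => X; apply/idP/idP => h.
  have [x xM ->] := block_pt pD h; rewrite e //.
  by case: (blk_in pE (x := x)); rewrite -?eMN.
by have [x xN ->] := block_pt pE h; rewrite -e ?eMN //; case: (blk_in pD (x := x)); rewrite ?eMN.
Qed.

Lemma part_mcycle M D X x y : part M D -> X \in D -> x \in X.1 -> y \in mcycle M x -> y \in X.1.
Proof.
move=> pD XD xX; have xM := part_sub pD XD xX.
by apply/fsubsetP; apply: mcycle_closed => // z; apply: part_closed pD _ _ XD.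
Qed.

Lemma cycsP M A c : reflect (exists2 x, x \in A & c = mcycle M x) (c \in cycs M A).
Proof. by apply: (iffP (imfsetP _ _ _ _)) => /= -[x xA ->]; exists x. Qed.

Lemma mem_cycs M A x : x \in A -> mcycle M x \in cycs M A.
Proof. by move=> xA; apply/cycsP; exists x. Qed.

Lemma cycsU M A B : cycs M (A `|` B) = cycs M A `|` cycs M B.
Proof. exact: imfsetU. Qed.

Lemma cycs_pts M : cycs M (pts M) = mcycles M.
Proof.
apply/fsetP => c; apply/cycsP/idP => [[x xM ->]|/mcyclesE //]; exact: mcyclesP.
Qed.

Lemma card_cycsU M A B : A `<=` pts M -> B `<=` pts M ->
  {in A, forall x, nxt M x \in A} -> [disjoint A & B] ->
  #|` cycs M (A `|` B)| = (#|` cycs M A| + #|` cycs M B|)%N.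
Proof.
move=> /fsubsetP AM /fsubsetP BM cA d; rewrite cycsU cardfsU.
suff -> : cycs M A `&` cycs M B = fset0 by rewrite cardfs0 subn0.
apply/fsetP => c; rewrite in_fsetI in_fset0; apply/negP => /andP[/cycsP[x xA ->] /cycsP[y yB e]].
have /fsubsetP s := mcycle_closed (AM x xA) xA cA.
by apply: (fdisjointF d (s y _) yB); rewrite e mem_mcycle ?BM.
Qed.

Lemma cycs_contr_out M A u v : A `<=` pts M -> {in A, forall x, nxt M x \in A} ->
  u \notin A -> v \notin A -> cycs (mcontr M u v) A = cycs M A.
Proof.
move=> /fsubsetP AM cA uA vA; apply: eq_in_imfset => //= x xA.
have /fsubsetP s := mcycle_closed (AM x xA) xA cA.
by apply: mcycle_twist_out; [exact: AM|apply: contra uA; apply: s|apply: contra vA; apply: s].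
Qed.

(** For a merge, count all cycles and cancel those outside [A], which do not change. A cut is a
    merge for the twisted multicycle, where [u] and [v] lie on different cycles. *)
Lemma card_cycs_contr M A u v : A `<=` pts M -> {in A, forall x, nxt M x \in A} ->
  u != v -> u \in A -> v \in A ->
  if v \in mcycle M u then #|` cycs (mcontr M u v) A| = #|` cycs M A|.+1
  else #|` cycs (mcontr M u v) A|.+1 = #|` cycs M A|.
Proof.
move=> AM cA uv uA vA; have /fsubsetP AM' := AM.
have [uM vM] : u \in pts M /\ v \in pts M by split; apply: AM'.
have main M' : pts M' = pts M -> {in A, forall x, nxt M' x \in A} -> v \notin mcycle M' u ->
    #|` cycs (mcontr M' u v) A|.+1 = #|` cycs M' A|.
  move=> eM cA' vu; have [uM' vM'] : u \in pts M' /\ v \in pts M' by rewrite eM.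
  have cA2 : {in A, forall x, nxt (mcontr M' u v) x \in A}.
    move=> x xA; rewrite nxt_mcontr; apply: cA'; rewrite fstpermE.
    by case: eqP => // _; case: eqP.
  have sA : A `|` (pts M' `\` A) = pts M' by apply/fsetP => x; rewrite in_fsetU in_fsetD eM; case: (boolP (x \in A)) => //= /AM'.
  have dA : [disjoint A & pts M' `\` A].
    by apply/fdisjointP => x xA; rewrite inE xA.
  have cB : {in pts M' `\` A, forall x, nxt M' x \in pts M' `\` A}.
    move=> x; rewrite !in_fsetD => /andP[xA xM]; rewrite nxt_pts xM andbT.
    apply: contra xA => nA; have xn : x \in mcycle M' (nxt M' x) by rewrite mcycle_nxt mem_mcycle.
    have nM : nxt M' x \in pts M' by rewrite nxt_pts.
    by have /fsubsetP := mcycle_closed nM nA cA'; apply.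
  have := card_mcycles_merge uM' vM' vu.
  have AM2 : A `<=` pts M' by rewrite eM.
  have BM : pts M' `\` A `<=` pts M' := fsubsetDl _ _.
  have [uB vB] : u \notin pts M' `\` A /\ v \notin pts M' `\` A by rewrite !in_fsetD uA vA.
  move: sA dA cB AM2 BM uB vB; set B := pts M' `\` A => sA dA cB AM2 BM uB vB.
  rewrite -!cycs_pts pts_mcontr // -{1 2}sA !card_cycsU ?pts_mcontr //.
  by rewrite (@cycs_contr_out M' B) // -addSn => /addIn.
case: ifP => [vu|/negbT vu]; last exact: main.
have cA2 : {in A, forall x, nxt (twist M u v) x \in A}.
  by move=> x xA; rewrite nxt_twist; apply: cA; rewrite fstpermE; case: eqP => // _; case: eqP.
have := main (twist M u v) (pts_twist uM vM) cA2 (mcycle_cut uM uv vu).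
by rewrite -[cycs (mcontr _ _ _) _]/(cycs (twist (twist M u v) u v) A) twistK.
Qed.

Section Part.
Variables (M : mcyc K) (D : {fset block}) (pD : part M D).

Lemma block_sub X : X \in D -> X.1 `<=` pts M.
Proof. by move=> XD; apply/fsubsetP => x; apply: part_sub pD _ _ XD. Qed.

Lemma block_closed X : X \in D -> {in X.1, forall x, nxt M x \in X.1}.
Proof. by move=> XD x; apply: part_closed pD _ _ XD. Qed.

Lemma block_disj X Y : X \in D -> Y \in D -> X != Y -> [disjoint X.1 & Y.1].
Proof.
move=> XD YD XY; apply/fdisjointP => x xX; apply/negP => xY.
by case/eqP: XY; apply: part_disj pD _ _ _ XD YD xX xY.
Qed.

Lemma mem_block X x : X \in D -> x \in pts M -> (x \in X.1) = (blk D x == X).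
Proof.
move=> XD xM; apply/idP/eqP => [|<-]; first by move=> xX; apply: (blk_eq pD XD xX).
by case: (blk_in pD xM).
Qed.

End Part.

Lemma mblockC X Y : mblock X Y = mblock Y X.
Proof.
rewrite /mblock fsetUC eq_sym; case: eqP => [->//|_]; by rewrite addnC.
Qed.

(** The block into which [Z] goes when [U] and [V] are united; [fuse2] unites the images of [C] and
    [W] afterwards. Commutation of merges is checked on these, block by block, with no reference to
    points. *)
Definition fuse U V Z : block := if (Z == U) || (Z == V) then mblock U V else Z.
Definition fuse2 U V C W Z : block :=
  fuse (fuse U V C) (fuse U V W) (fuse U V Z).

Lemma fuseC U V Z : fuse U V Z = fuse V U Z.
Proof. by rewrite /fuse orbC mblockC. Qed.

(** In a partition, a union of [U] and another block meets [U] and so is not a third block, see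
    [mblock_neq]. This is all of disjointness that the computations with [fuse] use. *)
Definition sep U V Z := Z != U -> Z != V -> (mblock U V == Z) = false.

Lemma fuse_l U V : fuse U V U = mblock U V.
Proof. by rewrite /fuse eqxx. Qed.

Lemma fuse_r U V : fuse U V V = mblock U V.
Proof. by rewrite /fuse eqxx orbT. Qed.

Lemma fuse_out U V Z : Z != U -> Z != V -> fuse U V Z = Z.
Proof. by rewrite /fuse => /negPf-> /negPf->. Qed.

Lemma mblock_neqE X Y : X != Y -> mblock X Y = (X.1 `|` Y.1, (X.2 + Y.2)%N).
Proof. by rewrite /mblock => /negPf->. Qed.

Lemma mblock_id X : mblock X X = (X.1, X.2.+1).
Proof. by rewrite /mblock eqxx fsetUid. Qed.

(** The weight of the result is the sum over the distinct blocks among the three, plus one for each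
    coincidence, in whichever order they are united. *)
Lemma mblock3C U V W : sep U V W -> sep U W V ->
  mblock (mblock U V) (fuse U V W) = mblock (mblock U W) (fuse U W V).
Proof.
have deg W' : W' != U -> sep U U W' -> mblock (mblock U U) (fuse U U W') = mblock (mblock U W') (fuse U W' U).
  move=> WU h; have m : mblock U U != W' by rewrite h.
  have UW : U != W' by rewrite eq_sym.
  by rewrite fuse_l fuse_out // (mblock_neqE m) !mblock_id (mblock_neqE UW) /= addSn.
move=> h1 h2; have [eV|VU] := eqVneq V U; have [eW|WU] := eqVneq W U.
- by rewrite eV eW.
- by rewrite eV in h1 *; apply: deg.
- by rewrite eW in h2 *; rewrite -deg.
have [<-//|WV] := eqVneq W V; have VW : V != W by rewrite eq_sym.
have [UV UW] : U != V /\ U != W by rewrite !(eq_sym U).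
have m1 : mblock U V != W by rewrite h1.
have m2 : mblock U W != V by rewrite h2.
rewrite !fuse_out // (mblock_neqE m1) (mblock_neqE m2) (mblock_neqE UV) (mblock_neqE UW) /=.
by rewrite fsetUAC addnAC.
Qed.

Lemma fuse2E U V W Z : sep U V W -> sep U V Z ->
  fuse2 U V U W Z = if [|| Z == U, Z == V | Z == W]
    then mblock (mblock U V) (fuse U V W) else Z.
Proof.
move=> h1 h2; rewrite /fuse2 fuse_l.
have [->|ZU] := eqVneq Z U; first by rewrite fuse_l fuse_l.
have [->|ZV] := eqVneq Z V; first by rewrite fuse_r fuse_l.
have [->|ZW] := eqVneq Z W; first by rewrite fuse_r.
have mZ : Z != mblock U V by rewrite eq_sym h2.
by rewrite /= (fuse_out ZU ZV) fuse_out //; rewrite /fuse; case: ifP.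
Qed.

Lemma fuse2_share U V W Z : sep U V W -> sep U V Z -> sep U W V -> sep U W Z ->
  fuse2 U V U W Z = fuse2 U W U V Z.
Proof. by move=> ? ? ? ?; rewrite !fuse2E // mblock3C // (orbC (Z == V)). Qed.

(** If the pairs share a block, symmetry reduces to a shared first entry, [fuse2_share]; otherwise
    the two unions are independent. *)
Lemma fuse2_sym U V C W Z :
  sep U V C -> sep U V W -> sep U V Z -> sep C W U -> sep C W V -> sep C W Z ->
  fuse2 U V C W Z = fuse2 C W U V Z.
Proof.
have sepC X Y Z' : sep X Y Z' -> sep Y X Z' by rewrite /sep mblockC => h ? ?; apply: h.
have sym1 X Y X' Y' : fuse2 X Y X' Y' Z = fuse2 Y X X' Y' Z by rewrite /fuse2 !(fuseC X Y).
have sym2 X Y X' Y' : fuse2 X Y X' Y' Z = fuse2 X Y Y' X' Z by rewrite /fuse2 (fuseC (fuse X Y X')).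
move=> h1C h1W h1Z h2U h2V h2Z.
have [e|CU] := eqVneq C U; first by rewrite e in h1C h2U h2V h2Z *; apply: fuse2_share.
have [e|WU] := eqVneq W U.
  by rewrite e in h1W h2U h2V h2Z *; rewrite sym2 (sym1 C); apply: fuse2_share => //; apply: sepC.
have [e|CV] := eqVneq C V.
  rewrite e in h1C h2U h2V h2Z *; rewrite sym1 (sym2 V W); apply: fuse2_share => //; exact: sepC.
have [e|WV] := eqVneq W V.
  rewrite e in h1W h2U h2V h2Z *; rewrite sym1 sym2 (sym1 C) (sym2 V C).
  by apply: fuse2_share => //; apply: sepC.
have [UC VC UW VW] : [/\ U != C, V != C, U != W & V != W] by rewrite ![_ == C]eq_sym ![_ == W]eq_sym.
rewrite /fuse2 (fuse_out CU CV) (fuse_out WU WV) (fuse_out UC UW) (fuse_out VC VW).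
have [eU|ZU] := eqVneq Z U.
  rewrite eU fuse_l [fuse C W U]fuse_out // fuse_l fuse_out // ?h1C ?h1W //.
have [eV|ZV] := eqVneq Z V.
  by rewrite eV fuse_r [fuse C W V]fuse_out // fuse_r fuse_out // ?h1C ?h1W.
rewrite (fuse_out ZU ZV); have [eC|ZC] := eqVneq Z C.
  by rewrite eC !fuse_l fuse_out // ?h2U ?h2V.
have [eW|ZW] := eqVneq Z W.
  by rewrite eW !fuse_r fuse_out // ?h2U ?h2V.
by rewrite !fuse_out.
Qed.
Lemma mergeE u v D : bmerge u v D = mblock (blk D u) (blk D v) |` (D `\ blk D u `\ blk D v).
Proof. by rewrite bmerge.unlock. Qed.

(** * Uniting the blocks of two points *)

Section Merge.
Variables (M : mcyc K) (D : {fset block}) (pD : part M D) (u v : K).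
Hypotheses (uM : u \in pts M) (vM : v \in pts M).
Let X := blk D u.
Let Y := blk D v.
Let XD : X \in D. Proof. by case: (blk_in pD uM). Qed.
Let YD : Y \in D. Proof. by case: (blk_in pD vM). Qed.
Let uX : u \in X.1. Proof. by case: (blk_in pD uM). Qed.
Let vY : v \in Y.1. Proof. by case: (blk_in pD vM). Qed.

Lemma mem_bmerge Z : (Z \in bmerge u v D) =
  (Z == mblock (blk D u) (blk D v)) || [&& Z != blk D v, Z != blk D u & Z \in D].
Proof. by rewrite mergeE !inE. Qed.

(** The only numerical condition is [part_gen]. A cut keeps g, a merge inside one block raises g by
    1, and a merge of two blocks adds their genera; in the last case [u] and [v] are on different
    cycles automatically. *)
Lemma part_merge : u != v -> part (mcontr M u v) (bmerge u v D).
Proof.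
have mem_bmerge Z : (Z \in bmerge u v D) = (Z == mblock X Y) || [&& Z != Y, Z != X & Z \in D] by exact: mem_bmerge.
move=> uv; have dis Z x : x \in (mblock X Y).1 -> Z != Y -> Z != X -> Z \in D -> x \in Z.1 -> False.
  move=> /= + ZY ZX ZD xZ; rewrite in_fsetU => /orP[] h.
    by case/eqP: ZX; apply: part_disj pD _ _ _ ZD XD xZ h.
  by case/eqP: ZY; apply: part_disj pD _ _ _ ZD YD xZ h.
split.
- move=> Z x; rewrite mem_bmerge pts_mcontr // => /orP[/eqP->|/and3P[_ _ ZD]]; last exact: part_sub pD _ _ ZD.
  by rewrite in_fsetU => /orP[]; [apply: part_sub pD _ _ XD|apply: part_sub pD _ _ YD].
- move=> Z; rewrite mem_bmerge => /orP[/eqP->|/and3P[_ _ ZD]]; last exact: part_ne pD _ ZD.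
  by apply/fset0Pn; exists u; rewrite in_fsetU uX.
- move=> Z x; rewrite mem_bmerge nxt_mcontr fstpermE => /orP[/eqP->|/and3P[ZY ZX ZD]] xZ.
    have [_|xu] := eqVneq x u; first by rewrite in_fsetU (part_closed pD YD) ?orbT.
    have [_|xv] := eqVneq x v; first by rewrite in_fsetU (part_closed pD XD).
    move: xZ; rewrite !in_fsetU => /orP[] xx; first by rewrite (part_closed pD XD).
    by rewrite (part_closed pD YD) ?orbT.
  have [xu|xu] := eqVneq x u.
    by case: (dis Z x) => //; rewrite xu in_fsetU uX.
  have [xv|xv] := eqVneq x v.
    by case: (dis Z x) => //; rewrite xv in_fsetU vY orbT.
  exact: part_closed pD _ _ ZD xZ.
- move=> Z; rewrite mem_bmerge => /orP[/eqP->|/and3P[ZY ZX ZD]]; last first.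
    have [g eg] := part_gen pD ZD; exists g; rewrite eg cycs_contr_out //.
    + exact: block_sub pD _ ZD.
    + exact: block_closed pD _ ZD.
    + by rewrite (mem_block pD) // eq_sym.
    + by rewrite (mem_block pD) // eq_sym.
  have sXY : (mblock X Y).1 `<=` pts M.
    by rewrite fsubUset (block_sub pD XD) (block_sub pD YD).
  have cXY : {in (mblock X Y).1, forall x, nxt M x \in (mblock X Y).1}.
    move=> x; rewrite !in_fsetU => /orP[] xx; first by rewrite (part_closed pD XD).
    by rewrite (part_closed pD YD) ?orbT.
  have [uXY vXY] : u \in (mblock X Y).1 /\ v \in (mblock X Y).1.
    by rewrite !in_fsetU uX vY orbT.
  have := card_cycs_contr sXY cXY uv uXY vXY.
  have [g eg] := part_gen pD XD; have [h eh] := part_gen pD YD.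
  rewrite /mblock /=; case: (eqVneq X Y) => [eXY|nXY].
    rewrite -eXY fsetUid; case: ifP => _ ec.
      by exists g; rewrite eg ec addnS.
    by exists g.+1; rewrite eg -ec; clear; lia.
  rewrite (card_cycsU (block_sub pD XD) (block_sub pD YD) (block_closed pD XD) (block_disj pD XD YD nXY)).
  rewrite ifN; last first.
    by apply: contra nXY => vu; rewrite eq_sym /X -(mem_block pD XD) // (part_mcycle pD XD uX vu).
  by move=> ec; exists (g + h)%N; apply: succn_inj; rewrite -addnS -addSn eg eh -addnS ec; clear; lia.
- move=> Z W x; rewrite !mem_bmerge => /orP[/eqP->|/and3P[ZY ZX ZD]] /orP[/eqP->|/and3P[WY WX WD]] //.
  + by move=> xx xW; case: (dis W x).
  + by move=> xx xW; case: (dis Z x).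
  + exact: part_disj pD _ _ _ ZD WD.
- move=> x; rewrite pts_mcontr // => xM; have [bD xb] := blk_in pD xM.
  have [e|nX] := eqVneq (blk D x) X.
    by exists (mblock X Y); rewrite ?mem_bmerge ?eqxx // in_fsetU -e xb.
  have [e|nY] := eqVneq (blk D x) Y.
    by exists (mblock X Y); rewrite ?mem_bmerge ?eqxx // in_fsetU -e xb orbT.
  by exists (blk D x); rewrite // mem_bmerge nX nY bD orbT.
Qed.

Lemma mblock_neq Z : Z \in D -> Z != blk D u -> Z != blk D v ->
  mblock (blk D u) (blk D v) != Z.
Proof.
move=> ZD ZX _; apply: contra_neq ZX => e; rewrite -/X.
by apply: part_disj pD _ _ _ ZD XD _ uX; rewrite -e in_fsetU uX.
Qed.

Lemma blk_merge x : u != v -> x \in pts M -> blk (bmerge u v D) x =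
  if (blk D x == blk D u) || (blk D x == blk D v) then mblock (blk D u) (blk D v) else blk D x.
Proof.
rewrite -/X -/Y => uv xM; have pm := part_merge uv; have [bD xb] := blk_in pD xM.
case: ifP => [h|/norP[nX nY]]; apply: (blk_eq pm) => //; rewrite ?mem_bmerge ?eqxx ?nX ?nY ?bD ?orbT //.
by rewrite in_fsetU; case/orP: h => /eqP <-; rewrite xb ?orbT.
Qed.

(** Twice the sum of G_i + 1 over the nests, that is, the contribution of the nests to 2G + 2 in the
    definition of the components. *)
Definition sigma D := (\sum_(Z <- D) (2 * Z.2 + 2))%N.

Let sum_same (a n : nat) : (2 * a.+1 + 2 + n = 2 * a + 2 + n + 2)%N.
Proof. clear; lia. Qed.

Let sum_diff (a b n : nat) : (2 * (a + b) + 2 + n + 2 = 2 * a + 2 + (2 * b + 2 + n))%N.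
Proof. clear; lia. Qed.

Lemma sigma_merge : if blk D u == blk D v then sigma (bmerge u v D) = (sigma D + 2)%N
  else (sigma (bmerge u v D) + 2)%N = sigma D.
Proof.
rewrite -/X -/Y /sigma mergeE -/X -/Y big_fsetU1 /=; last first.
  rewrite !in_fsetD1; apply/negP => /and3P[mY mX mD].
  by have := mblock_neq mD mX mY; rewrite eqxx.
case: (eqVneq X Y) => [<-|nXY].
  have -> : D `\ X `\ X = D `\ X by apply/fsetP => Z; rewrite !inE; case: eqP.
  by rewrite (big_fsetD1 X XD); apply: sum_same.
have YDX : Y \in D `\ X by rewrite !inE eq_sym nXY.
by rewrite (big_fsetD1 X XD) (big_fsetD1 Y YDX); apply: sum_diff.
Qed.

End Merge.

(** A partition is determined by the map [blk], and on blocks the iterated merges act by [fuse2]. *)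
Lemma mergeC M D u v c d : part M D -> u \in pts M -> v \in pts M -> c \in pts M -> d \in pts M ->
  u != v -> c != d -> bmerge c d (bmerge u v D) = bmerge u v (bmerge c d D).
Proof.
move=> pD uM vM cM dM uv cd.
have p1 := part_merge pD uM vM uv; have p2 := part_merge pD cM dM cd.
have [p1M p2M] := (pts_mcontr uM vM, pts_mcontr cM dM).
have p12 : part (mcontr (mcontr M u v) c d) (bmerge c d (bmerge u v D)).
  by apply: part_merge => //; rewrite p1M.
have p21 : part (mcontr (mcontr M c d) u v) (bmerge u v (bmerge c d D)).
  by apply: part_merge => //; rewrite p2M.
have e12 : pts (mcontr (mcontr M u v) c d) = pts M by rewrite pts_mcontr p1M.
have e21 : pts (mcontr (mcontr M c d) u v) = pts M by rewrite pts_mcontr p2M.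
apply: (part_ext p12 p21); first by rewrite e12 e21.
rewrite e12 => x xM.
have [c1 d1] : c \in pts (mcontr M u v) /\ d \in pts (mcontr M u v) by rewrite p1M.
have [u2 v2] : u \in pts (mcontr M c d) /\ v \in pts (mcontr M c d) by rewrite p2M.
have x1 : x \in pts (mcontr M u v) by rewrite p1M.
have x2 : x \in pts (mcontr M c d) by rewrite p2M.
rewrite (blk_merge p1 c1 d1 cd x1) (blk_merge p2 u2 v2 uv x2).
rewrite !(blk_merge pD uM vM uv) // !(blk_merge pD cM dM cd) //.
have n1 z : z \in pts M -> blk D z != blk D u -> blk D z != blk D v ->
    (mblock (blk D u) (blk D v) == blk D z) = false.
  move=> zM h1 h2; apply: negPf; apply: (mblock_neq pD) => //; by case: (blk_in pD zM).
have n2 z : z \in pts M -> blk D z != blk D c -> blk D z != blk D d ->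
    (mblock (blk D c) (blk D d) == blk D z) = false.
  move=> zM h1 h2; apply: negPf; apply: (mblock_neq pD) => //; by case: (blk_in pD zM).
rewrite -!/(fuse _ _ _) -!/(fuse2 _ _ _ _ _).
by apply: fuse2_sym => ? ?; rewrite ?n1 ?n2.
Qed.

End Blocks.

(** * Transport of blocks along isomorphisms *)

HB.lock Definition bset (K : choiceType) (M : mcyc K) (r : relabeling K) (A : {fset K}) : {fset K} :=
  \bigcup_(x <- A) on_cycle r (mcycle M x).

HB.lock Definition bmap (K : choiceType) (M : mcyc K) (r : relabeling K) (D : {fset block K}) :
    {fset block K} :=
  [fset ((bset M r X.1, X.2) : block K) | X in D].

Section Maps.
Variable K : choiceType.
Local Notation block := (block K).

Implicit Types (M N T : mcyc K) (u v x y : K) (A B O : {fset K}) (r : relabeling K)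
  (X Y Z U V W C : block) (D E : {fset block}).

(** A relabeling maps cycles to cycles but not points to points, so a block is transported through
    the cycles it consists of. *)
Lemma bsetP M r A y : reflect (exists2 x, x \in A & y \in on_cycle r (mcycle M x)) (y \in bset M r A).
Proof.
rewrite bset.unlock; apply: (iffP (bigfcupP _ _ _ _)).
  by case=> x /andP[xA _] yx; exists x.
by case=> x xA yx; exists x; rewrite ?xA.
Qed.

Lemma bset_ext M r N r' A : {in A, forall x, on_cycle r (mcycle M x) = on_cycle r' (mcycle N x)} ->
  bset M r A = bset N r' A.
Proof.
move=> e; apply/fsetP => y; apply/bsetP/bsetP => -[x xA yx]; exists x => //.
  by rewrite -e.
by rewrite e.
Qed.

Lemma bsetU M r A B : bset M r (A `|` B) = bset M r A `|` bset M r B.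
Proof.
apply/fsetP => y; rewrite in_fsetU; apply/bsetP/orP.
  by case=> x; rewrite in_fsetU => /orP[] xA yx; [left|right]; apply/bsetP; exists x.
by case=> /bsetP[x xA yx]; exists x; rewrite // in_fsetU xA ?orbT.
Qed.

Lemma bmapP M r D Z : reflect (exists2 X, X \in D & Z = (bset M r X.1, X.2)) (Z \in bmap M r D).
Proof. by rewrite bmap.unlock; apply: (iffP (imfsetP _ _ _ _)) => /= -[X XD ->]; exists X. Qed.

Lemma bmap_in M r D X : X \in D -> ((bset M r X.1, X.2) : block) \in bmap M r D.
Proof. by move=> XD; apply/bmapP; exists X. Qed.

Lemma bmap_ext M r N r' D :
  (forall X, X \in D -> bset M r X.1 = bset N r' X.1) -> bmap M r D = bmap N r' D.
Proof.
by move=> e; apply/fsetP => Z; apply/bmapP/bmapP => -[X XD ->]; exists X; rewrite // e.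
Qed.

Lemma bmapU M r D E : bmap M r (D `|` E) = bmap M r D `|` bmap M r E.
Proof.
apply/fsetP => Z; rewrite in_fsetU; apply/bmapP/orP.
  by case=> X; rewrite in_fsetU => /orP[] XD ->; [left|right]; apply: bmap_in.
by case=> /bmapP[X XD ->]; exists X; rewrite // in_fsetU XD ?orbT.
Qed.

Section Relabel.
Variables (M N : mcyc K) (r : relabeling K) (D : {fset block}).
Hypotheses (rMN : mrel M N r) (pD : part M D).

Lemma on_cycle_pt x y : x \in pts M -> y \in on_cycle r (mcycle M x) ->
  y \in pts N /\ on_cycle r (mcycle M x) = mcycle N y.
Proof.
move=> xM yx; have cN := bij_fset_in (mrel_cycle rMN) (mcyclesP xM).
exact: mem_mcycles cN yx.
Qed.

Lemma on_cycle_surj y : y \in pts N -> exists2 x, x \in pts M & y \in on_cycle r (mcycle M x).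
Proof.
move=> yN; have [c /mcyclesE[x xM ->] e] := bij_fset_surj (mrel_cycle rMN) (mcyclesP yN).
by exists x; rewrite // -e mem_mcycle.
Qed.

Lemma mem_bset X x y : X \in D -> x \in pts M -> y \in on_cycle r (mcycle M x) ->
  (y \in bset M r X.1) = (x \in X.1).
Proof.
move=> XD xM yx; apply/bsetP/idP => [[z zX yz]|xX]; last by exists x.
have zM := part_sub pD XD zX.
have e : on_cycle r (mcycle M z) = on_cycle r (mcycle M x).
  by rewrite (on_cycle_pt zM yz).2 (on_cycle_pt xM yx).2.
case: (mrel_cycle rMN) => inj _; have {}e := inj _ _ (mcyclesP zM) (mcyclesP xM) e.
by apply: (part_mcycle pD XD zX); rewrite e mem_mcycle.
Qed.

Lemma cycs_bset X : X \in D -> cycs N (bset M r X.1) = [fset on_cycle r c | c in cycs M X.1].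
Proof.
move=> XD; apply/fsetP => c; apply/cycsP/imfsetP => /= [[y /bsetP[x xX yx] ->]|[d /cycsP[x xX ->] ->]].
  have xM := part_sub pD XD xX; exists (mcycle M x); first exact: mem_cycs.
  by rewrite (on_cycle_pt xM yx).2.
have xM := part_sub pD XD xX.
have /mcyclesE[y yN e] := bij_fset_in (mrel_cycle rMN) (mcyclesP xM).
have yx : y \in on_cycle r (mcycle M x) by rewrite e mem_mcycle.
by exists y; rewrite // (mem_bset XD xM yx).
Qed.

Lemma cycs_mcycles X : X \in D -> {subset cycs M X.1 <= mcycles M}.
Proof. by move=> XD c /cycsP[x xX ->]; apply: mcyclesP; apply: part_sub pD _ _ XD xX. Qed.

Lemma card_cycs_bset X : X \in D -> #|` cycs N (bset M r X.1)| = #|` cycs M X.1|.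
Proof.
move=> XD; rewrite cycs_bset // card_in_imfset //= => c d cX dX.
by case: (mrel_cycle rMN) => inj _; apply: inj; apply: (cycs_mcycles XD).
Qed.

Lemma bset_inj X Y : X \in D -> Y \in D -> bset M r X.1 = bset M r Y.1 -> X = Y.
Proof.
move=> XD YD e; have /fset0Pn[x xX] := part_ne pD XD.
have xM := part_sub pD XD xX.
have /mcyclesE[y yN ey] := bij_fset_in (mrel_cycle rMN) (mcyclesP xM).
have yx : y \in on_cycle r (mcycle M x) by rewrite ey mem_mcycle.
have := mem_bset XD xM yx; rewrite e (mem_bset YD xM yx) xX.
by move=> xY; apply: (part_disj pD XD YD xX xY).
Qed.

Lemma part_map : part N (bmap M r D).
Proof.
split.
- move=> Z y /bmapP[X XD ->] /= /bsetP[x xX yx].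
  by case: (on_cycle_pt (part_sub pD XD xX) yx).
- move=> Z /bmapP[X XD ->] /=; have /fset0Pn[x xX] := part_ne pD XD.
  have xM := part_sub pD XD xX; apply/fset0Pn.
  have /mcyclesE[y yN ey] := bij_fset_in (mrel_cycle rMN) (mcyclesP xM).
  by exists y; apply/bsetP; exists x; rewrite // ey mem_mcycle.
- move=> Z y /bmapP[X XD ->] /= /bsetP[x xX yx]; apply/bsetP; exists x => //.
  have [yN e] := on_cycle_pt (part_sub pD XD xX) yx.
  by rewrite e nxt_mcycle.
- move=> Z /bmapP[X XD ->] /=; have [g eg] := part_gen pD XD.
  by exists g; rewrite card_cycs_bset.
- move=> Z W y /bmapP[X XD ->] /bmapP[Y YD ->] /= /bsetP[x xX yx].
  have xM := part_sub pD XD xX; rewrite (mem_bset YD xM yx) => xY.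
  by rewrite (part_disj pD XD YD xX xY).
- move=> y /on_cycle_surj[x xM yx]; have [bD xb] := blk_in pD xM.
  by exists (bset M r (blk D x).1, (blk D x).2); [apply: bmap_in|apply/bsetP; exists x].
Qed.

Lemma blk_map x y : x \in pts M -> y \in on_cycle r (mcycle M x) ->
  blk (bmap M r D) y = (bset M r (blk D x).1, (blk D x).2).
Proof.
move=> xM yx; have [bD xb] := blk_in pD xM; apply: (blk_eq part_map); first exact: bmap_in.
by apply/bsetP; exists x.
Qed.

Lemma blk_map_input x : x \in inputs M ->
  blk (bmap M r D) (on_open r x) = (bset M r (blk D x).1, (blk D x).2).
Proof.
move=> xM; apply: blk_map; first exact: inputs_pts.
rewrite (mrel_mem rMN) //; apply/mem_mcycle/inputs_pts.
exact: bij_fset_in (mrel_open rMN) _ xM.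
Qed.

Lemma big_bmap (F : nat -> nat) : (\sum_(Z <- bmap M r D) F Z.2 = \sum_(Z <- D) F Z.2)%N.
Proof.
rewrite bmap.unlock big_imfset //= => X Y XD YD [e _]; exact: bset_inj.
Qed.

Lemma sigma_map : sigma (bmap M r D) = sigma D.
Proof. exact: (big_bmap (fun n => 2 * n + 2)%N). Qed.

End Relabel.

Lemma bmap_id M D r : part M D -> {in mcycles M, on_cycle r =1 id} -> bmap M r D = D.
Proof.
move=> pD e; have eb X : X \in D -> bset M r X.1 = X.1.
  move=> XD; apply/fsetP => y; apply/bsetP/idP => [[x xX]|yX].
    have xM := part_sub pD XD xX; rewrite e ?mcyclesP // => yx.
    exact: part_mcycle pD XD xX yx.
  have yM := part_sub pD XD yX.
  by exists y; rewrite // e ?mcyclesP // mem_mcycle.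
apply/fsetP => Z; apply/bmapP/idP => [[X XD ->]|ZD].
  by rewrite eb // -surjective_pairing.
by exists Z; rewrite // eb // -surjective_pairing.
Qed.

Lemma bmap_comp M N T D r r' r'' : mrel M N r -> mrel N T r' -> part M D ->
  {in mcycles M, on_cycle r'' =1 on_cycle r' \o on_cycle r} ->
  bmap M r'' D = bmap N r' (bmap M r D).
Proof.
move=> h h' pD e; have eb X : X \in D -> bset M r'' X.1 = bset N r' (bset M r X.1).
  move=> XD; apply/fsetP => z; apply/bsetP/bsetP => [[x xX]|[y /bsetP[x xX yx]]].
    have xM := part_sub pD XD xX; rewrite e ?mcyclesP //= => zx.
    have /mcyclesE[y yN ey] := bij_fset_in (mrel_cycle h) (mcyclesP xM).
    exists y; last by rewrite -ey.
    by apply/bsetP; exists x; rewrite // ey mem_mcycle.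
  have xM := part_sub pD XD xX; have [yN ey] := on_cycle_pt h xM yx => zy.
  by exists x; rewrite // e ?mcyclesP //= ey.
apply/fsetP => Z; apply/bmapP/bmapP => [[X XD ->]|[Y /bmapP[X XD ->] ->]].
  by exists (bset M r X.1, X.2); rewrite ?bmap_in //= eb.
by exists X; rewrite ?eb.
Qed.

Lemma bmap_cycle_ext M D r r' : part M D -> {in mcycles M, on_cycle r =1 on_cycle r'} ->
  bmap M r D = bmap M r' D.
Proof.
move=> pD e; apply: bmap_ext => X XD; apply: bset_ext => x xX.
by rewrite e ?mcyclesP ?(part_sub pD XD xX).
Qed.

(** The cycles through [u] and [v] differ before and after gluing, but their union does not
    ([mcycle_twistU]), and neither does the union of their images. The united block contains both,
    so only this union matters; all other cycles are mapped as before. *)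
Lemma bmap_merge M N r D u v : mrel M N r -> part M D ->
  u \in inputs M -> v \in inputs M -> u != v ->
  bmap (mcontr M u v) (rel_glue Open u v N r) (bmerge u v D) =
  bmerge (on_open r u) (on_open r v) (bmap M r D).
Proof.
move=> h pD uM vM uv; set u' := on_open r u; set v' := on_open r v; set r' := rel_glue _ _ _ _ _.
have [uMp vMp] := (inputs_pts uM, inputs_pts vM).
have [uN vN] : u' \in inputs N /\ v' \in inputs N.
  by split; apply: bij_fset_in (mrel_open h) _ _.
have [uNp vNp] := (inputs_pts uN, inputs_pts vN).
have pm := part_merge pD uMp vMp uv.
have rcyc w : w \in [:: u; v] -> on_cycle r' (mcycle (mcontr M u v) w) = mcycle (mcontr N u' v') (on_open r w).
  rewrite !inE => /orP[]/eqP->; rewrite /r' /=; first by rewrite mem_mcycle ?pts_mcontr.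
  have vI : v \in mcycle (mcontr M u v) v by rewrite mem_mcycle ?pts_mcontr.
  rewrite vI; case: ifP => // uc; rewrite -/u' -/v'.
  have vin : v \in inputs (twist M u v) by rewrite inputs_twist.
  have := mrel_mem (mrel_twist h uM vM) vin; rewrite /= -[mcycle (twist M u v) v]/(mcycle (mcontr M u v) v) uc.
  by rewrite -/u' -/v'.
have glueU : on_cycle r' (mcycle (mcontr M u v) u) `|` on_cycle r' (mcycle (mcontr M u v) v) =
    on_cycle r (mcycle M u) `|` on_cycle r (mcycle M v).
  by rewrite !rcyc ?inE ?eqxx ?orbT // mcycle_twistU // !(mrel_mem h).
have out x : x \in pts M -> x \notin mcycle M u -> x \notin mcycle M v ->
    on_cycle r' (mcycle (mcontr M u v) x) = on_cycle r (mcycle M x).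
  move=> xM xu xv; have [ux vx] : u \notin mcycle M x /\ v \notin mcycle M x.
    by split; [apply: contra xu|apply: contra xv]; apply: mcycle_sym.
  by rewrite mcycle_twist_out // /r' /= (negPf ux) (negPf vx).
have uvin A y : u \in A -> v \in A ->
    y \in on_cycle r' (mcycle (mcontr M u v) u) `|` on_cycle r' (mcycle (mcontr M u v) v) ->
    y \in bset (mcontr M u v) r' A /\ y \in bset M r A.
  move=> uA vA h1; have := h1; rewrite glueU => h2; split; apply/bsetP.
    by move: h1; rewrite in_fsetU => /orP[] ?; [exists u|exists v].
  by move: h2; rewrite in_fsetU => /orP[] ?; [exists u|exists v].
have in_uv x : x \in pts M -> (x \in mcycle M u) || (x \in mcycle M v) ->
    mcycle (mcontr M u v) x = mcycle (mcontr M u v) u \/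
    mcycle (mcontr M u v) x = mcycle (mcontr M u v) v.
  move=> xM; rewrite -in_fsetU -mcycle_twistU // in_fsetU => /orP[] e; [left|right].
    by rewrite (mcycle_eq _ e) ?pts_mcontr.
  by rewrite (mcycle_eq _ e) ?pts_mcontr.
have eb A : {subset A <= pts M} -> u \in A -> v \in A -> bset (mcontr M u v) r' A = bset M r A.
  move=> AM uA vA; apply/fsetP => y; apply/idP/idP => /bsetP[x xA].
    have [xuv|/norP[xu xv]] := boolP ((x \in mcycle M u) || (x \in mcycle M v)); last first.
      by rewrite out ?AM // => yx; apply/bsetP; exists x.
    move=> yx; case: (uvin A y) => //; rewrite in_fsetU.
    by case: (in_uv x (AM x xA) xuv) => <-; rewrite yx ?orbT.
  have [xuv|/norP[xu xv]] := boolP ((x \in mcycle M u) || (x \in mcycle M v)); last first.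
    by rewrite -out ?AM // => yx; apply/bsetP; exists x.
  move=> yx; case: (uvin A y) => //; rewrite glueU in_fsetU.
  by case/orP: xuv => xx; rewrite -(mcycle_eq _ xx) // yx ?orbT.
have eout X : X \in D -> X != blk D u -> X != blk D v -> bset (mcontr M u v) r' X.1 = bset M r X.1.
  move=> XD Xu Xv; apply: bset_ext => x xX; have xM := part_sub pD XD xX.
  apply: out => //.
    by apply: contra Xu => /(mcycle_sym uMp) ux; rewrite eq_sym -(mem_block pD) // (part_mcycle pD XD xX).
  by apply: contra Xv => /(mcycle_sym vMp) vx; rewrite eq_sym -(mem_block pD) // (part_mcycle pD XD xX).
have [uD uB] := blk_in pD uMp; have [vD vB] := blk_in pD vMp.
have eXY : (bset M r (blk D u).1 == bset M r (blk D v).1) && ((blk D u).2 == (blk D v).2) = (blk D u == blk D v).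
  apply/andP/eqP => [[/eqP e _]|->]; last by rewrite !eqxx.
  exact: (bset_inj h pD uD vD e).
have em : ((bset (mcontr M u v) r' (mblock (blk D u) (blk D v)).1, (mblock (blk D u) (blk D v)).2) : block) =
    mblock (blk (bmap M r D) u') (blk (bmap M r D) v').
  rewrite (blk_map_input h pD uM) (blk_map_input h pD vM) /mblock /= eb; last first.
  - by rewrite in_fsetU vB orbT.
  - by rewrite in_fsetU uB.
  - by move=> x; rewrite in_fsetU => /orP[] xx; [exact: (part_sub pD uD xx)|exact: (part_sub pD vD xx)].
  by rewrite bsetU xpair_eqE eXY.
apply/fsetP => Z; rewrite mem_bmerge -em (blk_map_input h pD uM) (blk_map_input h pD vM).
apply/bmapP/orP => [[X]|].
  rewrite mem_bmerge => /orP[/eqP->|/and3P[XY XU XD]] ->; first by left.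
  right; rewrite eout // bmap_in // andbT; apply/andP; split.
    by apply: contra XY => /eqP[e _]; apply/eqP; apply: (bset_inj h pD XD vD e).
  by apply: contra XU => /eqP[e _]; apply/eqP; apply: (bset_inj h pD XD uD e).
case=> [/eqP->|/and3P[Zv Zu /bmapP[X XD e]]].
  by exists (mblock (blk D u) (blk D v)); rewrite // mem_bmerge eqxx.
have Xu : X != blk D u by apply: contraNneq Zu => <-; rewrite e.
have Xv : X != blk D v by apply: contraNneq Zv => <-; rewrite e.
by exists X; rewrite ?eout // mem_bmerge Xu Xv XD orbT.
Qed.

End Maps.

(** * Genus, gluing and unions at the level of components *)

Section Arities.
Variable K : choiceType.
Local Notation block := (block K).

Implicit Types (M N T : mcyc K) (u v x y : K) (A B O : {fset K}) (r : relabeling K)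
  (X Y Z U V W C : block) (D E : {fset block}) (s t w : arity K) (k l : kind).

(* The genus g of the symbol, as forced by twice the operadic genus. *)
Definition gen t D := ((gen2 t + 2 - (sigma D + #|` clo t|)) %/ 4)%N.

Record ok t D : Prop := Ok {
  ok_part : part (mc t) D;
  ok_gen : (gen2 t + 2 = sigma D + #|` clo t| + 4 * gen t D)%N }.

Lemma okI t D g : part (mc t) D -> (gen2 t + 2 = sigma D + #|` clo t| + 4 * g)%N ->
  ok t D /\ gen t D = g.
Proof.
move=> pD e; have eg : gen t D = g by rewrite /gen e addKn mulKn.
by split=> //; split; rewrite ?eg.
Qed.

Definition bcontr k u v D := if k is Open then bmerge u v D else D.

Lemma clo_tglue k u v t :
  clo (tglue k u v t) = if k is Open then clo t else clo t `\` [fset u; v].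
Proof. by case: k. Qed.

Lemma gen2_tglue k u v t : gen2 (tglue k u v t) = gen2 t.
Proof. by case: k. Qed.

Lemma ok_map s t r D : relabels s t r -> ok s D ->
  ok t (bmap (mc s) r D) /\ gen t (bmap (mc s) r D) = gen s D.
Proof.
move=> /relabelsE[h bC bG] [pD eD]; apply: okI; first exact: part_map.
by rewrite (sigma_map h pD) -(bij_fset_card bC) -bG.
Qed.

Lemma card_fsetD2 (A : {fset K}) u v : u != v -> u \in A -> v \in A ->
  (#|` A `\` [fset u; v]| + 2 = #|` A|)%N.
Proof.
move=> uv uA vA; have sA : [fset u; v] `<=` A.
  by apply/fsubsetP => x; rewrite !inE => /orP[]/eqP->.
have := fsubset_leq_card sA; rewrite cardfsDS // cardfs2 uv => h.
by rewrite subnK.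
Qed.

Lemma part_contr k u v t D : u != v -> u \in ports k t -> v \in ports k t ->
  part (mc t) D -> part (mc (tglue k u v t)) (bcontr k u v D).
Proof.
by case: k => //= uv ut vt pD; apply: part_merge => //; apply: inputs_pts.
Qed.

(** Closed contractions remove two closed inputs, and uniting two blocks removes one summand 2; only
    a contraction inside a block adds. As a contraction raises [gen2] by 2, the term 4g grows by 4
    in the first two cases and by 0 in the last, which gives [ok_contr]. *)
Lemma weight_contr k u v t D : u != v -> u \in ports k t -> v \in ports k t ->
  part (mc t) D ->
  if (k, blk D u == blk D v) is (Open, true)
  then (sigma (bcontr k u v D) + #|` clo (tglue k u v t)| = sigma D + #|` clo t| + 2)%N
  else (sigma (bcontr k u v D) + #|` clo (tglue k u v t)| + 2 = sigma D + #|` clo t|)%N.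
Proof.
case: k => uv ut vt pD; last first.
  by rewrite /= -addnA card_fsetD2.
have := sigma_merge pD (inputs_pts ut) (inputs_pts vt); rewrite /bcontr clo_tglue.
case: (blk D u == blk D v); move: (sigma _) (sigma D) (#|` _|) => a b c; clear; lia.
Qed.

Lemma ok_contr k u v t D : contractible k u v t -> ok t D ->
  ok (tcontr k u v t) (bcontr k u v D) /\
  gen (tcontr k u v t) (bcontr k u v D) =
    (gen t D + if k is Open then blk D u != blk D v : nat else 1)%N.
Proof.
move=> /and3P[uv ut vt] [pD eD].
have := weight_contr uv ut vt pD; have := part_contr uv ut vt pD.
rewrite /tcontr => pD' w; apply: okI => //; first by case: (k) pD'.
move: w; rewrite gen2_tglue /= !clo_tglue addSn addSn eD /=.
move: (sigma _) (sigma D) (#|` _|) (#|` _|) (gen t D) => a b c d g.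
case: (k) => /=; last by clear; lia.
by case: (_ == _); clear; lia.
Qed.

Lemma sigmaU M N D E : [disjoint pts M & pts N] -> part M D -> part N E ->
  sigma (D `|` E) = (sigma D + sigma E)%N.
Proof.
move=> d pD pE; rewrite /sigma (big_fsetID _ (mem D)) /=; congr (_ + _)%N; apply: eq_fbigl => X.
  by rewrite !inE /= andb_orl andbb; case: (X \in D); rewrite ?orbT ?andbF.
rewrite !inE /=; case: (boolP (X \in D)) => XD; last by rewrite andbT.
rewrite andbF; apply/esym/negP => XE; have [x xM e] := block_pt pD XD.
have [_ xX] := blk_in pD xM; rewrite -e in xX.
exact: fdisjointF d xM (part_sub pE XE xX).
Qed.

Lemma part_union M N D E : [disjoint pts M & pts N] -> part M D -> part N E ->
  part (munion M N) (D `|` E).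
Proof.
move=> d pD pE.
have cM X : X \in D -> cycs (munion M N) X.1 = cycs M X.1.
  move=> XD; apply: eq_in_imfset => //= x xX.
  by rewrite mcycle_munionl // (part_sub pD XD xX).
have cN X : X \in E -> cycs (munion M N) X.1 = cycs N X.1.
  move=> XE; apply: eq_in_imfset => //= x xX.
  by rewrite mcycle_munionr // (part_sub pE XE xX).
split.
- move=> X x; rewrite !in_fsetU => /orP[XD|XE] xX.
    by rewrite (part_sub pD XD xX).
  by rewrite (part_sub pE XE xX) orbT.
- by move=> X; rewrite in_fsetU => /orP[XD|XE]; [exact: (part_ne pD XD)|exact: (part_ne pE XE)].
- move=> X x; rewrite in_fsetU => /orP[XD|XE] xX.
    by rewrite nxt_munionl ?(part_closed pD XD xX) ?(part_sub pD XD xX).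
  by rewrite nxt_munionr ?(part_closed pE XE xX) ?(part_sub pE XE xX).
- move=> X; rewrite in_fsetU => /orP[XD|XE].
    by rewrite cM //; exact: (part_gen pD XD).
  by rewrite cN //; exact: (part_gen pE XE).
- move=> X Y x; rewrite !in_fsetU => /orP[XD|XE] /orP[YD|YE] xX xY.
  + exact: (part_disj pD XD YD xX xY).
  + by case: (fdisjointF d (part_sub pD XD xX) (part_sub pE YE xY)).
  + by case: (fdisjointF d (part_sub pD YD xY) (part_sub pE XE xX)).
  + exact: (part_disj pE XE YE xX xY).
- move=> x; rewrite in_fsetU => /orP[xM|xN].
    by have [X XD xX] := part_cover pD xM; exists X; rewrite // in_fsetU XD.
  by have [X XE xX] := part_cover pE xN; exists X; rewrite // in_fsetU XE orbT.
Qed.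

Lemma blk_unionl M N D E x : [disjoint pts M & pts N] -> part M D -> part N E ->
  x \in pts M -> blk (D `|` E) x = blk D x.
Proof.
move=> d pD pE xM; have [bD xb] := blk_in pD xM.
by apply: (blk_eq (part_union d pD pE)) => //; rewrite in_fsetU bD.
Qed.

Lemma blk_unionr M N D E x : [disjoint pts M & pts N] -> part M D -> part N E ->
  x \in pts N -> blk (D `|` E) x = blk E x.
Proof.
move=> d pD pE xM; have [bD xb] := blk_in pE xM.
by apply: (blk_eq (part_union d pD pE)) => //; rewrite in_fsetU bD orbT.
Qed.

Lemma blk_union_neq M N D E x y : [disjoint pts M & pts N] -> part M D -> part N E ->
  x \in pts M -> y \in pts N -> blk (D `|` E) x != blk (D `|` E) y.
Proof.
move=> d pD pE xM yN; rewrite (blk_unionl d pD pE) // (blk_unionr d pD pE) //.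
apply/eqP => e; have [bD xb] := blk_in pD xM; have [bE yb] := blk_in pE yN.
by rewrite e in xb; apply: fdisjointF d xM (part_sub pE bE xb).
Qed.

Lemma card_fsetU_disj (A B : {fset K}) : [disjoint A & B] -> #|` A `|` B| = (#|` A| + #|` B|)%N.
Proof. by rewrite -fsetI_eq0 => /eqP e; rewrite cardfsU e cardfs0 subn0. Qed.

Lemma joinable_neq k u v s t : joinable k u v s t ->
  [/\ u != v, u \in ports k (tunion s t) & v \in ports k (tunion s t)].
Proof.
case/and4P => dO dC us vt.
have d : [disjoint ports k s & ports k t] by case: (k) => //; apply: disjoint_inputs.
split; first by apply/eqP => e; rewrite -e in vt; apply: fdisjointF d us vt.
  by case: (k) us => /= h; rewrite in_fsetU h.
by case: (k) vt => /= h; rewrite in_fsetU h orbT.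
Qed.

(** Adding the two equations for [gen2] leaves an excess of 2, which is what the gluing removes: the
    glued inputs never lie in one block, as they come from disjoint multicycles. Hence the genera
    add up. *)
Lemma ok_join k u v s t D E : joinable k u v s t -> ok s D -> ok t E ->
  ok (tjoin k u v s t) (bcontr k u v (D `|` E)) /\
  gen (tjoin k u v s t) (bcontr k u v (D `|` E)) = (gen s D + gen t E)%N.
Proof.
move=> j [pD eD] [pE eE]; have [uv uU vU] := joinable_neq j.
case/and4P: j => dO dC us vt; have pU := part_union dO pD pE.
have := weight_contr (t := tunion s t) uv uU vU pU.
have := part_contr (t := tunion s t) uv uU vU pU.
rewrite /tjoin => pD' w; apply: okI => //.
move: w; rewrite gen2_tglue /= (sigmaU dO pD pE) card_fsetU_disj //.
have nb : k = Open -> (blk (D `|` E) u == blk (D `|` E) v) = false.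
  move=> ek; rewrite ek in us vt; apply/negbTE.
  by apply: (blk_union_neq dO pD pE); apply: inputs_pts.
move=> w; have {}w : (sigma (bcontr k u v (D `|` E)) + #|` clo (tglue k u v (tunion s t))| + 2
    = sigma D + sigma E + (#|` clo s| + #|` clo t|))%N.
  by case: (k) nb w => [/(_ erefl)->|].
move: w eD eE; move: (sigma _) (sigma _) (sigma _) (#|` _|) (#|` _|) (#|` _|) (gen s D) (gen t E).
by move: (gen2 s) (gen2 t) => a b c d e f g h i j; clear; lia.
Qed.

Lemma relabels_glue k u v s t r : relabels s t r -> u != v ->
  u \in ports k s -> v \in ports k s ->
  relabels (tglue k u v s) (tglue k (on_port k r u) (on_port k r v) t) (rel_glue k u v (mc t) r).
Proof.
move=> /relabelsE[h bC bG] uv us vs; apply/relabelsE; case: k us vs => /= us vs.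
  by split=> //; apply: mrel_contr.
split=> //; have [injC _] := bC; apply: bij_fsetI => [x|x y|y].
- rewrite !inE negb_or => /andP[/andP[xu xv] xs]; rewrite (bij_fset_in bC) // andbT.
  by rewrite negb_or; apply/andP; split; [apply: contra_neq xu|apply: contra_neq xv] => e; apply: injC.
- by rewrite !inE => /andP[_ ?] /andP[_ ?]; apply: injC.
- rewrite !inE negb_or => /andP[/andP[yu yv] yt]; have [x xs e] := bij_fset_surj bC yt.
  exists x => //; rewrite !inE xs andbT negb_or.
  by apply/andP; split; [apply: contraNneq yu|apply: contraNneq yv] => <-; rewrite e.
Qed.

Lemma relabels_contr k u v s t r : relabels s t r -> contractible k u v s ->
  contractible k (on_port k r u) (on_port k r v) t /\
  relabels (tcontr k u v s) (tcontr k (on_port k r u) (on_port k r v) t) (rel_glue k u v (mc t) r).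
Proof.
move=> h /and3P[uv us vs]; have [ho bC bG] := (relabelsE _ _ _).1 h.
have bk : bij_fset (on_port k r) (ports k s) (ports k t) by case: (k) => //; apply: mrel_open.
split.
  rewrite /contractible !(bij_fset_in bk) // !andbT; case: bk => inj _.
  by apply: contra_neq uv => e; apply: inj.
apply: (relabels_glue (s := Arity (mc s) (clo s) (gen2 s).+2) (t := Arity (mc t) (clo t) (gen2 t).+2)).
- by apply/relabelsE; split=> //=; rewrite bG.
- exact: uv.
- by case: (k) us.
- by case: (k) vs.
Qed.

Lemma relabels_union s s' t t' r r' : relabels s s' r -> relabels t t' r' ->
  [disjoint pts (mc s) & pts (mc t)] -> [disjoint clo s & clo t] ->
  [disjoint pts (mc s') & pts (mc t')] -> [disjoint clo s' & clo t'] ->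
  relabels (tunion s t) (tunion s' t') (rel_union s r r').
Proof.
move=> /relabelsE[h bC bG] /relabelsE[h' bC' bG'] d dC d' dC'; apply/relabelsE; split.
- exact: mrel_union.
- exact: bij_fsetU.
- by rewrite /= bG bG'.
Qed.

Lemma on_port_union k u v s t r r' : joinable k u v s t ->
  on_port k (rel_union s r r') u = on_port k r u /\
  on_port k (rel_union s r r') v = on_port k r' v.
Proof.
case/and4P => dO dC us vt; case: k us vt => /= us vt; rewrite us; split=> //; rewrite ifN //.
  by apply/negP => vs; apply: fdisjointF (disjoint_inputs dO) vs vt.
by apply/negP => vs; apply: fdisjointF dC vs vt.
Qed.

Lemma relabels_join k u v s s' t t' r r' : relabels s s' r -> relabels t t' r' ->
  joinable k u v s t -> joinable k (on_port k r u) (on_port k r' v) s' t' ->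
  relabels (tjoin k u v s t) (tjoin k (on_port k r u) (on_port k r' v) s' t')
    (rel_glue k u v (munion (mc s') (mc t')) (rel_union s r r')).
Proof.
move=> h h' j /and4P[dO' dC' _ _]; have [uv uU vU] := joinable_neq j.
have [eu ev] := on_port_union r r' j; case/and4P: j => dO dC us vt.
have := relabels_glue (relabels_union h h' dO dC dO' dC') uv uU vU.
by rewrite eu ev.
Qed.

Lemma bset_unionl s N r r' A : [disjoint pts (mc s) & pts N] -> {subset A <= pts (mc s)} ->
  bset (munion (mc s) N) (rel_union s r r') A = bset (mc s) r A.
Proof.
move=> d sA; apply: bset_ext => x /sA xs; rewrite mcycle_munionl //= ifT //.
exact: mcyclesP.
Qed.

Lemma bset_unionr s N r r' A : [disjoint pts (mc s) & pts N] -> {subset A <= pts N} ->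
  bset (munion (mc s) N) (rel_union s r r') A = bset N r' A.
Proof.
move=> d sA; apply: bset_ext => x /sA xs; rewrite mcycle_munionr //= ifF //.
by apply: (mcycles_disj d); apply: mcyclesP.
Qed.

Lemma bmap_union s t r r' D E : [disjoint pts (mc s) & pts (mc t)] ->
  part (mc s) D -> part (mc t) E ->
  bmap (munion (mc s) (mc t)) (rel_union s r r') (D `|` E) =
  bmap (mc s) r D `|` bmap (mc t) r' E.
Proof.
move=> d pD pE; rewrite bmapU; congr (_ `|` _); apply: bmap_ext => X XD.
  by apply: bset_unionl => // x; apply: part_sub pD _ _ XD.
by apply: bset_unionr => // x; apply: part_sub pE _ _ XD.
Qed.

Lemma bmap_glue k u v s t r D : relabels s t r -> u != v -> u \in ports k s -> v \in ports k s ->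
  part (mc s) D ->
  bmap (mc (tglue k u v s)) (rel_glue k u v (mc t) r) (bcontr k u v D) =
  bcontr k (on_port k r u) (on_port k r v) (bmap (mc s) r D).
Proof.
by move=> /relabelsE[h _ _]; case: k => // uv us vs pD; apply: bmap_merge.
Qed.

Lemma bmap_contr k u v s t r D : relabels s t r -> contractible k u v s -> part (mc s) D ->
  bmap (mc (tcontr k u v s)) (rel_glue k u v (mc t) r) (bcontr k u v D) =
  bcontr k (on_port k r u) (on_port k r v) (bmap (mc s) r D).
Proof.
move=> h /and3P[uv us vs] pD; rewrite -(bmap_glue h uv us vs pD).
by case: (k).
Qed.

Lemma bmap_join k u v s s' t t' r r' D E : relabels s s' r -> relabels t t' r' ->
  joinable k u v s t -> joinable k (on_port k r u) (on_port k r' v) s' t' ->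
  part (mc s) D -> part (mc t) E ->
  bmap (mc (tjoin k u v s t)) (rel_glue k u v (munion (mc s') (mc t')) (rel_union s r r'))
    (bcontr k u v (D `|` E)) =
  bcontr k (on_port k r u) (on_port k r' v) (bmap (mc s) r D `|` bmap (mc t) r' E).
Proof.
move=> h h' j /and4P[dO' dC' _ _] pD pE; have [uv uU vU] := joinable_neq j.
have [eu ev] := on_port_union r r' j; case/and4P: j => dO dC us vt.
have hU := relabels_union h h' dO dC dO' dC'.
rewrite -(bmap_union r r' dO pD pE) -eu -ev.
exact: (bmap_glue hU uv uU vU (part_union dO pD pE)).
Qed.

Lemma bcontr_sym k u v D : bcontr k u v D = bcontr k v u D.
Proof.
case: k => //=; rewrite !mergeE mblockC; congr (_ |` _).
by apply/fsetP => X; rewrite !inE andbCA.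
Qed.

Lemma bcontrC k l u v c d t D : part (mc t) D -> u != v -> c != d ->
  u \in ports k t -> v \in ports k t -> c \in ports l t -> d \in ports l t ->
  bcontr k u v (bcontr l c d D) = bcontr l c d (bcontr k u v D).
Proof.
case: k; case: l => //= pD uv cd uM vM cM dM.
by apply: (mergeC pD) => //; apply: inputs_pts.
Qed.

Lemma bmerge_unionl M N D E u v : [disjoint pts M & pts N] -> part M D -> part N E ->
  u \in pts M -> v \in pts M -> bmerge u v (D `|` E) = bmerge u v D `|` E.
Proof.
move=> d pD pE uM vM; rewrite !mergeE !(blk_unionl d pD pE) // -fsetUA; congr (_ `|` _).
have nE x : x \in pts M -> blk D x \notin E.
  move=> xM; have [bD xb] := blk_in pD xM; apply/negP => bE.
  exact: fdisjointF d xM (part_sub pE bE xb).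
apply/fsetP => X; rewrite !inE.
case: (eqVneq X (blk D u)) => [->|_]; first by rewrite (negPf (nE u uM)) !andbF.
by case: (eqVneq X (blk D v)) => [->|_]; first by rewrite (negPf (nE v vM)).
Qed.

End Arities.

(** * The modular hybrid of symbols *)

Section Symbols.
Variable K : choiceType.
Local Notation block := (block K).
Local Notation nest := (nest K).

Implicit Types (M N T : mcyc K) (u v x y : K) (A B O : {fset K}) (r : relabeling K)
  (X Y Z U C : block) (V W : nest) (D E : {fset block}) (s t w : arity K) (k l : kind)
  (P Q : {fset {fset K}}).

Lemma pts_msub M P : pts (msub M P) = [fset x in pts M | mcycle M x \in P].
Proof. by []. Qed.

Lemma mem_pts_msub M P x : (x \in pts (msub M P)) = (x \in pts M) && (mcycle M x \in P).
Proof. by rewrite pts_msub !inE. Qed.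

Lemma inputs_msub M P x : (x \in inputs (msub M P)) = (x \in inputs M) && (mcycle M x \in P).
Proof.
rewrite in_fsetI -/(pts (msub M P)) mem_pts_msub.
by case: (boolP (x \in inputs M)) => //= /inputs_pts ->.
Qed.

Lemma nxt_msub M P x : x \in pts (msub M P) -> nxt (msub M P) x = nxt M x.
Proof. by move=> xP; rewrite /nxt /= fsfunE -/(pts (msub M P)) xP. Qed.

Lemma mcycle_msub M P x : x \in pts (msub M P) -> mcycle (msub M P) x = mcycle M x.
Proof.
move=> xP; have := xP; rewrite mem_pts_msub => /andP[xM cP].
apply/esym/mcycle_agree => // y yx; rewrite nxt_msub //.
by rewrite mem_pts_msub (mem_mcycle_pts xM yx) (mcycle_eq xM yx).
Qed.

Lemma mcycles_msub M P : mcycles (msub M P) = P `&` mcycles M.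
Proof.
apply/fsetP => c; rewrite in_fsetI; apply/idP/andP => [/mcyclesE[x xP ->]|[cP /mcyclesE[x xM e]]].
  by rewrite mcycle_msub //; move: xP; rewrite mem_pts_msub => /andP[xM ->]; rewrite mcyclesP.
have xP : x \in pts (msub M P) by rewrite mem_pts_msub xM -e.
by rewrite e -(mcycle_msub xP) mcyclesP.
Qed.

Lemma msub_eq M A T : {subset A <= pts M} -> {in A, forall x, nxt M x \in A} ->
  pts T = A -> {in A, forall x, (x \in inputs T) = (x \in inputs M)} ->
  {in A, nxt T =1 nxt M} -> msub M (cycs M A) = T.
Proof.
move=> sA cA eT iT nT; have eA : pts (msub M (cycs M A)) = A.
  apply/fsetP => x; rewrite mem_pts_msub; apply/andP/idP => [[xM /cycsP[y yA e]]|xA].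
    have /fsubsetP := mcycle_closed (sA y yA) yA cA; apply.
    by rewrite -e mem_mcycle.
  by rewrite sA // mem_cycs.
apply: mcyc_eq => [||x]; first by rewrite eA.
  apply/fsetP => x; have [xA|xA] := boolP (x \in A); first by rewrite iT // inputs_msub mem_cycs ?andbT.
  have [-> ->//] : x \in inputs T = false /\ x \in inputs (msub M (cycs M A)) = false.
  by split; apply: contraNF xA => /inputs_pts; rewrite ?eT ?eA.
have [xA|xA] := boolP (x \in A); first by rewrite nT // nxt_msub ?eA.
by rewrite !nxt_out ?eA ?eT.
Qed.

(** [toN] and [ofN] are the dictionary between blocks and nests; the genus is solved for in G + 1 =
    2g + b. *)
Definition toN M X : nest := (msub M (cycs M X.1), (X.2.+1 - #|` cycs M X.1|)./2).
Definition ofN V : block := (pts V.1, nestG V).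

Section Part.
Variables (M : mcyc K) (D : {fset block}) (pD : part M D).

Lemma pts_toN X : X \in D -> pts (toN M X).1 = X.1.
Proof.
move=> XD; apply/fsetP => x; rewrite mem_pts_msub; apply/andP/idP => [[xM /cycsP[y yX e]]|xX].
  by apply: (part_mcycle pD XD yX); rewrite -e mem_mcycle.
by rewrite (part_sub pD XD xX) mem_cycs.
Qed.

Lemma mcycles_toN X : X \in D -> mcycles (toN M X).1 = cycs M X.1.
Proof.
by move=> XD; rewrite mcycles_msub; apply/fsetIidPl/fsubsetP; apply: (cycs_mcycles pD XD).
Qed.

Lemma cycs_gt0 X : X \in D -> (0 < #|` cycs M X.1|)%N.
Proof.
move=> XD; have /fset0Pn[x xX] := part_ne pD XD.
by rewrite cardfs_gt0; apply/fset0Pn; exists (mcycle M x); apply: mem_cycs.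
Qed.

Lemma toN_gen X g : X.2.+1 = (2 * g + #|` cycs M X.1|)%N -> (toN M X).2 = g.
Proof. by move=> e; rewrite /= e addnK mul2n doubleK. Qed.

Lemma nestG_toN X : X \in D -> nestG (toN M X) = X.2.
Proof.
move=> XD; have [g eg] := part_gen pD XD; rewrite /nestG mcycles_toN // (toN_gen eg) -eg.
by rewrite subn1.
Qed.

Lemma toNK X : X \in D -> ofN (toN M X) = X.
Proof. by move=> XD; rewrite /ofN pts_toN // nestG_toN // -surjective_pairing. Qed.

Lemma ofN_toN : [fset ofN V | V in [fset toN M X | X in D]] = D.
Proof.
apply/fsetP => X; apply/imfsetP/idP => /= [[V /imfsetP[Y /= YD ->] ->]|XD].
  by rewrite toNK.
by exists (toN M X); rewrite ?toNK //; apply/imfsetP; exists X.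
Qed.

Lemma toN_inj : {in D &, injective (toN M)}.
Proof. by move=> X Y XD YD e; rewrite -(toNK XD) e toNK. Qed.

Lemma decomposition_toN : decomposition M [fset toN M X | X in D].
Proof.
apply/and3P; split.
- apply/allP => V /imfsetP[X /= XD ->]; rewrite mcycles_toN // eqxx /=.
  by rewrite -cardfs_gt0 cycs_gt0.
- apply/allP => V /imfsetP[X /= XD ->]; apply/allP => W /imfsetP[Y /= YD ->].
  have [->|XY] := eqVneq X Y; first by rewrite eqxx.
  apply/orP; right; rewrite !mcycles_toN //; apply/fdisjointP => c /cycsP[x xX ->].
  apply/negP => /cycsP[y yY e]; case/eqP: XY; apply: (part_disj pD XD YD xX).
  by apply: (part_mcycle pD YD yY); rewrite -e mem_mcycle // (part_sub pD XD xX).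
- apply/eqP/fsetP => c; apply/bigfcupP/idP => [[V /andP[/imfsetP[X /= XD ->] _]]|].
    by rewrite mcycles_toN // => /(cycs_mcycles pD XD).
  case/mcyclesE => x xM ->; have [X XD xX] := part_cover pD xM.
  exists (toN M X); last by rewrite mcycles_toN // mem_cycs.
  by rewrite andbT; apply/imfsetP; exists X.
Qed.

Lemma sum_toN : (\sum_(V <- [fset toN M X | X in D]) nestG V = \sum_(X <- D) X.2)%N.
Proof.
rewrite big_imfset /=; last exact: toN_inj.
by rewrite big_seq [RHS]big_seq; apply: eq_bigr => X; apply: nestG_toN.
Qed.

Lemma sigmaE : (sigma D = 2 * (\sum_(X <- D) X.2) + 2 * #|` D|)%N.
Proof.
by rewrite /sigma big_split /= -big_distrr /= big_const_seq count_predT iter_addn_0.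
Qed.

End Part.

Lemma card_toN M D : part M D -> #|` [fset toN M X | X in D]| = #|` D|.
Proof. by move=> pD; rewrite card_in_imfset //; apply: toN_inj pD. Qed.

Definition symbol_of t D : symbol K := ([fset toN (mc t) X | X in D], gen t D, clo t).

Fact symbol_of_mem t D : ok t D -> ModOC_mem t (symbol_of t D).
Proof.
move=> [pD eD]; rewrite /ModOC_mem /= decomposition_toN // eqxx /=; apply/eqP.
rewrite eD (sigmaE D) sum_toN // card_toN //.
by move: (\sum_(_ <- _) _)%N (#|` _|) (#|` _|) (gen t D) => a b c d; clear; lia.
Qed.

Definition toM t D (o : ok t D) : ModOC t := exist (ModOC_mem t) _ (symbol_of_mem o).

Section Decomposition.
Variables (M : mcyc K) (Ds : {fset nest}).
Hypothesis dec : decomposition M Ds.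

Lemma dec_msub V : V \in Ds -> V.1 = msub M (mcycles V.1).
Proof. by case/and3P: dec => /allP h _ _ /h /andP[/eqP]. Qed.

Lemma dec_sub V : V \in Ds -> mcycles V.1 `<=` mcycles M.
Proof. by move=> VD; rewrite (dec_msub VD) mcycles_msub fsubsetIr. Qed.

Lemma dec_gt0 V : V \in Ds -> (0 < #|` mcycles V.1|)%N.
Proof. by rewrite cardfs_gt0; case/and3P: dec => /allP h _ _ /h /andP[_]. Qed.

Lemma dec_cycs V : V \in Ds -> cycs M (pts V.1) = mcycles V.1.
Proof.
move=> VD; apply/fsetP => c; apply/cycsP/idP => [[x xV ->]|cV].
  by rewrite (dec_msub VD) mem_pts_msub in xV; case/andP: xV.
have /mcyclesE[x xM e] := fsubsetP (dec_sub VD) c cV.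
by exists x; rewrite // (dec_msub VD) mem_pts_msub xM -e.
Qed.

Lemma ofNK V : V \in Ds -> toN M (ofN V) = V.
Proof.
move=> VD; rewrite /toN /= dec_cycs // -(dec_msub VD) /nestG.
have -> : ((2 * V.2 + #|` mcycles V.1| - 1).+1 - #|` mcycles V.1| = V.2.*2)%N.
  by move: (dec_gt0 VD); move: (#|` _|) (V.2) => a b; clear; lia.
by rewrite doubleK -surjective_pairing.
Qed.

Lemma part_ofN : part M [fset ofN V | V in Ds].
Proof.
have msubP V x : V \in Ds -> x \in pts V.1 -> x \in pts M /\ mcycle M x \in mcycles V.1.
  by move=> VD; rewrite {1}(dec_msub VD) mem_pts_msub => /andP.
split.
- by move=> X x /imfsetP[V /= VD ->] /(msubP V x VD)[].
- move=> X /imfsetP[V /= VD ->] /=; have := dec_gt0 VD.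
  rewrite cardfs_gt0 => /fset0Pn[c /mcyclesE[x xV _]]; apply/fset0Pn; by exists x.
- move=> X x /imfsetP[V /= VD ->] /= /(msubP V x VD)[xM cV].
  by rewrite (dec_msub VD) mem_pts_msub nxt_pts mcycle_nxt xM.
- move=> X /imfsetP[V /= VD ->] /=; exists V.2; rewrite dec_cycs // /nestG.
  by move: (dec_gt0 VD); move: (#|` _|) (V.2) => a b; clear; lia.
- move=> X Y x /imfsetP[V /= VD ->] /imfsetP[W /= WD ->] /= xV xW.
  have [xM cV] := msubP V x VD xV; have [_ cW] := msubP W x WD xW.
  case/and3P: (dec) => _ /allP/(_ V VD)/allP/(_ W WD)/orP[/eqP->//|d _].
  by case: (fdisjointF d cV cW).
- move=> x xM; have := mcyclesP xM; case/and3P: (dec) => _ _ /eqP <-.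
  case/bigfcupP => V /andP[VD _] cV; exists (ofN V); first by apply/imfsetP; exists V.
  by rewrite /= (dec_msub VD) mem_pts_msub xM.
Qed.

Lemma ofN_inj : {in Ds &, injective ofN}.
Proof. by move=> V W VD WD e; rewrite -(ofNK VD) e ofNK. Qed.

Lemma toN_ofN : [fset toN M X | X in [fset ofN V | V in Ds]] = Ds.
Proof.
apply/fsetP => V; apply/imfsetP/idP => /= [[X /imfsetP[W /= WD ->] ->]|VD].
  by rewrite ofNK.
by exists (ofN V); rewrite ?ofNK //; apply/imfsetP; exists V.
Qed.

End Decomposition.

Definition blocks t (x : ModOC t) : {fset block} := [fset ofN V | V in nests x].

Lemma dec_nests t (x : ModOC t) : decomposition (mc t) (nests x).
Proof. by case: x => [[[Ds g] C] h] /=; case/and3P: (h). Qed.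

Lemma blocks_ok t (x : ModOC t) : ok t (blocks x) /\ gen t (blocks x) = genus x.
Proof.
have dx := dec_nests x; apply: okI; first exact: part_ofN.
have := valP x; rewrite /genus /symb /blocks /nests /symb; move: dx; rewrite /nests /symb.
case: (val x) => [[Ds g] C] /= dx /and3P[_ /eqP-> /eqP->].
rewrite sigmaE big_imfset /=; last exact: ofN_inj dx.
rewrite card_in_imfset /=; last exact: ofN_inj dx.
by move: (\sum_(_ <- _) _)%N (#|` _|) (#|` _|) => a b c; clear; lia.
Qed.

Lemma blocks_toM t D (o : ok t D) : blocks (toM o) = D.
Proof. exact: (ofN_toN (ok_part o)). Qed.

(** Within a component the closed inputs are fixed and the genus is forced by the equation for
    [gen2], so the blocks determine the symbol. All axioms are reduced to blocks by this. *)
Lemma ModOC_ext t (x y : ModOC t) : blocks x = blocks y -> x = y.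
Proof.
move=> e; have [_ gx] := blocks_ok x; have [_ gy] := blocks_ok y.
have en : nests x = nests y.
  by rewrite -(toN_ofN (dec_nests x)) -(toN_ofN (dec_nests y)) -/(blocks x) e.
have eg : genus x = genus y by rewrite -gx -gy e.
have ec (z : ModOC t) : symb z = (nests z, genus z, clo t).
  by rewrite /nests /genus /symb; case: z => [[[Ds g] C] h] /=; case/and3P: (h) => _ /eqP->.
by apply: val_inj; rewrite -!/(symb _) !ec en eg.
Qed.

Lemma ModOC_heq s t (x : ModOC s) (y : ModOC t) : s = t -> blocks x = blocks y ->
  existT (@ModOC K) s x = existT (@ModOC K) t y.
Proof. by move=> e; case: t / e y => y e; rewrite (ModOC_ext e). Qed.

End Symbols.

(** * The structure operations and their axioms *)

Section Structure.
Variable K : choiceType.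
Local Notation block := (block K).

Implicit Types (M N T : mcyc K) (u v x y a b c d : K) (A B O : {fset K}) (r : relabeling K)
  (D E F : {fset block}) (s t w : arity K) (k l : kind).

(** A contraction is gluing at the index with operadic genus raised by 1. As [up] commutes with
    [tglue], identities between indices reduce to identities between gluings. *)
Definition up t : arity K := Arity (mc t) (clo t) (gen2 t).+2.

Lemma tcontrE k u v t : tcontr k u v t = tglue k u v (up t).
Proof. by []. Qed.

Lemma tglue_up k u v t : tglue k u v (up t) = up (tglue k u v t).
Proof. by case: k. Qed.

Lemma tglueC k l u v c d t : (k = l -> [&& u != c, u != d, v != c & v != d]) ->
  tglue k u v (tglue l c d t) = tglue l c d (tglue k u v t).
Proof.
case: k; case: l => h //.
  case/and4P: (h erefl) => uc ud vc vd; rewrite /tglue /= mcontrC // eq_sym //.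
by apply: arity_eq => //=; rewrite !fsetDDl fsetUC.
Qed.

Lemma ports_tglue k l u v t : ports k (tglue l u v t) `<=` ports k t.
Proof.
by case: k; case: l => //=; apply: fsubsetDl.
Qed.

Lemma ports_tglueE k u v t : ports k (tglue k u v t) = ports k t `\` [fset u; v].
Proof. by case: k. Qed.

Lemma tglueUl k u v s t : u \in ports k s -> v \in ports k s ->
  [disjoint pts (mc s) & pts (mc t)] -> [disjoint clo s & clo t] ->
  tunion (tglue k u v s) t = tglue k u v (tunion s t).
Proof.
case: k => /= us vs d dC; apply: arity_eq => //=.
  by rewrite mcontr_munionl //; apply/negP; apply: fdisjointF d _; apply: inputs_pts.
apply/fsetP => x; rewrite !inE; case: (boolP (x \in clo t)) => [xt|]; last by rewrite !orbF.
have xn z : z \in clo s -> x != z by move=> zs; apply: contraTneq xt => ->; apply/negP/(fdisjointF dC zs).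
by rewrite (negPf (xn u us)) (negPf (xn v vs)) !orbT.
Qed.

Lemma tunionA s t w : tunion (tunion s t) w = tunion s (tunion t w).
Proof.
by apply: arity_eq => /=; [exact: munionA|exact/esym/fsetUA|exact/esym/addnA].
Qed.

Lemma contractibleC k l u v c d t : contractible l c d t ->
  contractible k u v (tcontr l c d t) ->
  tcontr k u v (tcontr l c d t) = tcontr l c d (tcontr k u v t).
Proof.
move=> _ /and3P[_ + +]; rewrite !tcontrE !tglue_up => us vs.
rewrite tglueC // => e; move: us vs; rewrite -e -tglue_up ports_tglueE !inE !negb_or.
by move=> /andP[/andP[-> ->] _] /andP[/andP[-> ->] _].
Qed.

Lemma contr_tjoin k l u v a b s t : joinable l a b s t -> contractible k u v s ->
  joinable l a b (tcontr k u v s) t ->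
  tcontr k u v (tjoin l a b s t) = tjoin l a b (tcontr k u v s) t.
Proof.
move=> /and4P[d dC as_ bt] /and3P[uv us vs] /and4P[_ _ as2 _].
have eU : tunion (tcontr k u v s) t = up (tglue k u v (tunion s t)).
  by rewrite -tglueUl // tcontrE tglue_up; apply: arity_eq; rewrite //= ?gen2_tglue.
rewrite /tjoin eU !tglue_up tcontrE tglue_up; congr up; rewrite tglueC // => e.
have dp : [disjoint ports l s & ports l t] by case: (l) => //; apply: disjoint_inputs.
subst l; move: as2; rewrite tcontrE ports_tglueE !inE negb_or => /andP[/andP[au av] _].
rewrite ![_ == a]eq_sym au av /=; apply/andP; split; apply/eqP => e.
  by case: (fdisjointF dp us); rewrite e.
by case: (fdisjointF dp vs); rewrite e.
Qed.

Lemma contr_tjoin2 k l a b c d s t : joinable l c d s t -> joinable k a b s t ->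
  contractible k a b (tjoin l c d s t) ->
  tcontr k a b (tjoin l c d s t) = tcontr l c d (tjoin k a b s t).
Proof.
move=> _ _ /and3P[_ + +]; rewrite /tjoin !tcontrE !tglue_up => aj bj; congr up.
rewrite tglueC // => e; move: aj bj; rewrite -e ports_tglueE !inE !negb_or.
by move=> /andP[/andP[-> ->] _] /andP[/andP[-> ->] _].
Qed.

Lemma bcontr_unionl k u v s t D E : u \in ports k s -> v \in ports k s ->
  [disjoint pts (mc s) & pts (mc t)] -> part (mc s) D -> part (mc t) E ->
  bcontr k u v (D `|` E) = bcontr k u v D `|` E.
Proof.
case: k => //= us vs d pD pE; apply: (bmerge_unionl d) => //; exact: inputs_pts.
Qed.

Definition mod_map s t r (hr : relabels s t r) (x : ModOC s) : ModOC t :=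
  toM (ok_map hr (blocks_ok x).1).1.

Definition mod_join k u v s t (j : joinable k u v s t) (x : ModOC s) (y : ModOC t) :
    ModOC (tjoin k u v s t) :=
  toM (ok_join j (blocks_ok x).1 (blocks_ok y).1).1.

Definition mod_contr k u v t (q : contractible k u v t) (x : ModOC t) : ModOC (tcontr k u v t) :=
  toM (ok_contr q (blocks_ok x).1).1.

Lemma blocks_part t (x : ModOC t) : part (mc t) (blocks x).
Proof. by case: (blocks_ok x) => -[]. Qed.

Lemma blocks_map s t r (hr : relabels s t r) (x : ModOC s) :
  blocks (mod_map hr x) = bmap (mc s) r (blocks x).
Proof. exact: blocks_toM. Qed.

Lemma blocks_join k u v s t (j : joinable k u v s t) (x : ModOC s) (y : ModOC t) :
  blocks (mod_join j x y) = bcontr k u v (blocks x `|` blocks y).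
Proof. exact: blocks_toM. Qed.

Lemma blocks_contr k u v t (q : contractible k u v t) (x : ModOC t) :
  blocks (mod_contr q x) = bcontr k u v (blocks x).
Proof. exact: blocks_toM. Qed.

(** A gluing in two factors may be performed in the union of all three by [bcontr_unionl], and there
    the two gluings commute. *)
Lemma bcontr_joinA k l a b c d s t w D E F :
  joinable k a b s t -> joinable l c d (tjoin k a b s t) w ->
  joinable l c d t w -> joinable k a b s (tjoin l c d t w) ->
  part (mc s) D -> part (mc t) E -> part (mc w) F ->
  bcontr l c d (bcontr k a b (D `|` E) `|` F) = bcontr k a b (D `|` bcontr l c d (E `|` F)).
Proof.
move=> j1 j2 j3 j4 pD pE pF.
have [ab a1 b1] := joinable_neq j1; have [cd c3 d3] := joinable_neq j3.
case/and4P: (j1) => dst _ as_ bt; case/and4P: (j2) => dstw _ _ _.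
case/and4P: (j3) => dtw _ ct dw; case/and4P: (j4) => dsj _ _ _.
have sub1 : [disjoint pts (mc (tunion s t)) & pts (mc w)].
  by apply/fdisjointP => x xst; apply: (fdisjointP dstw); rewrite pts_tjoin.
have sub2 : [disjoint pts (mc s) & pts (mc (tunion t w))].
  by apply/fdisjointP => x xs; have := fdisjointP dsj x xs; rewrite pts_tjoin.
have pDE := part_union dst pD pE; have pEF := part_union dtw pE pF.
rewrite -(@bcontr_unionl k a b (tunion s t) w) //.
have -> : D `|` bcontr l c d (E `|` F) = bcontr l c d (D `|` (E `|` F)).
  rewrite [LHS]fsetUC -(@bcontr_unionl l c d (tunion t w) s) // 1?fdisjoint_sym //.
  by rewrite [_ `|` D]fsetUC.
rewrite fsetUA; have sub (k' : kind) x s' t' : (x \in ports k' s') || (x \in ports k' t') -> x \in ports k' (tunion s' t').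
  by case: (k') => /=; rewrite in_fsetU.
apply: (@bcontrC _ l k c d a b (tunion (tunion s t) w)) => //.
- exact: part_union.
- by move: c3; rewrite tunionA => h; apply: sub; rewrite h orbT.
- by move: d3; rewrite tunionA => h; apply: sub; rewrite h orbT.
- by apply: sub; rewrite a1.
- by apply: sub; rewrite b1.
Qed.

Definition mod_cyclic : cyclic_str (@ModOC K).
Proof.
unshelve refine (@CyclicStr K (@ModOC K) mod_map mod_join _ _ _ _ _).
- move=> t r hr x _ ec _; apply: ModOC_ext; rewrite blocks_map bmap_id //; exact: blocks_part.
- move=> s t w r r' r'' hr hr' hr'' x _ ec _; apply: ModOC_ext; rewrite !blocks_map.
  have [h _ _] := (relabelsE _ _ _).1 hr; have [h' _ _] := (relabelsE _ _ _).1 hr'.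
  exact: bmap_comp h h' (blocks_part x) ec.
- move=> k u v s t s' t' r r' hr hr' j j' hj x y; apply: ModOC_ext.
  rewrite blocks_map !blocks_join !blocks_map.
  exact: bmap_join hr hr' j j' (blocks_part x) (blocks_part y).
- move=> k u v s t j j' x y; apply: ModOC_heq; first exact: tjoinC.
  by rewrite !blocks_join bcontr_sym fsetUC.
- move=> k l a b c d s t w j1 j2 j3 j4 x y z; apply: ModOC_heq; first exact: tjoinA.
  rewrite !blocks_join; apply: (bcontr_joinA j1 j2 j3 j4); exact: blocks_part.
Defined.

Definition mod_modular : modular_str mod_cyclic.
Proof.
unshelve refine (@ModularStr K (@ModOC K) mod_cyclic mod_contr _ _ _ _ _).
- move=> k u v s t r hr q q' hq x; apply: ModOC_ext.
  rewrite blocks_map !blocks_contr blocks_map; exact: bmap_contr hr q (blocks_part x).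
- move=> k u v t q q' x; apply: ModOC_heq; last by rewrite !blocks_contr bcontr_sym.
  rewrite !tcontrE !tglue_up; congr up; case: (k); apply: arity_eq => //=; first exact: mcontr_swap.
  by congr (_ `\` _); apply/fsetP => z; rewrite !inE orbC.
- move=> k l u v c d t q1 q2 q3 q4 x; apply: ModOC_heq; first exact: contractibleC.
  rewrite !blocks_contr; case/and3P: (q1) => cd ct dt; case/and3P: (q3) => uv ut vt.
  by apply: bcontrC (blocks_part x) uv cd ut vt ct dt.
- move=> k l u v a b s t j q q' j' x y; apply: ModOC_heq; first exact: contr_tjoin.
  rewrite blocks_contr !blocks_join blocks_contr.
  case/and3P: (q') => uv us vs; case/and4P: (j) => dO dC as_ bt.
  rewrite -(bcontr_unionl us vs dO (blocks_part x) (blocks_part y)).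
  have [ab aU bU] := joinable_neq j.
  have sub k' z : z \in ports k' s -> z \in ports k' (tunion s t).
    by case: k' => /= h; rewrite in_fsetU h.
  apply: (@bcontrC _ k l u v a b (tunion s t)) => //; try exact: sub.
  exact: part_union (blocks_part x) (blocks_part y).
- move=> k l a b c d s t j q j' q' x y; apply: ModOC_heq; first exact: contr_tjoin2.
  rewrite !blocks_contr !blocks_join.
  have [ab aU bU] := joinable_neq j'; have [cd cU dU] := joinable_neq j.
  case/and4P: (j) => dO _ _ _.
  apply: (@bcontrC _ k l a b c d (tunion s t)) => //.
  exact: part_union (blocks_part x) (blocks_part y).
Defined.

End Structure.

(** * The operations in terms of nests *)

Lemma fsetUD1D1 (T : choiceType) (A B : {fset T}) a b : a \notin B -> b \notin A ->
  (A `|` B) `\ a `\ b = (A `\ a) `|` (B `\ b).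
Proof.
move=> aB bA; apply/fsetP => x; rewrite !(in_fsetU, in_fsetD1).
have [->|xa] /= := eqVneq x a; first by rewrite (negPf aB) !andbF.
by have [->|xb] //= := eqVneq x b; rewrite (negPf bA).
Qed.

Lemma fsetD1_id (T : choiceType) (A : {fset T}) a : A `\ a `\ a = A `\ a.
Proof. by apply/fsetP => x; rewrite !in_fsetD1; case: eqP. Qed.

Section Formulas.
Variable K : choiceType.
Local Notation block := (block K).
Local Notation nest := (nest K).

Implicit Types (M N T : mcyc K) (u v x y a b c d : K) (A B O : {fset K}) (r : relabeling K)
  (D E F : {fset block}) (s t w : arity K) (k l : kind) (V W : nest) (X Y Z : block).

Lemma toN_eq M D X T g : part M D -> X \in D -> pts T = X.1 ->
  {in X.1, forall x, (x \in inputs T) = (x \in inputs M)} -> {in X.1, nxt T =1 nxt M} ->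
  X.2.+1 = (2 * g + #|` cycs M X.1|)%N -> toN M X = (T, g).
Proof.
move=> pD XD eT iT nT /toN_gen eg; rewrite [LHS]surjective_pairing eg; congr (_, _).
apply: msub_eq => // x; first exact: (part_sub pD XD).
exact: (part_closed pD XD).
Qed.

Lemma inputs_toN M X x : x \in X.1 -> (x \in inputs (toN M X).1) = (x \in inputs M).
Proof. by move=> xX; rewrite inputs_msub mem_cycs ?andbT. Qed.

Lemma nxt_toN M D X x : part M D -> X \in D -> x \in X.1 -> nxt (toN M X).1 x = nxt M x.
Proof. by move=> pD XD xX; rewrite nxt_msub // -/(toN M X).1 (pts_toN pD). Qed.

Lemma inputs_contr M u v x :
  (x \in inputs (mcontr M u v)) = [&& x != u, x != v & x \in inputs M].
Proof. by rewrite /inputs /= in_fsetD in_fset2 negb_or andbA. Qed.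

Lemma toN_contr_out M D E u v Z : part M D -> part (mcontr M u v) E -> Z \in D -> Z \in E ->
  u \notin Z.1 -> v \notin Z.1 -> toN (mcontr M u v) Z = toN M Z.
Proof.
move=> pD pE ZD ZE uZ vZ; have [g eg] := part_gen pD ZD.
have nZ x : x \in Z.1 -> x != u /\ x != v.
  by move=> xZ; split; [apply: contraNneq uZ => <-|apply: contraNneq vZ => <-].
have ec : cycs (mcontr M u v) Z.1 = cycs M Z.1.
  apply: cycs_contr_out => //; first exact: (block_sub pD ZD).
  exact: (block_closed pD ZD).
rewrite [RHS]surjective_pairing (toN_gen eg); apply: (toN_eq pE ZE).
- exact: (pts_toN pD ZD).
- by move=> x xZ; have [xu xv] := nZ x xZ; rewrite inputs_toN // inputs_contr xu xv.
- by move=> x xZ; have [xu xv] := nZ x xZ; rewrite (nxt_toN pD ZD xZ) mcontr_id.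
- by rewrite ec.
Qed.

(** Translates weights back into genera. The points, inputs and successors of the united block are
    those of the contracted nest, and its genus follows from the change in the number of cycles. *)
Lemma toN_mblock M D u v : part M D -> u \in inputs M -> v \in inputs M -> u != v ->
  toN (mcontr M u v) (mblock (blk D u) (blk D v)) =
  if blk D u == blk D v then ncontr u v (toN M (blk D u))
  else njoin u v (toN M (blk D u)) (toN M (blk D v)).
Proof.
move=> pD uM vM uv; have [uMp vMp] := (inputs_pts uM, inputs_pts vM).
have pm := part_merge pD uMp vMp uv.
have [uD uX] := blk_in pD uMp; have [vD vY] := blk_in pD vMp.
have mD : mblock (blk D u) (blk D v) \in bmerge u v D by rewrite mem_bmerge eqxx.
move: (blk D u) (blk D v) uD uX vD vY mD => X Y XD uX YD vY mD.
have [g eg] := part_gen pD XD; have [h eh] := part_gen pD YD.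
have sm : (mblock X Y).1 `<=` pts M by rewrite fsubUset (block_sub pD XD) (block_sub pD YD).
have cm : {in (mblock X Y).1, forall x, nxt M x \in (mblock X Y).1}.
  move=> x; rewrite !in_fsetU => /orP[] xx; first by rewrite (part_closed pD XD).
  by rewrite (part_closed pD YD) ?orbT.
have um : u \in (mblock X Y).1 by rewrite in_fsetU uX.
have vm : v \in (mblock X Y).1 by rewrite in_fsetU vY orbT.
have cc := card_cycs_contr sm cm uv um vm.
have inc (P : mcyc K) x : {in (mblock X Y).1, forall x, (x \in inputs P) = (x \in inputs M)} ->
    x \in (mblock X Y).1 -> (x \in inputs (mcontr P u v)) = (x \in inputs (mcontr M u v)).
  by move=> eP xm; rewrite !inputs_contr eP.
have tpm x : x \in (mblock X Y).1 -> fstperm u v x \in (mblock X Y).1.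
  by rewrite fstpermE; case: eqP => // _; case: eqP.
have [eXY|nXY] := eqVneq X Y; apply: (toN_eq pm mD).
- rewrite pts_mcontr ?(pts_toN pD XD) //; first by rewrite /mblock /= -eXY fsetUid.
  by rewrite eXY.
- move=> x; apply: inc => y; rewrite /mblock /= -eXY fsetUid; exact: inputs_toN.
- move=> x xm; rewrite !nxt_mcontr (nxt_toN pD XD) //.
  by have := tpm x xm; rewrite /mblock /= -eXY fsetUid.
- have -> : mcycle (toN M X).1 u = mcycle M u by rewrite mcycle_msub // mem_pts_msub uMp mem_cycs.
  rewrite (toN_gen eg) {1}/mblock eXY eqxx -eXY /= eg; move: cc; rewrite /mblock -eXY fsetUid /=.
  move: (#|` cycs _ _|) (#|` cycs _ _|) => c1 c2.
  by case: ifP => _; clear; lia.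
- have d : [disjoint pts (toN M X).1 & pts (toN M Y).1].
    by rewrite (pts_toN pD XD) (pts_toN pD YD); apply: (block_disj pD).
  rewrite pts_mcontr ?in_fsetU ?(pts_toN pD XD) ?(pts_toN pD YD) ?uX ?vY ?orbT //.
  by rewrite -[LHS]/(pts (toN M X).1 `|` pts (toN M Y).1) (pts_toN pD XD) (pts_toN pD YD).
- move=> x; apply: inc => y; rewrite inputs_munion !in_fsetU.
  have eX : (y \in inputs (toN M X).1) = (y \in inputs M) && _ := inputs_msub _ _ _.
  have eY : (y \in inputs (toN M Y).1) = (y \in inputs M) && _ := inputs_msub _ _ _.
  move=> yXY; apply: (etrans (f_equal2 orb eX eY)); rewrite -andb_orr.
  by case/orP: yXY => yZ; rewrite (mem_cycs _ yZ) ?orbT andbT.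
- move=> x xm; rewrite !nxt_mcontr; have := tpm x xm; rewrite in_fsetU.
  have d : [disjoint pts (toN M X).1 & pts (toN M Y).1].
    by rewrite (pts_toN pD XD) (pts_toN pD YD); apply: (block_disj pD).
  case/orP => xx; first by rewrite nxt_munionl ?(nxt_toN pD XD) // (pts_toN pD XD).
  by rewrite nxt_munionr ?(nxt_toN pD YD) // (pts_toN pD YD).
- rewrite (toN_gen eg) (toN_gen eh) {1}/mblock (negPf nXY) /=; move: cc.
  rewrite (card_cycsU (block_sub pD XD) (block_sub pD YD) (block_closed pD XD) (block_disj pD XD YD nXY)).
  rewrite ifN; last first.
    by apply: contra nXY => vu; apply/eqP/(part_disj pD XD YD (part_mcycle pD XD uX vu) vY).
  move: eg eh; move: (#|` cycs _ _|) (#|` cycs _ _|) (#|` cycs _ _|) (X.2) (Y.2) => c1 c2 c3 p q.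
  by clear; lia.
Qed.

Lemma toN_bmerge M D u v V W : part M D -> u \in inputs M -> v \in inputs M -> u != v ->
  toN M (blk D u) = V -> toN M (blk D v) = W ->
  [fset toN (mcontr M u v) Z | Z in bmerge u v D] =
  (if blk D u == blk D v then ncontr u v V else njoin u v V W) |`
    ([fset toN M Z | Z in D] `\ V `\ W).
Proof.
move=> pD uM vM uv <- <-; have [uMp vMp] := (inputs_pts uM, inputs_pts vM).
have pm := part_merge pD uMp vMp uv.
have [XD uX] := blk_in pD uMp; have [YD vY] := blk_in pD vMp.
rewrite -(toN_mblock pD uM vM uv).
have out Z : Z \in D -> Z != blk D u -> Z != blk D v -> toN (mcontr M u v) Z = toN M Z.
  move=> ZD Zu Zv; apply: (toN_contr_out pD pm) => //.
  - by rewrite mem_bmerge Zu Zv ZD orbT.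
  - by rewrite (mem_block pD) // eq_sym.
  - by rewrite (mem_block pD) // eq_sym.
apply/fsetP => L; rewrite in_fset1U !in_fsetD1; apply/imfsetP/orP => /= [[Z + ->]|].
  rewrite mem_bmerge => /orP[/eqP->|/and3P[Zv Zu ZD]]; first by left.
  right; rewrite out // !(inj_in_eq (toN_inj pD)) // Zv Zu /=.
  by apply/imfsetP; exists Z.
case=> [/eqP->|/and3P[LW LV /imfsetP[Z /= ZD e]]].
  by exists (mblock (blk D u) (blk D v)); rewrite // mem_bmerge eqxx.
have Zu : Z != blk D u by apply: contraNneq LV => eZ; rewrite e eZ.
have Zv : Z != blk D v by apply: contraNneq LW => eZ; rewrite e eZ.
by exists Z; rewrite ?out // mem_bmerge Zu Zv ZD orbT.
Qed.

Lemma nestsE t (x : ModOC t) : nests x = [fset toN (mc t) X | X in blocks x].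
Proof. by rewrite (toN_ofN (dec_nests x)). Qed.

Lemma blk_nest t (x : ModOC t) V u : V \in nests x -> u \in inputs V.1 ->
  [/\ u \in inputs (mc t), blk (blocks x) u = ofN V & toN (mc t) (blk (blocks x) u) = V].
Proof.
move=> Vx uV; have Vb : ofN V \in blocks x by apply/imfsetP; exists V.
have eV := ofNK (dec_nests x) Vx.
have e : blk (blocks x) u = ofN V.
  by apply: (blk_eq (blocks_part x)) => //; apply: inputs_pts.
split; rewrite ?e //; move: uV; rewrite (dec_msub (dec_nests x) Vx) inputs_msub.
by case/andP.
Qed.

Lemma toN_unionl s t D E : [disjoint pts (mc s) & pts (mc t)] -> part (mc s) D -> part (mc t) E ->
  {in D, toN (munion (mc s) (mc t)) =1 toN (mc s)}.
Proof.
move=> d pD pE X XD; have [g eg] := part_gen pD XD.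
have pU := part_union d pD pE; have XU : X \in D `|` E by rewrite in_fsetU XD.
rewrite [RHS]surjective_pairing (toN_gen eg); apply: (toN_eq pU XU).
- exact: (pts_toN pD XD).
- move=> x xX; rewrite inputs_toN // inputs_munion in_fsetU.
  have xs := part_sub pD XD xX; rewrite orbC.
  by case: (boolP (x \in inputs (mc t))) => // /inputs_pts /(fdisjointF d xs).
- move=> x xX; rewrite (nxt_toN pD XD xX) nxt_munionl //; exact: (part_sub pD XD xX).
- rewrite eg; congr (_ + #|` _|)%N; apply: eq_in_imfset => //= x xX.
  by rewrite mcycle_munionl // (part_sub pD XD xX).
Qed.

Lemma nests_union s t (x : ModOC s) (y : ModOC t) : [disjoint pts (mc s) & pts (mc t)] ->
  [fset toN (munion (mc s) (mc t)) X | X in blocks x `|` blocks y] = nests x `|` nests y.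
Proof.
move=> d; have ds : [disjoint pts (mc t) & pts (mc s)] by rewrite fdisjoint_sym.
rewrite imfsetU !nestsE; congr (_ `|` _); apply: eq_in_imfset => //= X XD.
  exact: (toN_unionl d (blocks_part x) (blocks_part y)).
by rewrite munionC //; apply: (toN_unionl ds (blocks_part y) (blocks_part x)).
Qed.

Lemma nests_disj s t (x : ModOC s) (y : ModOC t) V : [disjoint pts (mc s) & pts (mc t)] ->
  V \in nests x -> V \in nests y -> False.
Proof.
move=> d Vx Vy; have Xx : ofN V \in blocks x by apply/imfsetP; exists V.
have Xy : ofN V \in blocks y by apply/imfsetP; exists V.
have [z zs e] := block_pt (blocks_part x) Xx; have [_ zX] := blk_in (blocks_part x) zs.
by rewrite -e in zX; apply: fdisjointF d zs (part_sub (blocks_part y) Xy zX).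
Qed.

Lemma mod_formulas : ModOC_formulas (mod_modular K).
Proof.
split.
- move=> s t r hr x; have [h _ _] := (relabelsE _ _ _).1 hr.
  rewrite /= /mod_map /symb /= /symbol_of; congr (_, _, _); last first.
    by rewrite (ok_map hr (blocks_ok x).1).2 (blocks_ok x).2.
  have px := blocks_part x.
  have e V : V \in nests x -> toN (mc t) ((bset (mc s) r (ofN V).1, (ofN V).2) : block) =
      (msub (mc t) [fset on_cycle r c | c in mcycles V.1], V.2).
    move=> Vx; have Xx : ofN V \in blocks x by apply/imfsetP; exists V.
    have [g eg] := part_gen px Xx; have eV := ofNK (dec_nests x) Vx.
    have g2 : V.2 = g by rewrite -eV (toN_gen eg).
    have ec : cycs (mc s) (ofN V).1 = mcycles V.1 := dec_cycs (dec_nests x) Vx.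
    have eg' : ((bset (mc s) r (ofN V).1, (ofN V).2) : block).2.+1 =
        (2 * g + #|` cycs (mc t) (bset (mc s) r (ofN V).1)|)%N.
      by rewrite (card_cycs_bset h px Xx).
    rewrite [LHS]surjective_pairing (toN_gen eg') g2; congr (_, _).
    by rewrite /toN /= -ec -(cycs_bset h px Xx).
  apply/fsetP => W; apply/imfsetP/imfsetP => /= [[Z /bmapP[X /imfsetP[V /= Vx ->] ->] ->]|[V Vx ->]].
    by exists V; rewrite ?e.
  exists (bset (mc s) r (ofN V).1, (ofN V).2); last by rewrite e.
  by apply: bmap_in; apply/imfsetP; exists V.
- move=> u v s t j x y V W Vx Wy uV vW.
  have [uv uU vU] := joinable_neq j; case/and4P: (j) => d _ _ _.
  have [us bu eV] := blk_nest Vx uV; have [vt bv eW] := blk_nest Wy vW.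
  have [px py] := (blocks_part x, blocks_part y).
  have pU := part_union d px py.
  rewrite /= /mod_join /symb /= /symbol_of (ok_join j (blocks_ok x).1 (blocks_ok y).1).2.
  rewrite (blocks_ok x).2 (blocks_ok y).2; congr (_, _, _).
  have nb := blk_union_neq d px py (inputs_pts us) (inputs_pts vt).
  have bU : blk (blocks x `|` blocks y) u = ofN V by rewrite (blk_unionl d px py) ?inputs_pts.
  have bV : blk (blocks x `|` blocks y) v = ofN W by rewrite (blk_unionr d px py) ?inputs_pts.
  have Vb : ofN V \in blocks x by apply/imfsetP; exists V.
  have Wb : ofN W \in blocks y by apply/imfsetP; exists W.
  have eVU : toN (munion (mc s) (mc t)) (blk (blocks x `|` blocks y) u) = V.
    by rewrite bU (toN_unionl d px py) // (ofNK (dec_nests x) Vx).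
  have eWU : toN (munion (mc s) (mc t)) (blk (blocks x `|` blocks y) v) = W.
    rewrite bV munionC // (toN_unionl _ py px) ?(ofNK (dec_nests y) Wy) //.
    by rewrite fdisjoint_sym.
  rewrite (toN_bmerge pU uU vU uv eVU eWU) (negPf nb) (nests_union x y d).
  have nV : V \in nests y = false by apply/negP => /(nests_disj d Vx).
  have nW : W \in nests x = false by apply/negP => h; apply: (nests_disj d h Wy).
  by rewrite fsetUD1D1 ?nV ?nW.
- move=> u v s t j x y; case/and4P: (j) => d _ _ _.
  rewrite /= /mod_join /symb /= /symbol_of (ok_join j (blocks_ok x).1 (blocks_ok y).1).2.
  by rewrite (blocks_ok x).2 (blocks_ok y).2 (nests_union x y d).
- move=> u v t q x V W Vx Wx VW uV vW; case/and3P: (q) => uv ut vt.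
  have [us bu eV] := blk_nest Vx uV; have [_ bv eW] := blk_nest Wx vW.
  have nb : blk (blocks x) u != blk (blocks x) v.
    rewrite bu bv; apply: contra_neq VW; exact: ofN_inj (dec_nests x) _ _ Vx Wx.
  rewrite /= /mod_contr /symb /= /symbol_of (ok_contr q (blocks_ok x).1).2 (blocks_ok x).2.
  rewrite nb addn1; congr (_, _, _).
  by rewrite (toN_bmerge (blocks_part x) ut vt uv eV eW) (negPf nb) -nestsE.
- move=> u v t q x V Vx uV vV; case/and3P: (q) => uv ut vt.
  have [us bu eV] := blk_nest Vx uV; have [_ bv eW] := blk_nest Vx vV.
  have nb : blk (blocks x) u == blk (blocks x) v by rewrite bu bv.
  rewrite /= /mod_contr /symb /= /symbol_of (ok_contr q (blocks_ok x).1).2 (blocks_ok x).2.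
  rewrite nb addn0; congr (_, _, _).
  by rewrite (toN_bmerge (blocks_part x) ut vt uv eV eW) nb -nestsE fsetD1_id.
- move=> u v t q x.
  rewrite /= /mod_contr /symb /= /symbol_of (ok_contr q (blocks_ok x).1).2 (blocks_ok x).2.
  by rewrite addn1 nestsE.
Qed.

End Formulas.

(** * The unit of the adjunction, and the number of contractions *)

HB.lock Definition base_blocks (K : choiceType) (M : mcyc K) : {fset block K} :=
  [fset ((c, 0) : block K) | c in mcycles M].

Section Unit.
Variable K : choiceType.
Local Notation block := (block K).

Implicit Types (M N T : mcyc K) (u v x y a b c d : K) (A B O : {fset K}) (r : relabeling K)
  (D E F : {fset block}) (s t w : arity K) (k l : kind) (X Y Z : block).

Definition tweight D := (\sum_(X <- D) X.2)%N.

(** The number of contractions in any presentation by unit elements. A contraction raises either the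
    total weight or the genus by 1 ([degree_contr]), joins are additive ([degree_join]), and only
    units have degree 0 ([degree0]). *)
Definition degree t D := (tweight D + gen t D)%N.

Lemma base_blocksP M X : reflect (exists2 x, x \in pts M & X = (mcycle M x, 0)) (X \in base_blocks M).
Proof.
rewrite base_blocks.unlock; apply: (iffP (imfsetP _ _ _ _)) => /= [[c /mcyclesE[x xM ->] ->]|[x xM ->]].
  by exists x.
by exists (mcycle M x); rewrite ?mcyclesP.
Qed.

Lemma cycs_mcycle M x : x \in pts M -> cycs M (mcycle M x) = [fset mcycle M x].
Proof.
move=> xM; apply/fsetP => c; rewrite in_fset1; apply/cycsP/eqP => [[y yx ->]|->].
  exact: mcycle_eq.
by exists x; rewrite ?mem_mcycle.
Qed.

Lemma part_base M : part M (base_blocks M).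
Proof.
split.
- by move=> X y /base_blocksP[x xM ->] /= /(mem_mcycle_pts xM).
- by move=> X /base_blocksP[x xM ->] /=; apply/fset0Pn; exists x; apply: mem_mcycle.
- move=> X y /base_blocksP[x xM ->] /= yx.
  by rewrite -(mcycle_eq xM yx) nxt_mcycle // (mem_mcycle_pts xM yx).
- by move=> X /base_blocksP[x xM ->] /=; exists 0; rewrite cycs_mcycle // cardfs1.
- move=> X Y z /base_blocksP[x xM ->] /base_blocksP[y yM ->] /= zx zy.
  by rewrite -(mcycle_eq xM zx) (mcycle_eq yM zy).
- move=> x xM; exists (mcycle M x, 0); last exact: mem_mcycle.
  by apply/base_blocksP; exists x.
Qed.

Lemma base_blocks0 M X : X \in base_blocks M -> X.2 = 0.
Proof. by case/base_blocksP => x _ ->. Qed.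

(** Weight 0 means 1 = 2g + b with b > 0, so each block is a single cycle. Thus a partition of total
    weight 0 is unique, and equations between units need no further check. *)
Lemma base_eq M D : part M D -> (forall X, X \in D -> X.2 = 0) -> D = base_blocks M.
Proof.
move=> pD D0; apply: (part_ext pD (part_base M)) => // x xM.
have [bD xb] := blk_in pD xM.
have -> : blk (base_blocks M) x = (mcycle M x, 0).
  apply: (blk_eq (part_base M)); last exact: mem_mcycle.
  by apply/base_blocksP; exists x.
rewrite [LHS]surjective_pairing D0 //; congr (_, _).
have [g] := part_gen pD bD; rewrite D0 // => eg.
have c1 : #|` cycs M (blk D x).1| = 1.
  by have := cycs_gt0 pD bD; move: eg; move: (#|` _|) => n; clear; lia.
apply/eqP; rewrite eqEfsubset; apply/andP; split; last first.
  by apply/fsubsetP => y; apply: (part_mcycle pD bD xb).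
apply/fsubsetP => y yb; have yM := part_sub pD bD yb.
have /cardfs1P[c ec] : #|` cycs M (blk D x).1| == 1 by rewrite c1.
have := mem_cycs M yb; have := mem_cycs M xb; rewrite ec !in_fset1 => /eqP-> /eqP <-.
exact: mem_mcycle.
Qed.

Lemma total0 D X : tweight D = 0 -> X \in D -> X.2 = 0.
Proof. by rewrite /tweight => /eqP; rewrite sum_nat_seq_eq0 => /allP h /h /eqP. Qed.

Lemma total_base M : tweight (base_blocks M) = 0.
Proof. by rewrite /tweight big_seq big1 // => X /base_blocks0. Qed.

Lemma card_base M : #|` base_blocks M| = #|` mcycles M|.
Proof. by rewrite base_blocks.unlock card_in_imfset //= => c d _ _ []. Qed.

Lemma sigma_total D : (sigma D = 2 * tweight D + 2 * #|` D|)%N.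
Proof. exact: sigmaE. Qed.

Lemma ok_base t : OC_ok t -> ok t (base_blocks (mc t)) /\ gen t (base_blocks (mc t)) = 0.
Proof.
move=> /eqP e; apply: okI; first exact: part_base.
by rewrite sigma_total total_base card_base muln0 add0n addn0 e.
Qed.

Lemma degree_base t : OC_ok t -> degree t (base_blocks (mc t)) = 0.
Proof. by move=> o; rewrite /degree total_base (ok_base o).2. Qed.

Lemma degree0 t D : ok t D -> degree t D = 0 -> D = base_blocks (mc t) /\ OC_ok t.
Proof.
move=> [pD eD] /eqP; rewrite addn_eq0 => /andP[/eqP t0 /eqP g0].
have eb : D = base_blocks (mc t) by apply: base_eq => // X; apply: total0.
split=> //; apply/eqP; rewrite eD g0 muln0 addn0 sigma_total t0 eb card_base.
by rewrite muln0.
Qed.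

Lemma total_map M N r D : mrel M N r -> part M D -> tweight (bmap M r D) = tweight D.
Proof. by move=> h pD; apply: (big_bmap h pD id). Qed.

Lemma total_bmerge M D u v : part M D -> u \in pts M -> v \in pts M ->
  tweight (bmerge u v D) = (tweight D + (blk D u == blk D v))%N.
Proof.
move=> pD uM vM; have [uD uX] := blk_in pD uM; have [vD vY] := blk_in pD vM.
have h Z := @mblock_neq K M D pD u v uM Z.
rewrite mergeE; move: (blk D u) (blk D v) uD uX vD vY h => X Y XD uX YD vY h.
rewrite /tweight big_fsetU1 /=; last first.
  rewrite !in_fsetD1; apply/negP => /and3P[mY mX mD].
  by have := h _ mD mX mY; rewrite eqxx.
case: (eqVneq X Y) => [<-|nXY].
  by rewrite fsetD1_id [in RHS](big_fsetD1 X XD) /= addn1 addSn.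
have YDX : Y \in D `\ X by rewrite in_fsetD1 eq_sym nXY.
by rewrite [in RHS](big_fsetD1 X XD) /= [in RHS](big_fsetD1 Y YDX) /= addn0 addnA.
Qed.

Lemma totalU M N D E : [disjoint pts M & pts N] -> part M D -> part N E ->
  tweight (D `|` E) = (tweight D + tweight E)%N.
Proof.
move=> d pD pE; have := sigmaU d pD pE; rewrite !sigma_total.
have -> : #|` D `|` E| = (#|` D| + #|` E|)%N.
  rewrite cardfsU; have -> : D `&` E = fset0; last by rewrite cardfs0 subn0.
  apply/fsetP => X; rewrite in_fsetI in_fset0; apply/negP => /andP[XD XE].
  have [x xM e] := block_pt pD XD; have [_ xb] := blk_in pD xM; rewrite -e in xb.
  exact: fdisjointF d xM (part_sub pE XE xb).
by move: (#|` D|) (#|` E|) => a b; clear; lia.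
Qed.

Lemma degree_map s t r D : relabels s t r -> ok s D -> degree t (bmap (mc s) r D) = degree s D.
Proof.
move=> hr o; have [h _ _] := (relabelsE _ _ _).1 hr; case: (o) => pD _.
by rewrite /degree (ok_map hr o).2 (total_map h pD).
Qed.

Lemma degree_contr k u v t D : contractible k u v t -> ok t D ->
  degree (tcontr k u v t) (bcontr k u v D) = (degree t D).+1.
Proof.
move=> q o; rewrite /degree (ok_contr q o).2; case/and3P: q => uv ut vt.
case: o => pD _; case: k ut vt => /= ut vt; last by rewrite addn1 addnS.
rewrite (total_bmerge pD) ?inputs_pts //.
by move: (tweight D) (gen t D) => a b; case: eqP; clear; lia.
Qed.

Lemma degree_join k u v s t D E : joinable k u v s t -> ok s D -> ok t E ->
  degree (tjoin k u v s t) (bcontr k u v (D `|` E)) = (degree s D + degree t E)%N.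
Proof.
move=> j oD oE; rewrite /degree (ok_join j oD oE).2; case/and4P: j => d dC us vt.
have [pD _] := oD; have [pE _] := oE; have pU := part_union d pD pE.
have eT : tweight (bcontr k u v (D `|` E)) = (tweight D + tweight E)%N.
  rewrite -(totalU d pD pE); case: k us vt => //= us vt.
  have [uM vM] := (inputs_pts us, inputs_pts vt).
  rewrite (total_bmerge pU) ?in_fsetU ?uM ?vM ?orbT //.
  by rewrite (negPf (blk_union_neq d pD pE uM vM)) addn0.
by rewrite eT addnACA.
Qed.

Definition unitOC t (x : OC t) : ModOC t := toM (ok_base (OC_okP x)).1.

Lemma blocks_unit t (x : OC t) : blocks (unitOC x) = base_blocks (mc t).
Proof. exact: blocks_toM. Qed.

Lemma unit_formula : ModOC_unit_formula unitOC.
Proof.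
move=> t x; rewrite /unitOC /symb /= /symbol_of (ok_base (OC_okP x)).2; congr (_, _, _).
have e (c : {fset K}) : c \in mcycles (mc t) -> toN (mc t) ((c, 0) : block) = (msub (mc t) [fset c], 0).
  by case/mcyclesE => y yM ->; rewrite /toN /= cycs_mcycle // cardfs1.
apply/fsetP => V; apply/imfsetP/imfsetP => /= [[X /base_blocksP[y yM ->] ->]|[c cM ->]].
  by exists (mcycle (mc t) y); rewrite ?mcyclesP // e ?mcyclesP.
exists (c, 0); last by rewrite e.
by case/mcyclesE: cM => y yM ->; apply/base_blocksP; exists y.
Qed.

(** Both sides have total weight 0, since the weight is invariant under relabelings and the degree
    is additive under joins; [base_eq] then identifies them. *)
Lemma unit_hom : cyclic_hom (OC_cyclic K) (mod_cyclic K) unitOC.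
Proof.
split=> [s t r hr x|k u v s t j x y]; apply: ModOC_ext; rewrite blocks_unit.
  rewrite blocks_map blocks_unit; have [h _ _] := (relabelsE _ _ _).1 hr.
  have pm := part_map h (part_base (mc s)).
  apply/esym/(base_eq pm) => X; apply: total0.
  by rewrite (total_map h (part_base _)) total_base.
have ox := ok_base (OC_okP x); have oy := ok_base (OC_okP y).
rewrite blocks_join !blocks_unit.
have [[pm _] _] := ok_join j ox.1 oy.1.
have := degree_join j ox.1 oy.1; rewrite !degree_base ?OC_okP // addn0 => /eqP.
rewrite addn_eq0 => /andP[/eqP t0 _].
by apply/esym/(base_eq pm) => X; apply: total0.
Qed.

End Unit.

(** * The universal property *)

Section Rename.
Variable K : choiceType.
Implicit Types (M N T : mcyc K) (u v x y a b : K) (A B O : {fset K}) (r : relabeling K)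
  (s t w : arity K).

Section Bijection.
Variables (f g : K -> K) (fK : cancel f g) (gK : cancel g f).

Fact mren_ok M : mcyc_ok ([fset f x | x in pts M], [fset f x | x in inputs M],
  [fsfun y in [fset f x | x in pts M] => f (nxt M (g y))]).
Proof.
apply: mcyc_okP => [|||x y].
- by apply/fsubsetP => y /imfsetP[x /= /inputs_pts xM ->]; apply/imfsetP; exists x.
- exact: finsupp_sub.
- move=> y yM; rewrite fsfunE yM; case/imfsetP: yM => x /= xM ->.
  by rewrite fK; apply/imfsetP; exists (nxt M x); rewrite ?nxt_pts.
- by move=> xM yM; rewrite !fsfunE xM yM => /(can_inj fK)/nxt_inj/(can_inj gK).
Qed.

Definition mren M : mcyc K := Mcyc (mren_ok M).

Lemma mem_image A x : (f x \in [fset f y | y in A]) = (x \in A).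
Proof.
by apply/imfsetP/idP => /= [[y yA /(can_inj fK)->//]|xA]; exists x.
Qed.

Lemma pts_mren M : pts (mren M) = [fset f x | x in pts M]. Proof. by []. Qed.

Lemma inputs_mren M : inputs (mren M) = [fset f x | x in inputs M]. Proof. by []. Qed.

Lemma nxt_mren M x : nxt (mren M) (f x) = f (nxt M x).
Proof.
rewrite /nxt /= fsfunE mem_image fK; case: ifP => // /negbT xM.
by rewrite -/(nxt M) nxt_out.
Qed.

Lemma iter_mren M x n : iter n (nxt (mren M)) (f x) = f (iter n (nxt M) x).
Proof. by elim: n => //= n ->; rewrite nxt_mren. Qed.

Lemma mcycle_mren M x : x \in pts M -> mcycle (mren M) (f x) = [fset f y | y in mcycle M x].
Proof.
move=> xM; have xM' : f x \in pts (mren M) by rewrite pts_mren mem_image.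
apply/fsetP => y; apply/mcycleP/imfsetP => //= [[n ->]|[z /mcycleP - /(_ xM)[n ->] ->]].
  by exists (iter n (nxt M) x); rewrite ?iter_mren // iter_mcycle.
by exists n; rewrite iter_mren.
Qed.

Lemma bij_image A : bij_fset f A [fset f x | x in A].
Proof. by split=> // x y _ _; apply: (can_inj fK). Qed.

Lemma mrel_mren M : mrel M (mren M) (Relabeling f (fun c => [fset f x | x in c]) f).
Proof.
split=> /=; first exact: bij_image.
- apply: bij_fsetI => [c /mcyclesE[x xM ->]|c d _ _ e|c /mcyclesE[y + ->]].
  + by rewrite -mcycle_mren // mcyclesP // pts_mren mem_image.
  + by apply/fsetP => x; rewrite -(mem_image c) e mem_image.
  + rewrite pts_mren => /imfsetP[x /= xM ->]; exists (mcycle M x); first exact: mcyclesP.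
    exact: mcycle_mren.
- by move=> x xM; rewrite mcycle_mren // inputs_pts.
- move=> x xM; have xp := inputs_pts xM.
  have [k [-> ik nk]] := mnextP xp (mem_mcycle xp) xM.
  rewrite -iter_mren; apply/esym/mnext_iter; rewrite ?pts_mren ?inputs_mren ?iter_mren ?mem_image //.
  by move=> i lti; rewrite iter_mren mem_image nk.
Qed.

End Bijection.

Hypothesis K_infinite : forall A : {fset K}, exists x : K, x \notin A.

(** The bijection is a composite of transpositions, each exchanging an element still in [A] with a
    fresh one. It is defined on all of [K] so that multicycles can be transported along it. *)
Lemma fresh_bij (X A : {fset K}) : exists f g : K -> K,
  [/\ cancel f g, cancel g f & {in X, forall x, f x \notin A}].
Proof.
suff [f [g [fK gK h]]] : exists f g : K -> K,
    [/\ cancel f g, cancel g f & {in (X : seq K), forall x, f x \notin A}].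
  by exists f, g.
elim: (X : seq K) => [|x s [f [g [fK gK h]]]]; first by exists id, id.
have [fx|fx] := boolP (f x \in A); last first.
  by exists f, g; split=> // y; rewrite inE => /orP[/eqP->|/h].
(* The fresh element also avoids the images of the elements already treated, so the transposition
   leaves these outside [A]. *)
have [y] := K_infinite (A `|` [fset f z | z in x :: s]).
rewrite in_fsetU negb_or => /andP[yA ys].
exists (fun z => fstperm (f x) y (f z)), (fun z => g (fstperm (f x) y z)); split.
- by move=> z; rewrite fstpermK fK.
- by move=> z; rewrite gK fstpermK.
move=> z; rewrite inE fstpermE => /orP[/eqP->|zs]; first by rewrite eqxx.
case: eqP => // _; case: eqP => [e|_]; last exact: h.
by case/negP: ys; rewrite -e; apply/imfsetP; exists z; rewrite //= inE zs orbT.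
Qed.

Lemma fresh_copy t A : exists t' r, [/\ relabels t t' r,
  [disjoint pts (mc t') & A] & [disjoint clo t' & A]].
Proof.
have [f [g [fK gK h]]] := fresh_bij (pts (mc t) `|` clo t) A.
exists (Arity (mren fK gK (mc t)) [fset f x | x in clo t] (gen2 t)).
exists (Relabeling f (fun c => [fset f x | x in c]) f); split.
- apply/relabelsE; split=> //=; first exact: mrel_mren.
  exact: bij_image fK _.
- apply/fdisjointP => y /imfsetP[x /= xM ->]; apply: h; by rewrite in_fsetU xM.
- apply/fdisjointP => y /imfsetP[x /= xM ->]; apply: h; by rewrite in_fsetU xM orbT.
Qed.

Lemma relabels_id t : relabels t t (rel_id K).
Proof. by apply/relabelsE; split=> //; [apply: mrel_id|apply: bij_fset_id]. Qed.

Lemma relabels_comp s t w r r' : relabels s t r -> relabels t w r' ->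
  relabels s w (rel_comp r' r).
Proof.
move=> /relabelsE[h bC bG] /relabelsE[h' bC' bG']; apply/relabelsE; split.
- exact: mrel_comp h h'.
- exact: bij_fset_comp bC bC'.
- by rewrite bG.
Qed.

Record inverse_on s t r r' : Prop := InverseOn {
  inv_open : {in inputs (mc s), cancel (on_open r) (on_open r')};
  inv_cycle : {in mcycles (mc s), cancel (on_cycle r) (on_cycle r')};
  inv_closed : {in clo s, cancel (on_closed r) (on_closed r')};
  inv_open' : {in inputs (mc t), cancel (on_open r') (on_open r)};
  inv_cycle' : {in mcycles (mc t), cancel (on_cycle r') (on_cycle r)};
  inv_closed' : {in clo t, cancel (on_closed r') (on_closed r)} }.

Lemma relabels_inv s t r : relabels s t r -> exists r', relabels t s r' /\ inverse_on s t r r'.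
Proof.
move=> /relabelsE[h bC bG]; have [r' [h' oK cK oK' cK']] := mrel_inv h.
have [x0 _] := K_infinite fset0; have [g [bg gK gK']] := bij_fset_inv bC x0.
exists (Relabeling (on_open r') (on_cycle r') g); split=> //.
apply/relabelsE; split=> //; exact: mrel_ext h'.
Qed.

Lemma bmap_inv s t r r' D : relabels s t r -> relabels t s r' -> inverse_on s t r r' ->
  part (mc s) D -> bmap (mc t) r' (bmap (mc s) r D) = D.
Proof.
move=> /relabelsE[h _ _] /relabelsE[h' _ _] i pD.
rewrite -(bmap_comp (r'' := rel_comp r' r) h h' pD) //.
by apply: (bmap_id pD) => c cM; apply: (inv_cycle i).
Qed.

(** Decidable equality of indices makes [existT] injective in its second argument, so equations of
    the total space descend to components. *)
Lemma arity_eq_dec s t : {s = t} + {s <> t}.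
Proof.
have [e|ne] := eqVneq (mc s, clo s, gen2 s) (mc t, clo t, gen2 t).
  by left; case: e => *; apply: arity_eq.
by right => e; case/eqP: ne; rewrite e.
Qed.

Lemma arity_existT_inj (P : arity K -> Type) t (p q : P t) :
  existT P t p = existT P t q -> p = q.
Proof. exact: Eqdep_dec.inj_pair2_eq_dec arity_eq_dec _ _ _ _. Qed.

End Rename.

(** * The values that a morphism must take *)

Section Target.
Variable K : choiceType.
Hypothesis K_infinite : forall A : {fset K}, exists x : K, x \notin A.
Variables (P : arity K -> Type) (SP : cyclic_str P) (TP : modular_str SP).
Variable f : forall t, OC t -> P t.
Hypothesis f_hom : cyclic_hom (OC_cyclic K) SP f.

Local Notation block := (block K).

Implicit Types (M N T : mcyc K) (u v x y a b c d : K) (A B O : {fset K}) (r : relabeling K)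
  (D E F : {fset block}) (s t w : arity K) (k l : kind) (X Y Z : block).

Lemma hmap_rel_id t (h : relabels t t (rel_id K)) (p : P t) : hmap SP h p = p.
Proof. exact: (hmap_id SP). Qed.

Lemma hmap_agree s t r r' (h : relabels s t r) (h' : relabels s t r') (p : P s) :
  {in inputs (mc s), on_open r =1 on_open r'} ->
  {in mcycles (mc s), on_cycle r =1 on_cycle r'} ->
  {in clo s, on_closed r =1 on_closed r'} -> hmap SP h p = hmap SP h' p.
Proof.
move=> eo ec eC; rewrite (hmap_comp SP h' (relabels_id t) h) ?hmap_rel_id //.
Qed.

Lemma hmapK s t r r' (h : relabels s t r) (h' : relabels t s r') : inverse_on s t r r' ->
  cancel (hmap SP h) (hmap SP h').
Proof.
move=> i p; rewrite -(hmap_comp SP h h' (relabels_comp h h')) //.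
rewrite (hmap_agree _ (relabels_id s)) ?hmap_rel_id // => x xs /=.
- exact: (inv_open i).
- exact: (inv_cycle i).
- exact: (inv_closed i).
Qed.

(* [reaches n D p]: the element of the modular completion given by the blocks D
   has to be sent to p, as one sees from a presentation by n contractions. *)
Inductive reaches : nat -> forall t, {fset block} -> P t -> Prop :=
| reaches_base t (o : OC t) : reaches 0 (base_blocks (mc t)) (f o)
| reaches_map n s t r (h : relabels s t r) D (p : P s) :
    reaches n D p -> reaches n (bmap (mc s) r D) (hmap SP h p)
| reaches_contr n k u v t (q : contractible k u v t) D (p : P t) :
    reaches n D p -> reaches n.+1 (bcontr k u v D) (hcontr TP q p).

Lemma reaches_ok n t D (p : P t) : reaches n D p -> ok t D /\ degree t D = n.
Proof.
elim=> {n t D p} [t o|n s t r h D p _ [oD dD]|n k u v t q D p _ [oD dD]].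
- by rewrite degree_base ?OC_okP //; split=> //; case: (ok_base (OC_okP o)).
- by rewrite (degree_map h oD); split=> //; case: (ok_map h oD).
- by rewrite (degree_contr q oD) dD; split=> //; case: (ok_contr q oD).
Qed.

Lemma reaches_part n t D (p : P t) : reaches n D p -> part (mc t) D.
Proof. by case/reaches_ok => -[]. Qed.

Lemma reaches_existT n s t D (p : P s) (q : P t) :
  existT P s p = existT P t q -> reaches n D p -> reaches n D q.
Proof.
pose Q (z : {t & P t}) := reaches n D (projT2 z).
by move=> e h; have : Q (existT P s p) by []; rewrite e.
Qed.

Lemma base_map s t r : relabels s t r -> bmap (mc s) r (base_blocks (mc s)) = base_blocks (mc t).
Proof.
move=> /relabelsE[h _ _]; have pm := part_map h (part_base (mc s)).
by apply: (base_eq pm) => X; apply: total0; rewrite (total_map h (part_base _)) total_base.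
Qed.

(** Shape of a presentation with its final relabelings composed into one: either a unit, or one
    relabeling applied to a contraction. Compatibility of [f] with relabelings absorbs them in the
    unit case. *)
Definition last_step n t D (p : P t) : Prop :=
  if n is n'.+1 then exists k u v s (q : contractible k u v s) r
    (h : relabels (tcontr k u v s) t r) D0 (p0 : P s),
    [/\ reaches n' D0 p0, D = bmap (mc (tcontr k u v s)) r (bcontr k u v D0)
      & p = hmap SP h (hcontr TP q p0)]
  else exists o, D = base_blocks (mc t) /\ p = f o :> P t.

Lemma reaches_last n t D (p : P t) : reaches n D p -> last_step n D p.
Proof.
elim=> {n t D p} [t o|n s t r h D p _|n k u v t q D p hp _] /=; first by exists o.
  case: n => [[o [-> ->]]|n]; rewrite /last_step.
    by exists (hmap (OC_cyclic K) h o); rewrite (base_map h) f_hom.1.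
  case=> k [u [v [s' [q [r' [h' [D0 [p0 [hp -> ->]]]]]]]]].
  have pD0 := reaches_part hp; have pc : part (mc (tcontr k u v s')) (bcontr k u v D0).
    by have [[]] := ok_contr q (reaches_ok hp).1.
  exists k, u, v, s', q, (rel_comp r r'), (relabels_comp h' h), D0, p0; split=> //.
    have [m _ _] := (relabelsE _ _ _).1 h; have [m' _ _] := (relabelsE _ _ _).1 h'.
    by rewrite (bmap_comp m' m pc (r'' := rel_comp r r')).
  by rewrite -(hmap_comp SP h' h (relabels_comp h' h)).
exists k, u, v, t, q, (rel_id K), (relabels_id _), D, p; split=> //; last by rewrite hmap_rel_id.
rewrite bmap_id //; by have [[]] := ok_contr q (reaches_ok hp).1.
Qed.

Lemma contractible_join k l u v a b s t : contractible k u v s -> joinable l a b (tcontr k u v s) t ->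
  [disjoint pts (mc s) & pts (mc t)] -> [disjoint clo s & clo t] ->
  joinable l a b s t /\ contractible k u v (tjoin l a b s t).
Proof.
move=> /and3P[uv us vs] /and4P[_ _ as_ bt] d dC.
have as' : a \in ports l s.
  by move: as_; rewrite tcontrE => /(fsubsetP (ports_tglue _ _ _ _ _)); case: (l).
have sub k' z : z \in ports k' s -> z \in ports k' (tunion s t).
  by case: k' => /= h; rewrite in_fsetU h.
have dl : [disjoint ports l s & ports l t] by case: (l) => //; apply: disjoint_inputs.
split; first by rewrite /joinable d dC as' bt.
rewrite /contractible uv /= /tjoin.
have out z : z \in ports k s -> (k = l -> z != a) -> z \in ports k (tglue l a b (tunion s t)).
  move=> zs za; have zU := sub _ _ zs.
  case: k l za {sub} bt dl zs zU {us vs as_ as'} => -[] //= za bt dl zs zU.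
    rewrite in_fsetD zU andbT in_fset2 negb_or za //=.
    by apply/eqP => e; rewrite e in zs; apply: fdisjointF dl zs bt.
  rewrite in_fsetD zU andbT in_fset2 negb_or za //=.
  by apply/eqP => e; rewrite e in zs; apply: fdisjointF dl zs bt.
have nz : k = l -> u != a /\ v != a.
  move=> e; subst l; move: as_; rewrite tcontrE ports_tglueE in_fsetD in_fset2 negb_or.
  by rewrite ![a == _]eq_sym => /andP[/andP[]].
by rewrite !out // => /nz[].
Qed.

Lemma bcontr_contr_join k l u v a b s t D E : contractible k u v s ->
  joinable l a b s t -> part (mc s) D -> part (mc t) E ->
  bcontr k u v (bcontr l a b (D `|` E)) = bcontr l a b (bcontr k u v D `|` E).
Proof.
move=> /and3P[uv us vs] j pD pE; case/and4P: (j) => dO dC as_ bt.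
rewrite -(bcontr_unionl us vs dO pD pE); have [ab aU bU] := joinable_neq j.
have sub k' z : z \in ports k' s -> z \in ports k' (tunion s t).
  by case: k' => /= h; rewrite in_fsetU h.
apply: (@bcontrC _ k l u v a b (tunion s t)) => //; try exact: sub.
exact: part_union.
Qed.

Lemma on_port_bij k s t r : relabels s t r -> bij_fset (on_port k r) (ports k s) (ports k t).
Proof. by move=> /relabelsE[h bC _]; case: k => //; apply: mrel_open. Qed.

Lemma on_port_inv k s t r r' x : inverse_on s t r r' -> x \in ports k s ->
  on_port k r' (on_port k r x) = x.
Proof. by move=> i; case: k => /= xs; [apply: (inv_open i)|apply: (inv_closed i)]. Qed.

Section Join.
Variables (m : nat) (Q : forall t, {fset block} -> P t -> Prop).
Hypothesis Q_map : forall s t r (h : relabels s t r) D p, Q D p -> Q (bmap (mc s) r D) (hmap SP h p).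
Hypothesis Q_part : forall t D (p : P t), Q D p -> part (mc t) D.

Let joins n s D (p : P s) t E (q : P t) := forall k u v (j : joinable k u v s t),
  reaches (n + m) (bcontr k u v (D `|` E)) (hjoin SP j p q).

(** Joins are defined only for disjoint supports, and the elements occurring inside a presentation
    of the first factor may overlap with the second. The second factor is therefore replaced by a
    copy away from [A], and the result is transported back by [hjoin_map]. *)
Let freshen A n s s' r (h : relabels s s' r) D (p : P s) : part (mc s) D ->
  pts (mc s) `<=` A -> clo s `<=` A ->
  (forall t E (q : P t), Q E q -> [disjoint pts (mc t) & A] -> [disjoint clo t & A] ->
    joins n D p E q) ->
  forall t E (q : P t), Q E q -> joins n (bmap (mc s) r D) (hmap SP h p) E q.
Proof.
move=> pD sA cA hA t E q hq k u v j.
have [t1 [r1 [h1 d1 dC1]]] := fresh_copy K_infinite t A.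
have [r2 [h2 i]] := relabels_inv K_infinite h1.
have [ut' vt'] : u \in ports k s' /\ v \in ports k t by case/and4P: j.
have [u0 us eu] := bij_fset_surj (on_port_bij k h) ut'.
have v1 : on_port k r1 v \in ports k t1 := bij_fset_in (on_port_bij k h1) vt'.
have ev := on_port_inv i vt'; move: (on_port k r1 v) v1 ev => v0 vt ev.
have j0 : joinable k u0 v0 s t1.
  rewrite /joinable us vt !andbT; apply/andP; split; rewrite fdisjoint_sym.
    by apply: fdisjointWr d1.
  by apply: fdisjointWr dC1.
move: j; rewrite eu -ev => j.
have hj := relabels_join h h2 j0 j.
have := reaches_map hj (hA t1 _ _ (Q_map h1 hq) d1 dC1 k u0 v0 j0).
have pE1 : part (mc t1) (bmap (mc t) r1 E) := Q_part (Q_map h1 hq).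
rewrite (hjoin_map SP h h2 j0 j hj) (bmap_join h h2 j0 j pD pE1).
by rewrite (bmap_inv h1 h2 i (Q_part hq)) (hmapK h1 h2 i).
Qed.

Hypothesis base : forall s (o : OC s) t E (q : P t), Q E q -> joins 0 (base_blocks (mc s)) (f o) E q.

(** Induction on the presentation of the first factor, pulling contractions out by [hcontr_join].
    The class [Q] of the second factor is left open for two uses in [reaches_join]: with arbitrary
    second factors, where the base case has a unit as first factor; and, after exchanging the
    factors, with units as second factors, which settles that base case. *)
Lemma reaches_join_class n s D (p : P s) : reaches n D p -> forall t E (q : P t), Q E q ->
  forall k u v (j : joinable k u v s t), reaches (n + m) (bcontr k u v (D `|` E)) (hjoin SP j p q).
Proof.
elim=> {n s D p} [s o|n s t r h D p hp IH|n k u v s qc D p hp IH]; first exact: base.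
  apply: (@freshen (pts (mc s) `|` clo s)) => //.
  - exact: reaches_part hp.
  - exact: fsubsetUl.
  - exact: fsubsetUr.
  - by move=> t' E q hq _ _; apply: IH.
have oc := (ok_contr qc (reaches_ok hp).1).1.
move=> t E q hq; rewrite -[hcontr TP qc p](hmap_rel_id (relabels_id _)).
rewrite -[bcontr k u v D](bmap_id (ok_part oc) (r := rel_id K)) //.
apply: (@freshen (pts (mc (tcontr k u v s)) `|` (pts (mc s) `|` clo s))) hq.
- exact: ok_part oc.
- exact: fsubsetUl.
- rewrite tcontrE clo_tglue /=; apply/fsubsetP => x xs; rewrite !in_fsetU.
  suff -> : x \in clo s by rewrite !orbT.
  by case: (k) xs => //; rewrite in_fsetD => /andP[].
move=> t' E' q' hq'; rewrite fdisjoint_sym => d; rewrite fdisjoint_sym => dC l a b j.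
have dd : [disjoint pts (mc s) & pts (mc t')].
  by apply: fdisjointWl d; apply/fsubsetP => x xs; rewrite !in_fsetU xs orbT.
have ddC : [disjoint clo s & clo t'].
  by apply: fdisjointWl dC; apply/fsubsetP => x xs; rewrite !in_fsetU xs !orbT.
have [j0 q0] := contractible_join qc j dd ddC.
apply: reaches_existT (hcontr_join TP j0 q0 qc j p q') _.
rewrite -(bcontr_contr_join qc j0 (reaches_part hp) (Q_part hq')) addSn.
by apply: reaches_contr; apply: IH.
Qed.

End Join.

Lemma reaches_join n m s t D E (p : P s) (q : P t) k u v (j : joinable k u v s t) :
  reaches n D p -> reaches m E q -> reaches (n + m) (bcontr k u v (D `|` E)) (hjoin SP j p q).
Proof.
move=> hp hq; pose Q0 t E (q : P t) := exists o, E = base_blocks (mc t) /\ q = f o.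
have joinC k' u' v' s' t' (j' : joinable k' u' v' s' t') : joinable k' v' u' t' s'.
  case/and4P: j' => d dC us vt; apply/and4P; split=> //; by rewrite fdisjoint_sym.
apply: (@reaches_join_class m (fun t E q => reaches m E q) _ _ _ n s D p hp t E q hq).
- by move=> s' t' r h D' p'; apply: reaches_map.
- by move=> t' D' p'; apply: reaches_part.
move=> s' o t' E' q' hq' k' u' v' j'; rewrite add0n.
apply: reaches_existT (hjoinC SP (joinC _ _ _ _ _ j') j' q' (f o)) _.
rewrite bcontr_sym fsetUC -[m]addn0.
apply: (@reaches_join_class 0 Q0) hq' _ _ _ _ _ _ _ _.
- move=> s2 t2 r h D' p' [o' [-> ->]]; exists (hmap (OC_cyclic K) h o').
  by rewrite (base_map h) f_hom.1.
- by move=> t2 D' p' [o' [-> _]]; apply: part_base.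
- move=> s2 o2 t2 E2 q2 [o' [-> ->]] k2 u2 v2 j2; rewrite -f_hom.2.
  have -> : bcontr k2 u2 v2 (base_blocks (mc s2) `|` base_blocks (mc t2)) =
      base_blocks (mc (tjoin k2 u2 v2 s2 t2)).
    have := congr1 (@blocks K _) ((unit_hom K).2 k2 u2 v2 s2 t2 j2 o2 o').
    by rewrite blocks_join !blocks_unit.
  exact: reaches_base.
- by exists o.
Qed.

End Target.

(** * Undoing gluings on indices *)

Section Ungluing.
Variable K : choiceType.
Hypothesis K_infinite : forall A : {fset K}, exists x : K, x \notin A.

Implicit Types (M N T : mcyc K) (u v x y a b : K) (A B O : {fset K}) (r : relabeling K)
  (s t w z : arity K) (k l : kind).

(** Twisting by the same transposition is undone by a second twist, so two points that are not
    inputs can be made inputs whose gluing returns the given multicycle. *)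
Definition unglue k u v t : arity K :=
  match k with
  | Open => Arity (mset (mcontr (mc t) u v) ([fset u; v] `|` inputs (mc t))) (clo t) (gen2 t)
  | Closed => Arity (mc t) ([fset u; v] `|` clo t) (gen2 t)
  end.

Definition unglueable k u v t :=
  if k is Open then [&& u \in pts (mc t), v \in pts (mc t), u \notin inputs (mc t) & v \notin inputs (mc t)]
  else (u \notin clo t) && (v \notin clo t).

Lemma inputs_unglue u v t : u \in pts (mc t) -> v \in pts (mc t) ->
  inputs (mc (unglue Open u v t)) = [fset u; v] `|` inputs (mc t).
Proof.
move=> uM vM; apply: inputs_mset; rewrite pts_mcontr //; apply/fsubsetP => x.
by rewrite !inE => /orP[/orP[]/eqP->|/inputs_pts].
Qed.

Lemma fset2UD (A : {fset K}) u v : u \notin A -> v \notin A -> ([fset u; v] `|` A) `\` [fset u; v] = A.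
Proof.
move=> uA vA; apply/fsetP => x; rewrite !inE; case: (boolP (x \in A)) => xA; last first.
  by rewrite orbF; case: (_ || _).
rewrite orbT andbT negb_or; apply/andP; split; by [apply: contraNneq uA => <-|apply: contraNneq vA => <-].
Qed.

Lemma tglueK k u v t : unglueable k u v t -> tglue k u v (unglue k u v t) = t.
Proof.
case: k => /= [/and4P[uM vM uI vI]|/andP[uC vC]]; apply: arity_eq => //=; last exact: fset2UD.
have pU : pts (mc (unglue Open u v t)) = pts (mc t).
  by rewrite /= -[pts (mset _ _)]/(pts (mcontr (mc t) u v)) pts_mcontr.
apply: mcyc_eq => [||x].
- by rewrite pts_mcontr // pU.
- apply: etrans (_ : inputs (mc (unglue Open u v t)) `\` [fset u; v] = _) _ => //.
  by rewrite inputs_unglue // fset2UD.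
- by rewrite nxt_mcontr [nxt (mset _ _) _]nxt_mcontr fstpermK.
Qed.

Lemma ports_unglue k u v t : unglueable k u v t ->
  ports k (unglue k u v t) = [fset u; v] `|` ports k t.
Proof. by case: k => //= /and4P[uM vM _ _]; apply: inputs_unglue. Qed.

Definition tins x a t : arity K := Arity (demote (ins (mc t) x a) a) (clo t) (gen2 t).

Definition rel_ins x a : relabeling K := Relabeling id (addpt x a) id.

Lemma relabels_ins x a t : x \in pts (mc t) -> a \notin pts (mc t) ->
  relabels t (tins x a t) (rel_ins x a).
Proof.
move=> xM aM; apply/relabelsE; split=> //; first exact: mrel_ins.
exact: bij_fset_id.
Qed.

Lemma pts_tins x a t : x \in pts (mc t) -> pts (mc (tins x a t)) = a |` pts (mc t).
Proof. exact: pts_ins. Qed.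

Lemma inputs_tins x a t : a \notin pts (mc t) -> inputs (mc (tins x a t)) = inputs (mc t).
Proof.
move=> aM; rewrite /= inputs_demote inputs_ins fsetU1K //.
by apply: contra aM; apply: inputs_pts.
Qed.

Lemma fstperm_conj u v x a y : a != u -> a != v ->
  fstperm (fstperm u v x) a (fstperm u v y) = fstperm u v (fstperm x a y).
Proof.
move=> au av; have inj : injective (fstperm u v) := inv_inj (fstpermK u v).
have ea : fstperm u v a = a by rewrite fstpermE (negPf au) (negPf av).
have perm_r p q : fstperm p q q = p by rewrite fstpermE eqxx; case: eqP.
have [->|yx] := eqVneq y x; first by rewrite !(fstpermE _ a) !eqxx ea.
have [->|ya] := eqVneq y a; first by rewrite ea !perm_r.
rewrite [in RHS](fstpermE x) (negPf yx) (negPf ya) fstpermE (inj_eq inj) (negPf yx).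
by rewrite -[X in _ == X]ea (inj_eq inj) (negPf ya).
Qed.

(** Inserting a point commutes with an open contraction up to the place: the successor of [x] after
    the contraction is that of the transposed point before it, so the point goes after
    [fstperm u v x]. *)
Lemma tins_contr k u v t x a : contractible k u v t -> x \in pts (mc t) -> a \notin pts (mc t) ->
  exists t' r, [/\ relabels t t' r, tcontr k u v t' = tins x a (tcontr k u v t),
    {in ports k t, on_port k r =1 id},
    pts (mc t') = a |` pts (mc t) &
    [/\ {in mcycles (mc (tcontr k u v t)), on_cycle (rel_glue k u v (mc t') r) =1 addpt x a},
      on_open r =1 id & on_closed r =1 id] ].
Proof.
move=> /and3P[uv ut vt] xM aM; case: k ut vt => /= ut vt; last first.
  by exists (tins x a t), (rel_ins x a); split=> //; [exact: relabels_ins|exact: pts_tins].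
have [uM vM] := (inputs_pts ut, inputs_pts vt).
pose x' := fstperm u v x.
have x'M : x' \in pts (mc t) by rewrite /x' fstpermE; case: eqP => // _; case: eqP.
have [au av] : a != u /\ a != v by split; apply: contraNneq aM => ->.
have [uI vI] : u \in pts (mc (tins x' a t)) /\ v \in pts (mc (tins x' a t)).
  by rewrite pts_tins // !in_fset1U uM vM !orbT.
have xC : x \in pts (mc (tcontr Open u v t)) by rewrite pts_mcontr.
have aC : a \notin pts (mc (tcontr Open u v t)) by rewrite pts_mcontr.
have pC : pts (mc (tcontr Open u v t)) = pts (mc t) := pts_mcontr uM vM.
have emc : mcontr (mc (tins x' a t)) u v = mc (tins x a (tcontr Open u v t)).
  apply: mcyc_eq => [||y].
  - by rewrite (pts_mcontr uI vI) (pts_tins a x'M) (pts_tins a xC) pC.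
  - rewrite (inputs_tins x aC).
    exact: (congr1 (fun A => A `\` [fset u; v]) (inputs_tins x' aM)).
  - rewrite !nxt_mcontr; exact: (congr1 (nxt (mc t)) (fstperm_conj x y au av)).
have eC : tcontr Open u v (tins x' a t) = tins x a (tcontr Open u v t) by apply: arity_eq.
exists (tins x' a t), (rel_ins x' a); split=> //; first exact: relabels_ins.
  exact: pts_tins.
split=> // c cM.
have ecyc y : y \in c -> y \in pts (mc t) /\ mcycle (mc (tins x a (tcontr Open u v t))) y = addpt x a c.
  move=> yc; have [yM e] := mem_mcycles cM yc; split; first by move: yM; rewrite pts_mcontr.
  by rewrite e -[LHS]/(mcycle (ins (mc (tcontr Open u v t)) x a) y) mcycle_ins.
rewrite /= -[demote _ _]/(mc (tins x' a t)) emc; case: ifP => uc; first by case: (ecyc u uc).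
case: ifP => vc; first by case: (ecyc v vc).
rewrite /addpt /x' fstpermE; have [->|_] := eqVneq x u; first by rewrite uc vc.
by have [->|_] := eqVneq x v; first by rewrite uc vc.
Qed.

Lemma rel_glue_comp M N T r r' u v c : mrel M N r -> u \in inputs M -> v \in inputs M ->
  c \in mcycles (mcontr M u v) ->
  on_cycle (rel_glue Open u v T (rel_comp r' r)) c =
  on_cycle (rel_glue Open (on_open r u) (on_open r v) T r') (on_cycle (rel_glue Open u v N r) c).
Proof.
move=> h uM vM cM; have [_ hc] := glue_cases h uM vM cM.
rewrite [on_cycle (rel_glue Open (on_open r u) _ _ _) _]/= (hc u uM) (hc v vM) /=.
by case: ifP => // uc; case: ifP.
Qed.

Lemma tglue_unglueC k l u v a b t : (k = l -> [&& u != a, u != b, v != a & v != b]) ->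
  u \in ports k t -> v \in ports k t -> unglueable l a b t ->
  tglue k u v (unglue l a b t) = unglue l a b (tglue k u v t).
Proof.
move=> ne ut vt h; have hu : unglueable l a b (tglue k u v t).
  case: k l ne ut vt h => -[] //= ne ut vt.
    case/and4P => aM bM aI bI; rewrite (pts_mcontr (inputs_pts ut) (inputs_pts vt)) aM bM /=.
    by rewrite !inputs_contr (negPf aI) (negPf bI) !andbF.
  by case/andP => aC bC; rewrite !in_fsetD (negPf aC) (negPf bC) !andbF.
have ptsC x M p q : p \in pts M -> q \in pts M -> x \in pts M -> x \in pts (mcontr M p q).
  by move=> pM qM; rewrite pts_mcontr.
case: k l ne ut vt h hu => -[] //= ne ut vt h hu; apply: arity_eq => //=.
- case/and4P: (h) => aM bM aI bI; have [uM vM] := (inputs_pts ut, inputs_pts vt).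
  have := ne erefl; rewrite ![u == _]eq_sym ![v == _]eq_sym => /and4P[ua ub va vb].
  have eI := inputs_unglue aM bM.
  have eI' : inputs (mc (unglue Open a b (tglue Open u v t))) = [fset a; b] `|` (inputs (mc t) `\` [fset u; v]).
    by apply: inputs_unglue; apply: ptsC.
  have eP : pts (mc (unglue Open a b t)) = pts (mc t) := pts_mcontr aM bM.
  apply: mcyc_eq => [||x].
  + rewrite (_ : pts (mcontr _ u v) = pts (mc t)); last by rewrite pts_mcontr eP.
    apply/esym/(etrans (_ : _ = pts (mcontr (mcontr (mc t) u v) a b))) => //.
    by rewrite (@pts_mcontr _ (mcontr (mc t) u v)) ?ptsC // pts_mcontr.
  + rewrite (eI' : inputs (mset _ _) = _).
    apply: etrans (congr1 (fun A => A `\` [fset u; v]) eI) _.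
    apply/fsetP => x; rewrite !inE.
    have [->|_] := eqVneq x a; first by rewrite (negPf ua) (negPf va).
    by have [->|_] := eqVneq x b; first by rewrite (negPf ub) (negPf vb).
  + rewrite nxt_mcontr ![nxt (mset _ _) _]nxt_mcontr nxt_mcontr.
    by rewrite fstpermC // 1?eq_sym // ?ua ?ub ?va ?vb.
- apply/fsetP => x; rewrite !inE; have := ne erefl; rewrite ![u == _]eq_sym ![v == _]eq_sym => /and4P[ua ub va vb].
  have [->|_] := eqVneq x a; first by rewrite (negPf ua) (negPf va).
  by have [->|_] := eqVneq x b; first by rewrite (negPf ub) (negPf vb).
Qed.

End Ungluing.

(** * Bringing two last contractions onto one multicycle *)

Section Normalization.
Variable K : choiceType.
Hypothesis K_infinite : forall A : {fset K}, exists x : K, x \notin A.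

Implicit Types (M N T : mcyc K) (u v x y a b : K) (A B O : {fset K}) (r : relabeling K)
  (s t w z : arity K) (k l : kind).

(** An isomorphism out of a contraction extends over the two lost inputs. They are restored in the
    order opposite to the demotions in [mcontr_demote]: [b] before [a]. *)
Lemma promote2 M T r a b a' b' : a \in inputs M -> b \in inputs M -> a != b ->
  mrel (mcontr M a b) T r -> b' \notin pts T -> a' \notin pts T -> a' != b' ->
  exists x y r', [/\ x \in pts T, y \in pts (ins T x b'),
    mrel (twist M a b) (ins (ins T x b') y a') r',
    [/\ on_open r' a = a', on_open r' b = b' &
        forall c, c != a -> c != b -> on_open r' c = on_open r c] &
    forall c, on_cycle r' c = addpt y a' (addpt x b' (on_cycle r c))].
Proof.
move=> aM bM ab h bT aT ab'; set M2 := twist M a b.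
have aM2 : a \in inputs M2 by rewrite inputs_twist.
have bM2 : b \in inputs (demote M2 a) by rewrite inputs_demote inputs_twist in_fsetD1 eq_sym ab.
rewrite (mcontr_demote (inputs_pts aM) (inputs_pts bM)) -/M2 in h.
have [x xT h1] := mrel_promote bM2 bT h.
have aT2 : a' \notin pts (ins T x b') by rewrite pts_ins // in_fset1U negb_or ab' aT.
have [y yT h2] := mrel_promote aM2 aT2 h1.
exists x, y; eexists; split; [exact: xT|exact: yT|exact: h2| |by []].
split=> /=; rewrite ?eqxx //; first by rewrite eq_sym (negPf ab).
by move=> c /negPf-> /negPf->.
Qed.

(** Given an isomorphism [r] between two contractions, there is one [z] with inputs [u], [v], [a'],
    [b'] such that gluing a'b' in it gives [t0] and gluing uv gives [s0], up to isomorphisms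
    compatible with [r]. The axiom [hcontrC] and the comparison axiom for joins speak about this
    situation. *)
Definition normalized k u v t0 l a b s0 r := exists z a' b' r0 r1,
  [/\ relabels t0 (tglue l a' b' z) r0, relabels s0 (tglue k u v z) r1,
      on_port k r0 u = u /\ on_port k r0 v = v, on_port l r1 a = a' /\ on_port l r1 b = b' &
  [/\ contractible k u v z, contractible l a' b' z,
      (k = l -> [&& u != a', u != b', v != a' & v != b']) &
    let r2 := rel_glue l a b (mc (tglue k u v z)) r1 in
    let r3 := rel_comp (rel_glue k u v (mc (tglue l a' b' z)) r0) r in
    [/\ {in inputs (mc (tcontr l a b s0)), on_open r2 =1 on_open r3},
        {in mcycles (mc (tcontr l a b s0)), on_cycle r2 =1 on_cycle r3} &
        {in clo (tcontr l a b s0), on_closed r2 =1 on_closed r3}] ]].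

Lemma fresh2 A : exists a b, [/\ a \notin A, b \notin A & a != b].
Proof.
have [a aA] := K_infinite A; have [b] := K_infinite (a |` A).
by rewrite in_fset1U negb_or => /andP[ba bA]; exists a, b; rewrite eq_sym.
Qed.

(** Fresh closed inputs [a'] and [b'] can be added to [t0] directly; [a] and [b] are sent to them,
    and everything else as by [r]. *)
Lemma normalize_closed k u v t0 a b s0 r : contractible k u v t0 -> contractible Closed a b s0 ->
  relabels (tcontr Closed a b s0) (tcontr k u v t0) r -> normalized k u v t0 Closed a b s0 r.
Proof.
move=> /and3P[uv ut vt] /and3P[ab as_ bs] /relabelsE[h bC bG].
have [a' [b' [aC bC' ab']]] := fresh2 (clo t0).
have hu : unglueable Closed a' b' t0 by rewrite /= aC bC'.
have ne : k = Closed -> [&& u != a', u != b', v != a' & v != b'].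
  move=> e; subst k; apply/and4P; split.
  - by apply: contraNneq aC => <-.
  - by apply: contraNneq bC' => <-.
  - by apply: contraNneq aC => <-.
  - by apply: contraNneq bC' => <-.
pose g x := if x == a then a' else if x == b then b' else on_closed r x.
have ga : g a = a' by rewrite /g eqxx.
have gb : g b = b' by rewrite /g (eq_sym b) (negPf ab) eqxx.
have eC : clo (tglue k u v (unglue Closed a' b' t0)) = [fset a'; b'] `|` clo (tcontr k u v t0).
  by rewrite (tglue_unglueC ne) // tcontrE; case: (k).
have [aC2 bC2] : a' \notin clo (tcontr k u v t0) /\ b' \notin clo (tcontr k u v t0).
  rewrite !clo_tglue /=; case: (k) => //.
  by rewrite !in_fsetD (negPf aC) (negPf bC') !andbF.
have gr x : x \in clo s0 -> x != a -> x != b ->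
    g x = on_closed r x /\ on_closed r x \in clo (tcontr k u v t0).
  move=> xs xa xb; rewrite /g (negPf xa) (negPf xb); split=> //.
  by apply: (bij_fset_in bC); rewrite /= in_fsetD in_fset2 negb_or xa xb xs.
exists (unglue Closed a' b' t0), a', b', (rel_id K), (Relabeling (on_open r) (on_cycle r) g).
rewrite (tglueK hu); split.
- exact: relabels_id.
- apply/relabelsE; split.
  + by move: h; case: (k) => h; apply: (mrel_ext (r := r) _ _ h).
  + rewrite eC; apply: bij_fsetI => [x xs|x y xs ys|y] /=.
    * rewrite in_fsetU in_fset2; have [xa|xa] := eqVneq x a; first by rewrite xa ga eqxx.
      have [xb|xb] := eqVneq x b; first by rewrite xb gb eqxx orbT.
      by have [-> ->] := gr x xs xa xb; rewrite orbT.
    * have inj : {in clo (tcontr Closed a b s0) &, injective (on_closed r)} by case: bC.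
      have gn (p : K) : p \in clo s0 -> p != a -> p != b -> g p != a' /\ g p != b'.
        by move=> ps pa pb; have [-> h1] := gr p ps pa pb;
          split; [apply: contraNneq aC2 => <-|apply: contraNneq bC2 => <-].
      have [->|xa] := eqVneq x a; have [->|ya] := eqVneq y a => //; rewrite ?ga.
      - have [->|yb] := eqVneq y b; first by rewrite gb => e; rewrite e eqxx in ab'.
        by move=> e; have [] := gn y ys ya yb; rewrite -e eqxx.
      - have [->|xb] := eqVneq x b; first by rewrite gb => e; rewrite e eqxx in ab'.
        by move=> e; have [] := gn x xs xa xb; rewrite e eqxx.
      have [->|xb] := eqVneq x b; have [->|yb] := eqVneq y b => //; rewrite ?gb.
      - by move=> e; have [_] := gn y ys ya yb; rewrite -e eqxx.
      - by move=> e; have [_] := gn x xs xa xb; rewrite e eqxx.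
      have [-> _] := gr x xs xa xb; have [-> _] := gr y ys ya yb.
      by apply: inj; rewrite /= in_fsetD in_fset2 negb_or ?xa ?xb ?ya ?yb.
    * rewrite in_fsetU in_fset2 => /orP[/orP[]/eqP->|yt].
      - by exists a; rewrite ?ga.
      - by exists b; rewrite ?gb.
      have [x + ->] := bij_fset_surj bC yt; rewrite /= in_fsetD in_fset2 negb_or.
      by move=> /andP[/andP[xa xb] xs]; exists x; rewrite // /g (negPf xa) (negPf xb).
  + by move: bG; rewrite !tcontrE !gen2_tglue /= => -[].
- by case: (k).
- by [].
split=> //.
- rewrite /contractible uv; case: (k) ut vt => /= ut vt; first by rewrite ut vt.
  by rewrite !in_fsetU ut vt !orbT.
- by rewrite /contractible ab' /= !inE !eqxx !orbT.
split=> [x _|c cM|x] /=.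
- by case: (k).
- have cN : on_cycle r c \in mcycles (mc (tcontr k u v t0)) := bij_fset_in (mrel_cycle h) cM.
  case: k {ne eC aC2 bC2 gr bC h bG} ut vt cN => //= ut vt cN.
  case: ifP => uc; first by rewrite (mem_mcycles cN uc).2.
  by case: ifP => // vc; rewrite (mem_mcycles cN vc).2.
rewrite in_fsetD in_fset2 negb_or => /andP[/andP[xa xb] _].
by rewrite /g (negPf xa) (negPf xb); case: (k).
Qed.

(** [promote2] finds the places of [a'] and [b'] in the contraction of [t0]. By [tins_contr], used
    twice, they come from points of [t2], a multicycle isomorphic to [t0], where [unglue] makes them
    inputs. *)
Lemma normalize_open k u v t0 a b s0 r : contractible k u v t0 -> contractible Open a b s0 ->
  relabels (tcontr Open a b s0) (tcontr k u v t0) r -> normalized k u v t0 Open a b s0 r.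
Proof.
move=> q0 /and3P[ab as_ bs] hr; have [h bC bG] := (relabelsE _ _ _).1 hr.
have [a' [b' [aT bT ab']]] := fresh2 (pts (mc t0)).
have pT : pts (mc (tcontr k u v t0)) = pts (mc t0).
  case/and3P: q0; case: (k) => // _ /inputs_pts ut /inputs_pts vt; exact: pts_mcontr ut vt.
set t := tcontr k u v t0 in hr h bC bG pT *; set T := mc t.
have [x [y [r2 [xT yT h2 [r2a r2b r2o] r2c]]]] : exists x y r', _ :=
  promote2 (a' := a') (b' := b') as_ bs ab h (etrans (congr1 (fun A => b' \notin A) pT) bT)
    (etrans (congr1 (fun A => a' \notin A) pT) aT) ab'.
have x0 : x \in pts (mc t0) by rewrite -pT.
have [t1 [ra [h_a e_a fix_a pts_a [ca oa Ca]]]] := tins_contr q0 x0 bT.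
have [ua va] : on_port k ra u = u /\ on_port k ra v = v.
  by case/and3P: q0 => _ ut vt; rewrite !fix_a.
have [q1 _] := relabels_contr h_a q0; rewrite ua va in q1.
have pt1 : pts (mc t1) = b' |` pts (mc t0) := pts_a.
have y1 : y \in pts (mc t1) by rewrite pt1 -pT -(pts_ins b' xT).
have a1 : a' \notin pts (mc t1) by rewrite pt1 in_fset1U negb_or ab'.
have [t2 [rb [h_b e_b fix_b pts_b [cb ob Cb]]]] := tins_contr q1 y1 a1.
have [ub vb] : on_port k rb u = u /\ on_port k rb v = v.
  by case/and3P: q1 => _ ut vt; rewrite !fix_b.
have [q2 _] := relabels_contr h_b q1; rewrite ub vb in q2.
have et2 : tcontr k u v t2 = tins y a' (tins x b' t) by rewrite e_b e_a.
have it2 : inputs (mc t2) = inputs (mc t0).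
  have [[_ <-] _ _ _ _ _] := h_b; have [[_ <-] _ _ _ _ _] := h_a.
  apply/fsetP => w; apply/imfsetP/idP => /= [[w' /imfsetP[w2 /= w2t ->] ->]|wt].
    by rewrite oa ob.
  exists w; rewrite ?ob //; apply/imfsetP; exists w; by rewrite ?oa.
have hu : unglueable Open a' b' t2.
  rewrite /= pts_b pt1 !in_fset1U !eqxx orbT /= it2.
  by apply/andP; split; [apply: contra aT|apply: contra bT]; apply: inputs_pts.
case/and3P: (q2) => uv u2 v2.
have ne : k = Open -> [&& u != a', u != b', v != a' & v != b'].
  move=> e; case/and3P: (q0) => _; rewrite e => /= /inputs_pts ut /inputs_pts vt.
  apply/and4P; split.
  - by apply: contraNneq aT => <-.
  - by apply: contraNneq bT => <-.
  - by apply: contraNneq aT => <-.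
  - by apply: contraNneq bT => <-.
pose T2 := ins (ins T x b') y a'.
have xT' : x \in pts T := xT.
have bT' : b' \notin pts T by rewrite /T pT.
have pT2 : pts T2 = a' |` (b' |` pts T) := etrans (pts_ins a' yT) (congr1 _ (pts_ins b' xT')).
have sT2 : inputs T `<=` pts T2.
  by apply/fsubsetP => p /inputs_pts pTp; rewrite pT2 !in_fset1U pTp !orbT.
have subT2 : [fset a'; b'] `|` inputs T `<=` pts T2.
  rewrite fsubUset sT2 andbT pT2; apply/fsubsetP => p.
  by rewrite in_fset2 !in_fset1U => /orP[]->; rewrite ?orbT.
have iT2 : inputs T2 = a' |` (b' |` inputs T).
  exact: etrans (inputs_ins _ _ _) (congr1 _ (inputs_ins _ _ _)).
have eT2 : mc (tglue k u v t2) = mset T2 (inputs T).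
  have -> : mc (tglue k u v t2) = mc (tcontr k u v t2) by rewrite tcontrE; case: (k).
  rewrite et2; have a3 : a' \notin pts (mc (tins x b' t)) by rewrite (pts_tins b' xT) in_fset1U negb_or ab' pT.
  apply: mcyc_eq => [||p] //.
  by rewrite (inputs_tins y a3) (inputs_tins x bT') (inputs_mset sT2).
have eS1 : mc (tglue k u v (unglue Open a' b' t2)) = twist T2 a' b'.
  rewrite (tglue_unglueC ne) // [LHS]/= eT2; apply: mcyc_eq => [||p] //.
  rewrite inputs_twist iT2 inputs_mset ?(inputs_mset sT2) ?fsetUA //.
  exact: fsubset_trans subT2 (fsubsetUl _ _).
have eG : tcontr Open a' b' (tglue k u v (unglue Open a' b' t2)) = tcontr k u v t2.
  rewrite !tcontrE !tglue_up; congr up; rewrite tglueC ?tglueK // => e.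
  by case/and4P: (ne (esym e)) => ? ? ? ?; rewrite ![a' == _]eq_sym ![b' == _]eq_sym; apply/and4P.
(* [h2] starts from the twist of [mc s0]; a second twist at [a] and [b] on both sides recovers
   [mc s0] itself. *)
have hT2 : mrel (mc s0) (twist T2 a' b') (rel_glue Open a b T2 r2).
  have aI : a \in inputs (twist (mc s0) a b) by rewrite inputs_twist.
  have bI : b \in inputs (twist (mc s0) a b) by rewrite inputs_twist.
  by have := mrel_twist h2 aI bI; rewrite twistK ?inputs_pts // r2a r2b.
pose r1 := Relabeling (on_open r2) (on_cycle (rel_glue Open a b T2 r2)) (on_closed r).
exists (unglue Open a' b' t2), a', b', (rel_comp rb ra), r1; rewrite (tglueK hu).
have hab : relabels t0 t2 (rel_comp rb ra) := relabels_comp h_a h_b.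
split.
- exact: hab.
- apply/relabelsE; rewrite eS1; split.
  + exact: mrel_ext hT2.
  + have -> : clo (tglue k u v (unglue Open a' b' t2)) = clo t; last exact: bC.
    by rewrite -[RHS]/(clo (tins y a' (tins x b' t))) -et2 -eG.
  + have : gen2 (tcontr Open a b s0) = gen2 (tcontr Open a' b' (tglue k u v (unglue Open a' b' t2))).
      by rewrite eG et2.
    by rewrite !tcontrE !gen2_tglue /= !gen2_tglue => -[].
- have ec p : on_port k (rel_comp rb ra) p = on_port k rb (on_port k ra p) by case: (k).
  by rewrite !ec ua va ub vb.
- by [].
split.
- rewrite /contractible uv; case: (k) u2 v2 => /= u2 v2; last by rewrite u2 v2.
  case/and4P: (hu) => aP bP _ _.
  by rewrite (inputs_unglue aP bP) !in_fsetU u2 v2 !orbT.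
- rewrite /contractible ab' (ports_unglue hu) !in_fsetU !in_fset1 !eqxx.
  by rewrite orbT.
- exact: ne.
have eM1 : mcontr (mc (tglue k u v (unglue Open a' b' t2))) a' b' = mset T2 (inputs T).
  rewrite -eT2 -[LHS]/(mc (tcontr Open a' b' (tglue k u v (unglue Open a' b' t2)))) eG.
  by rewrite tcontrE; case: (k).
split=> [p|c cM|p _].
- rewrite inputs_contr => /and3P[pa pb _].
  by rewrite /= r2o //; case: (k); rewrite /= oa ob.
- have cT : on_cycle r c \in mcycles T := bij_fset_in (mrel_cycle h) cM.
  have cT1 : addpt x b' (on_cycle r c) \in mcycles (mc (tcontr k u v t1)).
    rewrite e_a; exact: (bij_fset_in (bij_addpt xT' bT') cT).
  have -> : on_cycle (rel_comp (rel_glue k u v (mc t2) (rel_comp rb ra)) r) c = on_cycle r2 c.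
    rewrite [RHS]r2c -(cb _ cT1) -(ca _ cT) [LHS]/=.
    have cT' : on_cycle r c \in mcycles (mc (tcontr k u v t0)) := cT.
    case: (k) q0 ua va cT' => // /and3P[_ ut vt] ua' va' cT'.
    have ha : mrel (mc t0) (mc t1) ra by case: ((relabelsE _ _ _).1 h_a).
    rewrite (rel_glue_comp _ _ ha ut vt cT').
    by rewrite (ua' : on_open ra u = u) (va' : on_open ra v = v).
  have ecyc p : p \in c -> on_cycle r2 c = mcycle T2 (on_open r2 p) \/ p \notin inputs (mc s0).
    move=> pc; have [pM ec] := mem_mcycles cM pc.
    have [pI|] := boolP (p \in inputs (mc s0)); [left|by right].
    have pI2 : p \in inputs (twist (mc s0) a b) by rewrite inputs_twist.
    by rewrite ec -[mcycle _ p]/(mcycle (twist (mc s0) a b) p) (mrel_mem h2 pI2).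
  have ra1 : on_open r1 a = a' := r2a.
  have rb1 : on_open r1 b = b' := r2b.
  rewrite [LHS]/= -/(on_open r1 a) -/(on_open r1 b) ra1 rb1 eM1.
  case: ifP => [ac|/negbT ac].
    by case: (ecyc a ac) => [->|]; rewrite ?r2a // as_.
  case: ifP => [bc|/negbT bc].
    by case: (ecyc b bc) => [->|]; rewrite ?r2b // bs.
  by rewrite /= (negPf ac) (negPf bc).
- by rewrite /=; case: (k); rewrite /= Ca Cb.
Qed.

Lemma normalize k u v t0 l a b s0 r : contractible k u v t0 -> contractible l a b s0 ->
  relabels (tcontr l a b s0) (tcontr k u v t0) r -> normalized k u v t0 l a b s0 r.
Proof. by case: l => q q'; [apply: normalize_open|apply: normalize_closed]. Qed.

End Normalization.

(** * Lowering the weight of a block, and splitting a block in two *)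

HB.lock Definition lower (K : choiceType) (X : block K) (D : {fset block K}) : {fset block K} :=
  ((X.1, X.2.-1) : block K) |` (D `\ X).

Section Pieces.
Variable K : choiceType.
Local Notation block := (block K).

Implicit Types (M N T : mcyc K) (u v x y a b : K) (A B O : {fset K}) (r : relabeling K)
  (D E F : {fset block}) (s t w z : arity K) (k l : kind) (X Y Z : block).

Lemma cycs_same M N A : pts M = pts N -> nxt M =1 nxt N -> cycs M A = cycs N A.
Proof.
by move=> eP /fsfunP eN; rewrite /cycs /mcycle eP eN.
Qed.

Lemma part_same M N D : pts M = pts N -> nxt M =1 nxt N -> part M D -> part N D.
Proof.
move=> eP eN [h1 h2 h3 h4 h5 h6]; split=> //.
- by move=> X x XD xX; rewrite -eP; apply: h1 XD xX.
- by move=> X x XD xX; rewrite -eN; apply: h3.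
- by move=> X /h4; rewrite (cycs_same _ eP eN).
- by move=> x; rewrite -eP; apply: h6.
Qed.

Lemma contr_contr M u v : u \in pts M -> v \in pts M ->
  pts (mcontr (mcontr M u v) u v) = pts M /\ nxt (mcontr (mcontr M u v) u v) =1 nxt M.
Proof.
move=> uM vM; have [uM' vM'] : u \in pts (mcontr M u v) /\ v \in pts (mcontr M u v).
  by rewrite pts_mcontr.
split=> [|x]; first by rewrite (pts_mcontr uM' vM') pts_mcontr.
by rewrite !nxt_mcontr fstpermK.
Qed.

(** A contraction inside one block only adds 1 to its weight, so undoing it subtracts 1. The
    numerical hypothesis is exactly [part_gen] for the lowered block, with the cycles counted after
    exchanging the successors of [u] and [v]. *)
Lemma part_lower M D X u v : part M D -> X \in D -> u \in X.1 -> v \in X.1 -> u != v ->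
  (exists g : nat, X.2 = 2 * g + #|` cycs (mcontr M u v) X.1|)%N ->
  part (mcontr M u v) (lower X D) /\ bmerge u v (lower X D) = D.
Proof.
move=> pD XD uX vX uv [g eg].
have [uM vM] := (part_sub pD XD uX, part_sub pD XD vX).
set X' : block := (X.1, X.2.-1).
have lowerP Z : (Z \in lower X D) = (Z == X') || (Z != X) && (Z \in D).
  by rewrite lower.unlock in_fset1U in_fsetD1.
have X0 : (0 < X.2)%N.
  have : (0 < #|` cycs (mcontr M u v) X.1|)%N.
    by rewrite cardfs_gt0; apply/fset0Pn; exists (mcycle (mcontr M u v) u); apply: mem_cycs.
  by rewrite eg; move: (#|` _|) => n; clear; lia.
have nX Z x : Z != X -> Z \in D -> x \in Z.1 -> x \in X.1 -> False.
  by move=> ZX ZD xZ xX; case/eqP: ZX; apply: (part_disj pD ZD XD xZ xX).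
have pl : part (mcontr M u v) (lower X D).
  split.
  - move=> Z x; rewrite lowerP pts_mcontr // => /orP[/eqP->|/andP[_ ZD]]; first exact: (part_sub pD XD).
    exact: (part_sub pD ZD).
  - move=> Z; rewrite lowerP => /orP[/eqP->|/andP[_ ZD]]; first exact: (part_ne pD XD).
    exact: (part_ne pD ZD).
  - move=> Z x; rewrite lowerP nxt_mcontr => /orP[/eqP->|/andP[ZX ZD]] xZ.
      by apply: (part_closed pD XD); rewrite fstpermE; case: eqP => // _; case: eqP.
    rewrite fstpermE; have [e|_] := eqVneq x u; first by case: (nX Z x ZX ZD xZ); rewrite e.
    have [e|_] := eqVneq x v; first by case: (nX Z x ZX ZD xZ); rewrite e.
    exact: (part_closed pD ZD).
  - move=> Z; rewrite lowerP => /orP[/eqP->|/andP[ZX ZD]].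
      by exists g; rewrite /= prednK.
    have [h eh] := part_gen pD ZD; exists h; rewrite eh cycs_contr_out //.
    + exact: (block_sub pD ZD).
    + exact: (block_closed pD ZD).
    + by apply/negP => uZ; apply: (nX Z u).
    + by apply/negP => vZ; apply: (nX Z v).
  - move=> Z W x; rewrite !lowerP => /orP[/eqP->|/andP[ZX ZD]] /orP[/eqP->|/andP[WX WD]] //= xZ xW.
    + by case: (nX W x).
    + by case: (nX Z x).
    + exact: (part_disj pD ZD WD xZ xW).
  - move=> x; rewrite pts_mcontr // => /(part_cover pD)[Z ZD xZ].
    have [e|ZX] := eqVneq Z X; first by rewrite e in xZ; exists X'; rewrite ?lowerP ?eqxx.
    by exists Z; rewrite // lowerP ZX ZD orbT.
split=> //; have X'l : X' \in lower X D by rewrite lowerP eqxx.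
have bu : blk (lower X D) u = X' := blk_eq pl X'l uX.
have bv : blk (lower X D) v = X' := blk_eq pl X'l vX.
rewrite mergeE bu bv mblock_id /= prednK // -surjective_pairing fsetD1_id.
apply/fsetP => Z; rewrite in_fset1U in_fsetD1 lowerP.
have [->|ZX] := eqVneq Z X; first by rewrite XD.
rewrite /=; have [e|//] := eqVneq Z X'.
apply/esym/negP => ZD; case/eqP: ZX; apply: (part_disj pD ZD XD _ uX).
by rewrite e.
Qed.

(** Converse of [part_lower]: when a contraction was made inside one block, the partition before it
    is determined by the partition after it. *)
Lemma bmerge_lower M E a b : part M E -> a \in pts M -> b \in pts M -> a != b ->
  blk E a = blk E b ->
  [/\ blk (bmerge a b E) a = ((blk E a).1, (blk E a).2.+1) &
      E = lower (blk (bmerge a b E) a) (bmerge a b E)].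
Proof.
move=> pE aM bM ab e; have [YE aY] := blk_in pE aM.
have ba : blk (bmerge a b E) a = ((blk E a).1, (blk E a).2.+1).
  by rewrite (blk_merge pE aM bM ab aM) eqxx /= -e mblock_id.
split=> //; rewrite ba lower.unlock /= -surjective_pairing mergeE -e mblock_id fsetD1_id.
apply/fsetP => Z; rewrite in_fset1U in_fsetD1 in_fset1U in_fsetD1.
have [->|ZY] /= := eqVneq Z (blk E a); first by rewrite YE.
have [eZ|] //= := eqVneq Z ((blk E a).1, (blk E a).2.+1).
by apply/negP => ZE; case/eqP: ZY; apply: (part_disj pE ZE YE _ aY); rewrite eZ.
Qed.

Definition restr M A := msub M (cycs M A).

Section Restrict.
Variables (M : mcyc K) (A : {fset K}).
Hypotheses (sA : {subset A <= pts M}) (cA : {in A, forall x, nxt M x \in A}).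

Lemma mem_pts_restr x : (x \in pts (restr M A)) = (x \in A).
Proof.
rewrite mem_pts_msub; apply/andP/idP => [[xM /cycsP[y yA e]]|xA].
  have /fsubsetP := mcycle_closed (sA yA) yA cA; apply.
  by rewrite -e mem_mcycle.
by rewrite sA // mem_cycs.
Qed.

Lemma pts_restr : pts (restr M A) = A.
Proof. by apply/fsetP => x; apply: mem_pts_restr. Qed.

Lemma nxt_restr x : x \in A -> nxt (restr M A) x = nxt M x.
Proof. by move=> xA; rewrite nxt_msub // mem_pts_restr. Qed.

Lemma inputs_restr x : (x \in inputs (restr M A)) = (x \in inputs M) && (x \in A).
Proof.
rewrite inputs_msub; case: (boolP (x \in A)) => [xA|xA]; first by rewrite mem_cycs.
rewrite andbF; apply: contraNF xA => /andP[/inputs_pts xM xc].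
by rewrite -mem_pts_restr mem_pts_msub xM.
Qed.

Lemma part_restr D1 D2 : part M (D1 `|` D2) ->
  (forall X, X \in D1 -> X.1 `<=` A) -> (forall X, X \in D2 -> [disjoint X.1 & A]) ->
  part (restr M A) D1.
Proof.
move=> pD h1 h2; have s1 X : X \in D1 -> X \in D1 `|` D2 by move=> XD; rewrite in_fsetU XD.
split.
- by move=> X x XD xX; rewrite mem_pts_restr; apply: (fsubsetP (h1 X XD)).
- by move=> X XD; apply: (part_ne pD (s1 X XD)).
- move=> X x XD xX; rewrite nxt_restr; first exact: (part_closed pD (s1 X XD)).
  by apply: (fsubsetP (h1 X XD)).
- move=> X XD; have [g eg] := part_gen pD (s1 X XD); exists g; rewrite eg; congr (_ + #|` _|)%N.
  apply: eq_in_imfset => //= x xX; rewrite mcycle_msub // -/(restr M A) mem_pts_restr.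
  by apply: (fsubsetP (h1 X XD)).
- by move=> X Y x XD YD; apply: (part_disj pD (s1 X XD) (s1 Y YD)).
- move=> x; rewrite mem_pts_restr => xA; have [X] := part_cover pD (sA xA).
  rewrite in_fsetU => /orP[XD xX|XD xX]; first by exists X.
  by case: (fdisjointF (h2 X XD) xX xA).
Qed.

Lemma closedC : {in pts M `\` A, forall x, nxt M x \in pts M `\` A}.
Proof.
move=> x; rewrite !in_fsetD nxt_pts => /andP[xA xM]; rewrite xM andbT.
apply: contra xA => nA; have nM : nxt M x \in pts M by rewrite nxt_pts.
have /fsubsetP := mcycle_closed nM nA cA; apply.
by rewrite mcycle_nxt mem_mcycle.
Qed.

End Restrict.

Lemma munion_restr M A : {subset A <= pts M} -> {in A, forall x, nxt M x \in A} ->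
  munion (restr M A) (restr M (pts M `\` A)) = M.
Proof.
move=> sA cA; have cB := closedC cA.
have sB : {subset pts M `\` A <= pts M} by move=> x; rewrite in_fsetD => /andP[].
have pA := pts_restr sA cA; have pB := pts_restr sB cB.
have d : [disjoint pts (restr M A) & pts (restr M (pts M `\` A))].
  by rewrite pA pB; apply/fdisjointP => x xA; rewrite in_fsetD xA.
apply: mcyc_eq => [||x].
- rewrite -[LHS]/(pts (restr M A) `|` pts (restr M (pts M `\` A))) pA pB.
  by apply/fsetP => x; rewrite in_fsetU in_fsetD; case: (boolP (x \in A)) => // /sA ->.
- apply/fsetP => x; rewrite inputs_munion in_fsetU !inputs_restr // -andb_orr in_fsetD.
  case: (boolP (x \in inputs M)) => //= /inputs_pts ->.
  by case: (x \in A).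
have [xA|xA] := boolP (x \in A); first by rewrite (nxt_munionl d) ?(nxt_restr sA cA xA) // pA.
have [xM|xM] := boolP (x \in pts M).
  have xB : x \in pts M `\` A by rewrite in_fsetD xA.
  by rewrite (nxt_munionr d) ?(nxt_restr sB cB xB) // pB.
rewrite nxt_munion (nxt_out xM) !nxt_out ?pA ?pB // ?in_fsetD ?(negPf xM) ?andbF //.
Qed.

(* The assumption on [Y.2] says that Y has genus 0 after the merge of two of its
   cycles in [mcontr M u v], so that Y arises from two nests of genus 0. *)
Lemma part_split M E Y A u v : part (mcontr M u v) E -> u \in pts M -> v \in pts M -> u != v ->
  Y \in E -> u \in Y.1 -> v \in Y.1 -> A `<=` Y.1 -> {in A, forall x, nxt M x \in A} ->
  u \in A -> v \notin A -> (Y.2.+2 = #|` cycs M Y.1|)%N ->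
  let D1 := [fset ((A, #|` cycs M A|.-1) : block)] in
  let D2 := ((Y.1 `\` A, #|` cycs M (Y.1 `\` A)|.-1) : block) |` (E `\ Y) in
  [/\ part M (D1 `|` D2), (forall X, X \in D1 -> X.1 `<=` A), (forall X, X \in D2 -> [disjoint X.1 & A])
    & forall p q, p \in A -> q \in Y.1 -> q \notin A -> bmerge p q (D1 `|` D2) = E].
Proof.
move=> pE uM vM uv YE uY vY sA cA uA vA eY D1 D2.
set X1 : block := (A, _) in D1 *; set X2 : block := (Y.1 `\` A, _) in D2 *.
have ptsE : pts (mcontr M u v) = pts M := pts_mcontr uM vM.
have sY : {subset Y.1 <= pts M} by move=> x /(part_sub pE YE); rewrite ptsE.
have sAM : {subset A <= pts M} by move=> x /(fsubsetP sA)/sY.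
have cY : {in Y.1, forall x, nxt M x \in Y.1}.
  move=> x xY; have := part_closed pE YE; move=> /(_ (fstperm u v x)).
  rewrite nxt_mcontr fstpermK; apply; rewrite fstpermE.
  by case: eqP => // _; case: eqP.
have cB : {in Y.1 `\` A, forall x, nxt M x \in Y.1 `\` A}.
  move=> x; rewrite !in_fsetD => /andP[xA xY]; rewrite cY // andbT.
  by have := closedC cA (x := x); rewrite !in_fsetD xA sY // => /(_ isT)/andP[].
have vB : v \in Y.1 `\` A by rewrite in_fsetD vA.
have nY Z x : Z \in E -> Z != Y -> x \in Z.1 -> x \in Y.1 -> False.
  by move=> ZE ZY xZ xY; case/eqP: ZY; apply: (part_disj pE ZE YE xZ xY).
have inD Z : (Z \in D1 `|` D2) = [|| Z == X1, Z == X2 | (Z != Y) && (Z \in E)].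
  by rewrite in_fsetU in_fset1 in_fset1U in_fsetD1.
have gt0 (B : {fset K}) x : x \in B -> (0 < #|` cycs M B|)%N.
  by move=> xB; rewrite cardfs_gt0; apply/fset0Pn; exists (mcycle M x); apply: mem_cycs.
have dAB : [disjoint A & Y.1 `\` A] by apply/fdisjointP => x xA; rewrite in_fsetD xA.
have eAB : A `|` (Y.1 `\` A) = Y.1.
  by apply/fsetP => x; rewrite in_fsetU in_fsetD; case: (boolP (x \in A)) => // /(fsubsetP sA) ->.
have pD : part M (D1 `|` D2).
  split.
  - move=> Z x; rewrite inD => /or3P[/eqP->|/eqP->|/andP[_ ZE]] /=.
    + exact: sAM.
    + by rewrite in_fsetD => /andP[_ /sY].
    + by rewrite -ptsE; apply: (part_sub pE ZE).
  - move=> Z; rewrite inD => /or3P[/eqP->|/eqP->|/andP[_ ZE]].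
    + by apply/fset0Pn; exists u.
    + by apply/fset0Pn; exists v.
    + exact: (part_ne pE ZE).
  - move=> Z x; rewrite inD => /or3P[/eqP->|/eqP->|/andP[ZY ZE]] xZ; [exact: cA|exact: cB|].
    have := part_closed pE ZE xZ; rewrite nxt_mcontr fstpermE.
    have [e|_] := eqVneq x u; first by case: (nY Z x ZE ZY xZ); rewrite e.
    by have [e|_] := eqVneq x v; first by case: (nY Z x ZE ZY xZ); rewrite e.
  - move=> Z; rewrite inD => /or3P[/eqP->|/eqP->|/andP[ZY ZE]].
    + by exists 0; rewrite muln0 add0n /= prednK // (gt0 A u).
    + by exists 0; rewrite muln0 add0n /= prednK // (gt0 _ v).
    have [g eg] := part_gen pE ZE; exists g; rewrite eg cycs_contr_out //.
    + by rewrite -ptsE; apply: (block_sub pE ZE).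
    + move=> x xZ; have := part_closed pE ZE xZ; rewrite nxt_mcontr fstpermE.
      have [e|_] := eqVneq x u; first by case: (nY Z x ZE ZY xZ); rewrite e.
      by have [e|_] := eqVneq x v; first by case: (nY Z x ZE ZY xZ); rewrite e.
    + by apply/negP => uZ; apply: (nY Z u).
    + by apply/negP => vZ; apply: (nY Z v).
  - have sX1 x : x \in X1.1 -> x \in Y.1 by move/(fsubsetP sA).
    have sX2 x : x \in X2.1 -> x \in Y.1 by rewrite in_fsetD => /andP[].
    have s12 x : x \in X1.1 -> x \in X2.1 -> False by apply: fdisjointF.
    move=> Z W x; rewrite !inD => /or3P[/eqP->|/eqP->|/andP[ZY ZE]] /or3P[/eqP->|/eqP->|/andP[WY WE]] xZ xW //.
    + by case: (s12 x).
    + by case: (nY W x) => //; apply: sX1.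
    + by case: (s12 x).
    + by case: (nY W x) => //; apply: sX2.
    + by case: (nY Z x) => //; apply: sX1.
    + by case: (nY Z x) => //; apply: sX2.
    + exact: (part_disj pE ZE WE xZ xW).
  - move=> x; rewrite -ptsE => /(part_cover pE)[Z ZE xZ].
    have [e|ZY] := eqVneq Z Y; last by exists Z; rewrite // inD ZY ZE !orbT.
    rewrite e in xZ; have [xA|xA] := boolP (x \in A).
      by exists X1; rewrite // inD eqxx.
    by exists X2; rewrite ?inD ?eqxx ?orbT //= in_fsetD xA.
split=> //.
- by move=> X; rewrite in_fset1 => /eqP->.
- move=> X; rewrite in_fset1U in_fsetD1 => /orP[/eqP->|/andP[XY XE]].
    by rewrite fdisjoint_sym.
  by apply/fdisjointP => x xX; apply/negP => /(fsubsetP sA); apply: nY XE XY xX.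
move=> p q pA qY qA.
have X1D : X1 \in D1 `|` D2 by rewrite inD eqxx.
have X2D : X2 \in D1 `|` D2 by rewrite inD eqxx orbT.
have bp : blk (D1 `|` D2) p = X1 := blk_eq pD X1D pA.
have bq : blk (D1 `|` D2) q = X2 by apply: (blk_eq pD X2D); rewrite in_fsetD qA.
have X12 : X1 != X2 by apply/eqP => -[e _]; have := vB; rewrite -e (negPf vA).
have nX Z x : x \in Z.1 -> x \in Y.1 -> Z != Y -> Z \in E = false.
  by move=> xZ xY ZY; apply/negP => ZE; apply: nY ZE ZY xZ xY.
rewrite mergeE bp bq (mblock_neqE X12) /= eAB.
(* Two nests of genus 0 with c1 and c2 cycles have weights c1 - 1 and c2 - 1, and c1 + c2 is the
   weight of [Y] plus 2. *)
have -> : ((#|` cycs M A|.-1 + #|` cycs M (Y.1 `\` A)|.-1)%N = Y.2).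
  have := eY; rewrite -{1}eAB card_cycsU //; last 2 first.
  - exact/fsubsetP.
  - by apply/fsubsetP => x; rewrite in_fsetD => /andP[_ /sY].
  have := gt0 A u uA; have := gt0 _ v vB.
  by move: (#|` _|) (#|` _|) (Y.2) => c1 c2 n; clear; lia.
rewrite -surjective_pairing; apply/fsetP => Z; rewrite in_fset1U !in_fsetD1 inD.
have [->|ZY] /= := eqVneq Z Y; first by rewrite YE.
have [e|_] := eqVneq Z X2; first by rewrite (nX Z v) // e.
by have [e|_] := eqVneq Z X1; first by rewrite (nX Z u) // e.
Qed.

End Pieces.

(** * Existence of presentations *)

Section Existence.
Variable K : choiceType.
Hypothesis K_infinite : forall A : {fset K}, exists x : K, x \notin A.
Variables (P : arity K -> Type) (SP : cyclic_str P) (TP : modular_str SP).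
Variable f : forall t, OC t -> P t.
Hypothesis f_hom : cyclic_hom (OC_cyclic K) SP f.

Local Notation block := (block K).
Local Notation reaches := (reaches TP f).

Implicit Types (M N T : mcyc K) (u v x y a b c d : K) (A B O : {fset K}) (r : relabeling K)
  (D E F : {fset block}) (s t w z : arity K) (k l : kind) (X Y Z : block).

Definition down t : arity K := Arity (mc t) (clo t) (gen2 t - 2).

Lemma up_down t : (2 <= gen2 t)%N -> up (down t) = t.
Proof. by move=> h; apply: arity_eq => //=; rewrite -addn2 subnK. Qed.

(** Undoing a contraction lowers [gen2] by 2, and the equation for the genus must stay solvable in
    natural numbers. Inside a block g is unchanged; for a closed contraction g drops by 1, whence
    the assumption that it is positive. *)
Lemma ok_lift k u v t E : contractible k u v t -> part (mc t) E ->
  ok (tcontr k u v t) (bcontr k u v E) ->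
  (k = Open -> blk E u = blk E v) -> (k = Closed -> 0 < gen (tcontr k u v t) (bcontr k u v E))%N ->
  ok t E.
Proof.
move=> /and3P[uv ut vt] pE [_]; move: (gen _ _) => g eg hO hC.
have w := weight_contr uv ut vt pE.
have eC : clo (tcontr k u v t) = clo (tglue k u v t) by rewrite tcontrE; case: (k).
have eG : gen2 (tcontr k u v t) = (gen2 t).+2 by rewrite tcontrE gen2_tglue.
rewrite eC eG in eg.
suff [h eh] : exists h, (gen2 t + 2 = sigma E + #|` clo t| + 4 * h)%N by case: (okI pE eh).
case: k {ut vt eC eG} hO hC eg w => hO hC eg.
  rewrite (hO erefl) eqxx => w; exists g; move: eg w.
  by move: (sigma _) (sigma _) (#|` _|) (gen2 t) => a b c d; clear; lia.
move=> w; exists g.-1; move: eg w (hC erefl).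
by move: (sigma _) (#|` _|) (#|` _|) (gen2 t) (g) => a b c d e; clear; lia.
Qed.

Lemma sigma_ge D X : X \in D -> (2 * X.2 + 2 <= sigma D)%N.
Proof. by move=> XD; rewrite /sigma (big_fsetD1 X XD) leq_addr. Qed.

Lemma bset_ins M x a A y : {subset A <= pts M} -> y \in A -> y \in bset M (rel_ins x a) A.
Proof.
move=> sA yA; apply/bsetP; exists y; rewrite //= /addpt.
by case: ifP => _; rewrite ?in_fset1U mem_mcycle ?orbT // sA.
Qed.

Lemma bset_ins_new M x a A : {subset A <= pts M} -> x \in A -> a \in bset M (rel_ins x a) A.
Proof.
move=> sA xA; apply/bsetP; exists x; rewrite //= /addpt mem_mcycle ?sA //.
by rewrite in_fset1U eqxx.
Qed.

(* The two points are inserted into different cycles if there are several, and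
   the contraction to be undone is then a cut; otherwise g > 0 and it is a merge. *)
Lemma insert_pair t D X : part (mc t) D -> X \in D -> (0 < X.2)%N ->
  exists a b t' r, [/\ relabels t t' r, unglueable Open a b t', a != b &
    exists2 X', X' \in bmap (mc t) r D &
    [/\ a \in X'.1, b \in X'.1, X'.2 = X.2 &
     exists g, (X'.2 = 2 * g + #|` cycs (mcontr (mc t') a b) X'.1|)%N]].
Proof.
move=> pD XD X0; have [a [b [aM bM ab]]] := fresh2 K_infinite (pts (mc t)).
have /fset0Pn[x xX] := part_ne pD XD; have xM := part_sub pD XD xX.
(* The places of insertion are [x] and [y], on different cycles whenever the block has more than
   one. *)
have [y yX hy] : exists2 y, y \in X.1 &
    if y \in mcycle (mc t) x then #|` cycs (mc t) X.1| = 1 else True.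
  have [/hasP[y yX yx]|/hasPn h] := boolP (has (fun y => y \notin mcycle (mc t) x) X.1).
    by exists y; rewrite // (negPf yx).
  exists x; rewrite // mem_mcycle //; apply/eqP/cardfs1P; exists (mcycle (mc t) x).
  apply/fsetP => c; rewrite in_fset1; apply/cycsP/eqP => [[y yX ->]|->]; last by exists x.
  by apply: mcycle_eq => //; have := h y yX; rewrite negbK.
set t1 := tins x a t; set r1 := rel_ins x a; have h1 : relabels t t1 r1 := relabels_ins xM aM.
have p1 : pts (mc t1) = a |` pts (mc t) := pts_tins a xM.
have a1 : a \in pts (mc t1) by rewrite p1 !inE eqxx.
have bM1 : b \notin pts (mc t1) by rewrite p1 in_fset1U negb_or eq_sym ab.
have yM1 : y \in pts (mc t1) by rewrite p1 in_fset1U (part_sub pD XD yX) orbT.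
set t2 := tins y b t1; set r2 := rel_ins y b; have h2 : relabels t1 t2 r2 := relabels_ins yM1 bM1.
have p2 : pts (mc t2) = b |` pts (mc t1) := pts_tins b yM1.
have [m1 _ _] := (relabelsE _ _ _).1 h1; have [m2 _ _] := (relabelsE _ _ _).1 h2.
have pD1 := part_map m1 pD; have pD2 := part_map m2 pD1.
set D1 := bmap (mc t) r1 D in pD1 pD2; set D2 := bmap (mc t1) r2 D1 in pD2.
pose X1 : block := (bset (mc t) r1 X.1, X.2); pose X2 : block := (bset (mc t1) r2 X1.1, X.2).
have X1D : X1 \in D1 := bmap_in _ _ XD; have X2D : X2 \in D2 := bmap_in _ _ X1D.
have sX : {subset X.1 <= pts (mc t)} by move=> z; apply: (part_sub pD XD).
have sX1 : {subset X1.1 <= pts (mc t1)} by move=> z; apply: (part_sub pD1 X1D).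
have aX1 : a \in X1.1 by apply: bset_ins_new.
have yX1 : y \in X1.1 by apply: bset_ins.
have aX2 : a \in X2.1 by apply: bset_ins.
have bX2 : b \in X2.1 by apply: bset_ins_new.
have c2 : #|` cycs (mc t2) X2.1| = #|` cycs (mc t) X.1|.
  by rewrite (card_cycs_bset m2 pD1 X1D) (card_cycs_bset m1 pD XD).
have bc : (b \in mcycle (mc t2) a) = (y \in mcycle (mc t) x).
  rewrite -[mcycle (mc t2) a]/(mcycle (ins (mc t1) y b) a) mcycle_ins //.
  rewrite -[mcycle (mc t1) a]/(mcycle (ins (mc t) x a) a) mcycle_ins_a // !in_fset1U.
  have -> : y == a = false by apply: contraNF aM => /eqP <-; apply: sX.
  rewrite /=; case: ifP => yx; first by rewrite in_fset1U eqxx.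
  rewrite in_fset1U eq_sym (negPf ab) /=; apply: contraNF bM; exact: mem_mcycle_pts.
exists a, b, t2, (rel_comp r2 r1); split=> //; first exact: relabels_comp h1 h2.
  have i1 : inputs (mc t1) = inputs (mc t) := inputs_tins x aM.
  have i2 : inputs (mc t2) = inputs (mc t1) := inputs_tins y bM1.
  rewrite /= p2 !in_fset1U a1 eqxx orbT /= -[inputs _]/(inputs (mc t2)) i2 i1.
  by apply/andP; split; [apply: contra aM|apply: contra bM]; apply: inputs_pts.
exists X2; first by rewrite (bmap_comp m1 m2 pD).
split=> //; have [g eg] := part_gen pD2 X2D.
have := card_cycs_contr (block_sub pD2 X2D) (block_closed pD2 X2D) ab aX2 bX2.
rewrite bc; case: ifP hy => yx; last first.
  by move=> _ ec; exists g; move: eg; rewrite -ec addnS => -[].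
(* A single cycle gives weight 2g, positive by assumption. Exchanging the successors of [a] and [b]
   splits the cycle in two, so the genus has to drop by 1. *)
rewrite -c2 => e1 ec; exists g.-1; move: eg ec X0; rewrite e1 /X2 /=.
by move=> eg ->; move: eg; move: (X.2) (g) => n h; clear; lia.
Qed.

(** The chosen last contraction: a closed one as long as the genus is positive, then an open one
    inside a block of positive weight. The clause on open contractions limits the cases that
    [confluent] has to compare. *)
Lemma uncontract t D : ok t D -> (0 < degree t D)%N ->
  exists t' r k u v t0 E, [/\ relabels t t' r, contractible k u v t0, ok t0 E &
    [/\ tcontr k u v t0 = t', bcontr k u v E = bmap (mc t) r D
      & k = Open -> gen t' (bmap (mc t) r D) = 0]].
Proof.
move=> oD dD; have [pD eD] := oD; have [g0|] := posnP (gen t D); last first.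
  move=> g1; have [a [b [aC bC ab]]] := fresh2 K_infinite (clo t).
  have hu : unglueable Closed a b (down t) by rewrite /= aC.
  have q : contractible Closed a b (unglue Closed a b (down t)).
    by rewrite /contractible ab /= !inE !eqxx !orbT.
  have et : tcontr Closed a b (unglue Closed a b (down t)) = t.
    rewrite tcontrE tglue_up tglueK // up_down //; move: eD g1.
    by move: (sigma _) (#|` _|) (gen2 t) (gen t D) => c d e h; clear; lia.
  exists t, (rel_id K), Closed, a, b, (unglue Closed a b (down t)), D.
  have -> : bmap (mc t) (rel_id K) D = D by apply: (bmap_id pD).
  split=> //; first exact: relabels_id.
  by apply: (ok_lift (k := Closed) q) => //; rewrite et.
have [/hasP[X XD X0]|/hasPn h] := boolP (has (fun X : block => 0 < X.2)%N D); last first.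
  have : tweight D = 0.
    by rewrite /tweight big_seq big1 // => X XD; apply/eqP; rewrite -leqn0 leqNgt h.
  by move: dD; rewrite /degree g0 addn0 => + e; rewrite e.
have [a [b [t' [r [hr hu ab [X' XD' [aX bX eX hg]]]]]]] := insert_pair pD XD X0.
have [oD' gD'] := ok_map hr oD; have [pD' eD'] := oD'.
have [pl el] := part_lower pD' XD' aX bX ab hg.
have q : contractible Open a b (unglue Open a b (down t')).
  rewrite /contractible ab; case/and4P: (hu) => aM bM _ _.
  by rewrite /ports (@inputs_unglue _ a b (down t') aM bM) !inE !eqxx !orbT.
(* The block [X] of positive weight contributes at least 4 to [sigma], so [gen2] is at least 2 and
   can be lowered by 2. *)
have et : tcontr Open a b (unglue Open a b (down t')) = t'.
  rewrite tcontrE tglue_up tglueK // up_down //; move: eD' (sigma_ge XD') X0; rewrite eX.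
  by move: (sigma _) (#|` _|) (gen2 t') (gen t' _) (X.2) => c d e h2 h3; clear; lia.
have pE : part (mc (unglue Open a b (down t'))) (lower X' (bmap (mc t) r D)).
  by apply: part_same pl.
exists t', r, Open, a, b, (unglue Open a b (down t')), (lower X' (bmap (mc t) r D)).
split=> //; last by split=> //; rewrite gD'.
apply: (ok_lift q pE) => //; rewrite ?et ?[bcontr _ _ _ _]el // => _.
have X'l : ((X'.1, X'.2.-1) : block) \in lower X' (bmap (mc t) r D).
  by rewrite lower.unlock in_fset1U eqxx.
by rewrite (blk_eq pl X'l aX) (blk_eq pl X'l bX).
Qed.

Lemma reaches_total n t D : ok t D -> degree t D = n -> exists p : P t, reaches n D p.
Proof.
elim: n t D => [|n IH] t D oD dD.
  have [-> o] := degree0 oD dD; exists (f (OC_elt o)); exact: reaches_base.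
have [|t' [r [k [u [v [t0 [E [hr q oE [et eD _]]]]]]]]] := uncontract oD; first by rewrite dD.
have [r' [hr' i]] := relabels_inv K_infinite hr; have [pD _] := oD.
have [|p hp] := IH t0 E oE.
  by have := degree_contr q oE; rewrite et eD (degree_map hr oD) dD => -[].
have [p' hp'] : exists p' : P t', reaches n.+1 (bmap (mc t) r D) p'.
  by rewrite -et -eD; exists (hcontr TP q p); apply: reaches_contr.
by exists (hmap SP hr' p'); rewrite -(bmap_inv hr hr' i pD); apply: reaches_map.
Qed.

End Existence.

(** * Comparison of two last contractions *)

Section Cut.
Variable K : choiceType.
Hypothesis K_infinite : forall A : {fset K}, exists x : K, x \notin A.
Variables (P : arity K -> Type) (SP : cyclic_str P) (TP : modular_str SP).
Variable f : forall t, OC t -> P t.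
Hypothesis f_hom : cyclic_hom (OC_cyclic K) SP f.

Local Notation block := (block K).
Local Notation reaches := (reaches TP f).

Implicit Types (M N T : mcyc K) (u v x y a b c d : K) (A B O : {fset K}) (r : relabeling K)
  (D E F : {fset block}) (s t w z : arity K) (k l : kind) (X Y Z : block).

Definition determined n := forall t D (p p' : P t), reaches n D p -> reaches n D p' -> p = p'.

(** An element over [z] with blocks [E2] has a presentation; by determinacy in degree n its two
    contractions are [p1] and [p0], and contractions commute. *)
Lemma contr_common n k u v l a b z E2 (p1 : P (tcontr k u v z)) (p0 : P (tcontr l a b z))
    (qa : contractible l a b (tcontr k u v z)) (qu : contractible k u v (tcontr l a b z)) :
  determined n -> contractible k u v z -> contractible l a b z -> ok z E2 ->
  reaches n (bcontr k u v E2) p1 -> reaches n (bcontr l a b E2) p0 ->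
  existT P _ (hcontr TP qa p1) = existT P _ (hcontr TP qu p0).
Proof.
move=> U qk ql oE h1 h0; have [p2 hp2] := reaches_total K_infinite TP f oE erefl.
have en : n = (degree z E2).+1 by case: (reaches_ok h1) => _ <-; apply: degree_contr.
move: U h1 h0; rewrite en => U h1 h0.
rewrite (U _ _ _ _ h1 (reaches_contr qk hp2)) (U _ _ _ _ h0 (reaches_contr ql hp2)).
exact: (hcontrC TP).
Qed.

(** By determinacy in degree n, [p1] and [p0] are the joins along uv and along ab of the same two
    elements, so [hcontr_join2] applies. No element over [z] itself is involved. *)
Lemma contr_cut n k u v l a b s1 s2 E1 E2 (p1 : P (tjoin k u v s1 s2)) (p0 : P (tjoin l a b s1 s2))
    (qa : contractible l a b (tjoin k u v s1 s2)) (qu : contractible k u v (tjoin l a b s1 s2)) :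
  determined n -> joinable k u v s1 s2 -> joinable l a b s1 s2 -> ok s1 E1 -> ok s2 E2 ->
  reaches n (bcontr k u v (E1 `|` E2)) p1 -> reaches n (bcontr l a b (E1 `|` E2)) p0 ->
  existT P _ (hcontr TP qa p1) = existT P _ (hcontr TP qu p0).
Proof.
move=> U jk jl o1 o2 h1 h0.
have [x hx] := reaches_total K_infinite TP f o1 erefl.
have [y hy] := reaches_total K_infinite TP f o2 erefl.
have en : n = (degree s1 E1 + degree s2 E2)%N by case: (reaches_ok h1) => _ <-; apply: degree_join.
move: U h1 h0; rewrite en => U h1 h0.
rewrite (U _ _ _ _ h1 (reaches_join K_infinite f_hom jk hx hy)).
rewrite (U _ _ _ _ h0 (reaches_join K_infinite f_hom jl hx hy)).
exact: (hcontr_join2 TP).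
Qed.

Section Core.
Variables (n : nat) (U : determined n).
Variables (k l : kind) (u v a b : K) (z s1 t1 : arity K).
Hypotheses (uv : u != v) (ab : a != b)
  (uz : u \in ports k z) (vz : v \in ports k z) (az : a \in ports l z) (bz : b \in ports l z).
Hypotheses (es : s1 = tglue k u v z) (et : t1 = tglue l a b z).
Variables (E1 E0 : {fset block}) (p1 : P s1) (p0 : P t1).
Hypotheses (h1 : reaches n E1 p1) (h0 : reaches n E0 p0).
Variables (qa : contractible l a b s1) (qu : contractible k u v t1).
Let goal := existT P _ (hcontr TP qa p1) = existT P _ (hcontr TP qu p0).

Lemma core_common E2 : part (mc z) E2 -> (2 <= gen2 z)%N ->
  bcontr k u v E2 = E1 -> bcontr l a b E2 = E0 ->
  (k = Open -> blk E2 u = blk E2 v) -> (k = Closed -> 0 < gen s1 E1)%N -> goal.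
Proof.
move=> pE hz e1 e0 hO hC; rewrite /goal; have ez := up_down hz.
have ports_down k' : ports k' (down z) = ports k' z by case: k'.
have qk : contractible k u v (down z) by rewrite /contractible uv !ports_down uz.
have ql : contractible l a b (down z) by rewrite /contractible ab !ports_down az.
have es' : s1 = tcontr k u v (down z) by rewrite tcontrE ez.
have et' : t1 = tcontr l a b (down z) by rewrite tcontrE ez.
have [o1 _] := reaches_ok h1.
have oE : ok (down z) E2.
  by apply: (ok_lift qk pE) => //; rewrite -es' e1.
move: p1 p0 h1 h0 qa qu; rewrite -e1 -e0.
clear - U qk ql es' et' oE K_infinite; move: es' et' => -> -> p1 p0 h1 h0 qa qu.
exact: contr_common qk ql oE h1 h0.
Qed.

(** The first part consists of the points [A] and the closed inputs [C1], with [gen2] chosen so that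
    its genus is 0; the second part takes the rest, including the whole genus of the symbol. The two
    lower bounds keep the subtractions exact. *)
Lemma core_cut A C1 D1 D2 : {subset A <= pts (mc z)} -> {in A, forall x, nxt (mc z) x \in A} ->
  part (mc z) (D1 `|` D2) -> (forall X, X \in D1 -> X.1 `<=` A) ->
  (forall X, X \in D2 -> [disjoint X.1 & A]) -> C1 `<=` clo z ->
  (2 <= sigma D1 + #|` C1|)%N -> (2 <= sigma D2 + #|` clo z `\` C1|)%N ->
  (if k is Open then (u \in A) && (v \notin A) else (u \in C1) && (v \notin C1)) ->
  (if l is Open then (a \in A) && (b \notin A) else (a \in C1) && (b \notin C1)) ->
  bcontr k u v (D1 `|` D2) = E1 -> bcontr l a b (D1 `|` D2) = E0 -> goal.
Proof.
move=> sA cA pD hD1 hD2 sC n1 n2 huv hab e1 e0; rewrite /goal.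
pose M := mc z; have cB := closedC cA.
have sB : {subset pts M `\` A <= pts M} by move=> x; rewrite in_fsetD => /andP[].
pose g1 := (sigma D1 + #|` C1| - 2)%N.
pose z1 := Arity (restr M A) C1 g1.
pose z2 := Arity (restr M (pts M `\` A)) (clo z `\` C1) (gen2 z - g1).
have pA : pts (mc z1) = A := pts_restr sA cA.
have pB : pts (mc z2) = pts M `\` A := pts_restr sB cB.
have d : [disjoint pts (mc z1) & pts (mc z2)].
  by rewrite pA pB; apply/fdisjointP => x xA; rewrite in_fsetD xA.
have dC : [disjoint clo z1 & clo z2] by apply/fdisjointP => x /= xA; rewrite in_fsetD xA.
have q1 : part (mc z1) D1 by apply: (part_restr sA cA pD).
have q2 : part (mc z2) D2.
  rewrite fsetUC in pD; apply: (part_restr sB cB pD) => X XD.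
    apply/fsubsetP => x xX; rewrite in_fsetD; apply/andP; split.
      by apply/negP; apply: fdisjointF (hD2 X XD) xX.
    by apply: (part_sub pD _ xX); rewrite in_fsetU XD.
  apply/fdisjointP => x /(fsubsetP (hD1 X XD)) xA; by rewrite in_fsetD xA.
have sg : sigma (D1 `|` D2) = (sigma D1 + sigma D2)%N := sigmaU d q1 q2.
have cC : (#|` C1| + #|` clo z `\` C1|)%N = #|` clo z|.
  by rewrite cardfsDS // subnKC // fsubset_leq_card.
have joinz (k' : kind) c e : c != e -> c \in ports k' z -> e \in ports k' z ->
    (if k' is Open then (c \in A) && (e \notin A) else (c \in C1) && (e \notin C1)) ->
    joinable k' c e z1 z2.
  move=> ce cz ez h; rewrite /joinable d dC /=; case: k' cz ez h => /= cz ez /andP[cA' eA].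
    by rewrite !inputs_restr // in_fsetD cz ez cA' eA inputs_pts.
  by rewrite cA' in_fsetD eA.
have jk := joinz k u v uv uz vz huv; have jl := joinz l a b ab az bz hab.
have nb : k = Open -> (blk (D1 `|` D2) u == blk (D1 `|` D2) v) = false.
  move=> ek; apply/negbTE; case/and4P: jk => _ _; rewrite ek => uz1 vz2.
  by apply: (blk_union_neq d q1 q2); apply: inputs_pts.
have w : (sigma E1 + #|` clo s1| + 2 = sigma (D1 `|` D2) + #|` clo z|)%N.
  have := weight_contr uv uz vz pD; rewrite -e1 es; case: (k) nb => // /(_ erefl) -> //.
have [[_ o1] _] := reaches_ok h1.
have gz : (gen2 z + 4 = sigma (D1 `|` D2) + #|` clo z| + 4 * gen s1 E1)%N.
  move: o1 w; rewrite {1}es gen2_tglue.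
  by move: (sigma _) (sigma _) (#|` _|) (#|` _|) (gen2 z) (gen _ _) => i1 i2 i3 i4 i5 i6; clear; lia.
rewrite sg -cC in gz.
have ez : tunion z1 z2 = z.
  apply: arity_eq => /=; first exact: munion_restr.
    apply/fsetP => x; rewrite in_fsetU in_fsetD.
    by case: (boolP (x \in C1)) => // /(fsubsetP sC) ->.
  rewrite subnKC // /g1; move: gz n2.
  by move: (sigma _) (sigma _) (#|` _|) (#|` _|) (gen2 z) (gen _ _) => i1 i2 i3 i4 i5 i6; clear; lia.
have [o1' _] : ok z1 D1 /\ gen z1 D1 = 0.
  by apply: okI; rewrite //= /g1 muln0 addn0 subnK.
have [o2' _] : ok z2 D2 /\ gen z2 D2 = gen s1 E1.
  apply: okI; rewrite //= /g1; move: gz n1 n2.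
  by move: (sigma _) (sigma _) (#|` _|) (#|` _|) (gen2 z) (gen _ _) => i1 i2 i3 i4 i5 i6; clear; lia.
have es' : s1 = tjoin k u v z1 z2 by rewrite /tjoin ez.
have et' : t1 = tjoin l a b z1 z2 by rewrite /tjoin ez.
move: p1 p0 h1 h0 qa qu; rewrite -e1 -e0.
clear - U jk jl es' et' o1' o2' K_infinite f_hom; move: es' et' => -> -> p1 p0 h1 h0 qa qu.
exact: (contr_cut _ _ U jk jl o1' o2' h1 h0).
Qed.

Hypothesis ne : k = l -> [&& u != a, u != b, v != a & v != b].
Hypothesis eD : bcontr l a b E1 = bcontr k u v E0.

(** Closed gluing does not touch the multicycle, so [E1] is itself a partition for [z]. Only the
    genus can prevent a common element over [z], and then a cut is available. *)
Lemma core_closed : k = Closed -> goal.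
Proof.
move=> ek; have [oE1 _] := reaches_ok h1; have [pE1 eE1] := oE1.
have emc : mc s1 = mc z by rewrite es ek.
have pz : part (mc z) E1 by rewrite -emc.
have e0 : bcontr l a b E1 = E0 by rewrite eD ek.
have u_clo : u \in clo z by move: uz; rewrite ek.
have v_clo : v \in clo z by move: vz; rewrite ek.
case el : l az bz => az' bz'; last first.
  case/and4P: (ne (etrans ek (esym el))) => ua ub va vb.
  (* The first part is the trivial multicycle with the two closed inputs [u] and [a], a unit of
     operadic genus 0. *)
  apply: (@core_cut fset0 [fset u; a] fset0 E1); rewrite ?ek ?el ?fset0U //.
  - by move=> X _; apply/fdisjointP => x _; rewrite in_fset0.
  - by apply/fsubsetP => x; rewrite in_fset2 => /orP[]/eqP->.
  - by rewrite cardfs2 ua leq_addl.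
  - apply: (leq_trans _ (leq_addl _ _)).
    have <- : #|` [fset v; b]| = 2 by rewrite cardfs2 vb.
    apply: fsubset_leq_card; apply/fsubsetP => x; rewrite in_fset2 in_fsetD in_fset2 negb_or.
    case/orP => /eqP->; first by rewrite (eq_sym v u) uv va.
    by rewrite eq_sym ub eq_sym ab.
  - by rewrite !in_fset2 eqxx (eq_sym v) negb_or uv va.
  - by rewrite !in_fset2 eqxx orbT negb_or eq_sym ub eq_sym ab.
  - by rewrite -e0 el.
have aM := inputs_pts az'; have bM := inputs_pts bz'.
have [eab|nab] := eqVneq (blk E1 a) (blk E1 b).
  (* The contraction ab, inside one block, keeps the genus while uv raises it. As the results agree,
     the genus after uv alone is positive. *)
  have g1 : (0 < gen s1 E1)%N.
    have [_ g2] := ok_contr qa oE1; have [_ g3] := ok_contr qu (reaches_ok h0).1.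
    have et2 : tcontr l a b s1 = tcontr k u v t1.
      rewrite es et !tcontrE !tglue_up; congr up; apply: tglueC => e.
      case/and4P: (ne (esym e)) => ? ? ? ?.
      by rewrite ![a == _]eq_sym ![b == _]eq_sym; apply/and4P.
    by move: g3; rewrite -eD -et2 g2 ek el eab eqxx addn0 addn1 => ->.
  apply: (@core_common E1) => //.
  - move: eE1 g1; rewrite es gen2_tglue; move: (sigma _) (#|` _|) (gen2 z) (gen _ _).
    by move=> i1 i2 i3 i4; clear; lia.
  - by rewrite ek.
  - by rewrite ek.
set X := blk E1 a; have [XE aX] := blk_in pz aM; rewrite -/X in XE aX.
have [YE bY] := blk_in pz bM.
have eX : [fset X] `|` (E1 `\ X) = E1 by rewrite fsetD1K.
(* Here [a] and [b] are in different blocks: cut off the block of [a] together with the closed input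
   [u]. *)
apply: (@core_cut X.1 [fset u] [fset X] (E1 `\ X)); rewrite ?eX ?ek ?el //.
- by move=> x; apply: (part_sub pz XE).
- by move=> x; apply: (part_closed pz XE).
- by move=> Z; rewrite in_fset1 => /eqP->.
- by move=> Z; rewrite in_fsetD1 => /andP[ZX ZE]; apply: (block_disj pz).
- by rewrite fsub1set.
- by apply: leq_trans (leq_addr _ _); apply: leq_trans (sigma_ge (fset11 X)); rewrite leq_addl.
- apply: leq_trans (leq_addr _ _).
  have YX : blk E1 b \in E1 `\ X by rewrite in_fsetD1 eq_sym nab.
  by apply: leq_trans (sigma_ge YX); rewrite leq_addl.
- by rewrite !in_fset1 eqxx eq_sym.
- by rewrite aX (mem_block pz XE bM) eq_sym.
- by rewrite -e0 el.
Qed.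

(** If the weight of the block [Y] of [u] and [v] may be lowered on [z], both elements come from one
    over [z]. Otherwise [Y] has genus 0, contains all four inputs, and is cut so that the cycles of
    [u] and [a] form one part. This fails if one of these cycles contains [v] or [b]; the premise
    [hswap] hands that case back, to be settled by exchanging [a] and [b]. *)
Lemma core_open_half : k = Open -> l = Open -> blk E1 a = blk E1 b -> blk E0 u = blk E0 v ->
  (v \notin mcycle (mc z) u -> b \notin mcycle (mc z) a ->
   (v \in mcycle (mc z) a) || (b \in mcycle (mc z) u) -> goal) -> goal.
Proof.
move=> ek el eab euv hswap; have [oE1 _] := reaches_ok h1; have [pE1 eE1] := oE1.
have [oE0 _] := reaches_ok h0; have [pE0 eE0] := oE0.
have uI : u \in inputs (mc z) by move: uz; rewrite ek.
have vI : v \in inputs (mc z) by move: vz; rewrite ek.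
have aI : a \in inputs (mc z) by move: az; rewrite el.
have bI : b \in inputs (mc z) by move: bz; rewrite el.
have [[[uM vM] aM] bM] := (inputs_pts uI, inputs_pts vI, inputs_pts aI, inputs_pts bI).
have emc : mc s1 = mcontr (mc z) u v by rewrite es ek.
have emc0 : mc t1 = mcontr (mc z) a b by rewrite et el.
have eD' : bmerge a b E1 = bmerge u v E0 by move: eD; rewrite ek el.
rewrite emc in pE1; rewrite emc0 in pE0.
set M := mc z in uI vI aI bI uM vM aM bM pE1 pE0 *.
have p1M : pts (mcontr M u v) = pts M := pts_mcontr uM vM.
have p0M : pts (mcontr M a b) = pts M := pts_mcontr aM bM.
have [u1 v1 a1 b1] : [/\ u \in pts (mcontr M u v), v \in pts (mcontr M u v),
  a \in pts (mcontr M u v) & b \in pts (mcontr M u v)] by rewrite p1M.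
have [u0 v0] : u \in pts (mcontr M a b) /\ v \in pts (mcontr M a b) by rewrite p0M.
have [D1a eE1D] := bmerge_lower pE1 a1 b1 ab eab.
have [D0u eE0D] := bmerge_lower pE0 u0 v0 uv euv.
rewrite -eD' in D0u eE0D; set D := bmerge a b E1 in D1a eE1D D0u eE0D eD'.
have bD p : p \in pts M -> blk D p = if blk E1 p == blk E1 a then ((blk E1 a).1, (blk E1 a).2.+1) else blk E1 p.
  by move=> pM; rewrite (blk_merge pE1 a1 b1 ab) ?p1M // -eab orbb mblock_id.
have mn p : p \in pts M -> blk E1 p != blk E1 a -> ((blk E1 a).1, (blk E1 a).2.+1) != blk E1 p.
  move=> pM h; have := mblock_neq pE1 a1 (v := b) (Z := blk E1 p); rewrite -eab mblock_id; apply=> //.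
  by case: (blk_in pE1 (x := p)); rewrite ?p1M.
have bDuv : blk D u = blk D v.
  by rewrite eD' (blk_merge pE0 u0 v0 uv u0) (blk_merge pE0 u0 v0 uv v0) !eqxx orbT.
(* The contraction ab stays inside one block and unites nothing, so points in one block of [D] are
   already in one block of [E1]. *)
have e1uv : blk E1 u = blk E1 v.
  have := bDuv; rewrite !bD //.
  have [eu|nu] := eqVneq (blk E1 u) (blk E1 a); have [ev|nv] := eqVneq (blk E1 v) (blk E1 a) => //.
  - by rewrite eu ev.
  - by move=> e; have := mn v vM nv; rewrite e eqxx.
  - by move=> e; have := mn u uM nu; rewrite e eqxx.
set Y := blk E1 u; have [YE uY] := blk_in pE1 u1; rewrite -/Y in YE uY.
have vY : v \in Y.1 by rewrite /Y e1uv; case: (blk_in pE1 v1).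
have [cP cN] := contr_contr uM vM.
have cM A : cycs (mcontr (mcontr M u v) u v) A = cycs M A := cycs_same A cP cN.
(* The bound makes the alternative decidable; a genus satisfying the equation is at most [Y.2]. *)
have [/existsP[g /eqP hg]|nC] := boolP [exists g : 'I_Y.2.+1, Y.2 == 2 * g + #|` cycs M Y.1|]%N.
  have hC : (exists g : nat, Y.2 = 2 * g + #|` cycs (mcontr (mcontr M u v) u v) Y.1|)%N.
    by exists g; rewrite cM.
  have [pl el1] := part_lower pE1 YE uY vY uv hC.
  have pE2 : part M (lower Y E1) := part_same cP cN pl.
  set E2 := lower Y E1 in pl el1 pE2.
  have Y'E : ((Y.1, Y.2.-1) : block) \in E2 by rewrite /E2 lower.unlock in_fset1U eqxx.
  have b2uv : blk E2 u = blk E2 v by rewrite (blk_eq pE2 Y'E uY) (blk_eq pE2 Y'E vY).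
  apply: (@core_common E2) => //.
  - have Y2 : (0 < Y.2)%N.
      rewrite hg addn_gt0; apply/orP; right; rewrite cardfs_gt0; apply/fset0Pn.
      by exists (mcycle M u); apply: mem_cycs.
    move: eE1 (sigma_ge YE) Y2; rewrite es gen2_tglue.
    by move: (sigma _) (#|` _|) (gen2 z) (gen _ _) (Y.2) => i1 i2 i3 i4 i5; clear; lia.
  - by rewrite ek.
  (* Both [W] and [E0] become [D] by uv inside one block, and [bmerge_lower] recovers such a
     partition from [D]. *)
  - rewrite el /=; set W := bmerge a b E2.
    have pW : part (mcontr M a b) W := part_merge pE2 aM bM ab.
    have bW : blk W u = blk W v.
      by rewrite !(blk_merge pE2 aM bM ab) // b2uv.
    have eW : bmerge u v W = D by rewrite /W -(mergeC pE2 uM vM aM bM uv ab) el1.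
    have [_] := bmerge_lower pW u0 v0 uv bW; rewrite eW => ->; exact/esym/eE0D.
  - by rewrite ek.
have sY : Y.1 `<=` pts M by rewrite -p1M; apply: (block_sub pE1 YE).
have cY : {in Y.1, forall x, nxt M x \in Y.1}.
  move=> x xY; rewrite -cN nxt_mcontr; apply: (block_closed pE1 YE).
  by rewrite fstpermE; case: eqP => // _; case: eqP.
have cu := card_cycs_contr sY cY uv uY vY.
have [g1 hg1] := part_gen pE1 YE.
have nC' g : Y.2 <> (2 * g + #|` cycs M Y.1|)%N.
  move=> e; have ltg : (g < Y.2.+1)%N by rewrite e; move: (#|` _|) => i; clear; lia.
  by case/existsP: nC; exists (Ordinal ltg); rewrite {1}e.
have c0 : (0 < #|` cycs M Y.1|)%N.
  by rewrite cardfs_gt0; apply/fset0Pn; exists (mcycle M u); apply: mem_cycs.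
(* If uv were a cut, the genus of [Y] would serve for the lowered block; if it is a merge and the
   genus is positive, the genus less 1 would. So uv merges two cycles and [Y] has genus 0. *)
have [nuv cY2] : v \notin mcycle M u /\ (Y.2.+2 = #|` cycs M Y.1|)%N.
  case: ifP cu => h hc.
    by case: (nC' g1); move: hg1; rewrite hc addnS => -[].
  split=> //; case: g1 hg1 => [|g1] hg1; first by rewrite hg1 muln0 add0n hc.
  by case: (nC' g1); move: hg1 hc; move: (#|` _|) (#|` _|) (Y.2) => i1 i2 i3; clear; lia.
(* Otherwise ab leaves [Y] alone, so the block of [u] in [E0] is [Y] with its weight lowered by 1
   and with the same cycles as in [z], which [nC'] excludes. *)
have eYa : Y = blk E1 a.
  have := bD u uM; rewrite -/Y; have [//|nYa] := eqVneq Y (blk E1 a) => eDu.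
  have [X0E uX0] := blk_in pE0 u0; have [g0 hg0] := part_gen pE0 X0E.
  have e1 : (blk E0 u).1 = Y.1 by rewrite -eDu D0u.
  have e2 : Y.2 = (blk E0 u).2.+1 by rewrite -eDu D0u.
  have aY : a \notin Y.1 by rewrite (mem_block pE1 YE a1) eq_sym.
  have bY : b \notin Y.1 by rewrite (mem_block pE1 YE b1) -eab eq_sym.
  by case: (nC' g0); rewrite e2 hg0 e1 (cycs_contr_out sY cY aY bY).
have aY : a \in Y.1 by rewrite eYa; case: (blk_in pE1 a1).
have bY : b \in Y.1 by rewrite eYa eab; case: (blk_in pE1 b1).
have eDu : blk D u = (Y.1, Y.2.+1) by rewrite bD // -/Y -eYa eqxx.
(* Both arise from [D] by lowering the one block that contains all four inputs. *)
have eE10 : E0 = E1 by rewrite eE0D eE1D eDu D1a -eYa.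
(* As a block of [E0], [Y] has at most [Y.2.+1] cycles after ab. On [z] it has [Y.2.+2], so ab
   cannot be a cut. *)
have nabc : b \notin mcycle M a.
  have ca := card_cycs_contr sY cY ab aY bY; have YE0 : Y \in E0 by rewrite eE10.
  have [g0 hg0] := part_gen pE0 YE0.
  case: ifP ca => [h hc|/negbT //]; exfalso; move: hg0 hc cY2.
  by move: (#|` _|) (#|` _|) (Y.2) => i1 i2 i3; clear; lia.
have [|] := boolP ((v \in mcycle M a) || (b \in mcycle M u)); first exact: hswap.
case/norP => va bu; set A := mcycle M u `|` mcycle M a.
have sA : A `<=` Y.1 by rewrite fsubUset !(mcycle_closed _ _ cY).
have cA : {in A, forall x, nxt M x \in A}.
  by move=> x; rewrite !in_fsetU => /orP[]h; apply/orP; [left|right]; rewrite -(mcycle_eq _ h) //;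
    apply: nxt_mcycle; apply: mem_mcycle_pts h.
have [uA aA] : u \in A /\ a \in A by rewrite !in_fsetU !mem_mcycle ?orbT.
have [vA bA] : v \notin A /\ b \notin A by rewrite !in_fsetU !negb_or nuv va bu.
have := part_split pE1 uM vM uv YE uY vY sA cA uA vA cY2.
move=> /=; set D1 := [fset _]; set D2 := (_ |` _) => -[pD hD1 hD2 hm].
apply: (@core_cut A fset0 D1 D2) => //.
- by move=> x xA; apply: (fsubsetP sY); apply: (fsubsetP sA).
- by apply: leq_trans (leq_addr _ _); apply: leq_trans (sigma_ge (fset11 _)); rewrite leq_addl.
- by apply: leq_trans (leq_addr _ _); apply: leq_trans (sigma_ge (fset1U1 _ _)); rewrite leq_addl.
- by rewrite ek uA vA.
- by rewrite el aA bA.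
- by rewrite ek; apply: hm.
- by rewrite el eE10; apply: hm.
Qed.

End Core.

(** The bad case for the pair ab is that [v] shares a cycle with [a], or [b] with [u]. After
    exchanging [a] and [b] it would also require that [v] share a cycle with [b], or [a] with [u];
    any two of these put [u] and [v], or [a] and [b], on one cycle. *)
Lemma core_open n (U : determined n) k l u v a b z s1 t1 (uv : u != v) (ab : a != b)
    (uz : u \in ports k z) (vz : v \in ports k z) (az : a \in ports l z) (bz : b \in ports l z)
    (es : s1 = tglue k u v z) (et : t1 = tglue l a b z) E1 E0 (p1 : P s1) (p0 : P t1)
    (h1 : reaches n E1 p1) (h0 : reaches n E0 p0)
    (qa : contractible l a b s1) (qu : contractible k u v t1) :
  bcontr l a b E1 = bcontr k u v E0 ->
  k = Open -> l = Open -> blk E1 a = blk E1 b -> blk E0 u = blk E0 v ->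
  existT P _ (hcontr TP qa p1) = existT P _ (hcontr TP qu p0).
Proof.
move=> eD ek el eab euv.
apply: (@core_open_half n U k l u v a b z s1 t1 uv ab uz vz az bz es et E1 E0 p1 p0 h1 h0) => //.
move=> nuv nab hv.
have qa' : contractible l b a s1 by move: qa; rewrite /contractible eq_sym => /and3P[-> -> ->].
rewrite (hcontr_sym TP qa qa').
have ba : b != a by rewrite eq_sym.
have et' : t1 = tglue l b a z by rewrite et el /tglue mcontr_swap.
apply: (@core_open_half n U k l u v b a z s1 t1 uv ba uz vz bz az es et' E1 E0 p1 p0 h1 h0) => //.
  by rewrite bcontr_sym.
move=> _ nba hv'; exfalso.
have [uM vM] : u \in pts (mc z) /\ v \in pts (mc z).
  by move: uz vz; rewrite ek => /inputs_pts -> /inputs_pts ->.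
have [aM bM] : a \in pts (mc z) /\ b \in pts (mc z).
  by move: az bz; rewrite el => /inputs_pts -> /inputs_pts ->.
have mE x y : x \in pts (mc z) -> y \in pts (mc z) -> (y \in mcycle (mc z) x) = (mcycle (mc z) y == mcycle (mc z) x).
  by move=> xM yM; apply/idP/eqP => [/(mcycle_eq xM)|<-] //; apply: mem_mcycle.
move: nuv nab hv hv'; rewrite !mE // => n1 n2.
by move/eqP: n1 => n1; move/eqP: n2 => n2; case/orP => /eqP e /orP[]/eqP e'; congruence.
Qed.

End Cut.

(** * Independence of the presentation *)

Section Confluence.
Variable K : choiceType.
Hypothesis K_infinite : forall A : {fset K}, exists x : K, x \notin A.
Variables (P : arity K -> Type) (SP : cyclic_str P) (TP : modular_str SP).
Variable f : forall t, OC t -> P t.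
Hypothesis f_hom : cyclic_hom (OC_cyclic K) SP f.

Local Notation block := (block K).
Local Notation reaches := (reaches TP f).
Local Notation determined := (determined TP f).

Implicit Types (M N T : mcyc K) (u v x y a b c d : K) (A B O : {fset K}) (r : relabeling K)
  (D E F : {fset block}) (s t w z : arity K) (k l : kind) (X Y Z : block).

Lemma hmap_inj s t r (h : relabels s t r) : injective (hmap SP h).
Proof. have [r' [h' i]] := relabels_inv K_infinite h; exact: (can_inj (@hmapK K P SP s t r r' h h' i)). Qed.

(** Elements of two components are compared in a common third one; relabelings act injectively, so
    the equality can be brought back. *)
Lemma transfer s t w1 w0 r r1 r0 (h : relabels s t r) (h1 : relabels s w1 r1)
    (h0 : relabels t w0 r0) (p : P s) (q : P t) :
  existT P _ (hmap SP h1 p) = existT P _ (hmap SP h0 q) ->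
  {in inputs (mc s), on_open r1 =1 on_open (rel_comp r0 r)} ->
  {in mcycles (mc s), on_cycle r1 =1 on_cycle (rel_comp r0 r)} ->
  {in clo s, on_closed r1 =1 on_closed (rel_comp r0 r)} -> hmap SP h p = q.
Proof.
move=> e eo ec eC; have ew : w1 = w0 := f_equal (@projT1 _ _) e.
move: h1 e; rewrite ew => h1 e'; have e := arity_existT_inj e'; apply: (@hmap_inj _ _ _ h0).
by rewrite -e -(hmap_comp SP h h0 h1).
Qed.

Lemma hcontr_map_eq k u v u' v' s t r (hr : relabels s t r) (q : contractible k u v s)
    (q' : contractible k u' v' t)
    (hq : relabels (tcontr k u v s) (tcontr k u' v' t) (rel_glue k u v (mc t) r)) (p : P s) :
  on_port k r u = u' -> on_port k r v = v' ->
  hmap SP hq (hcontr TP q p) = hcontr TP q' (hmap SP hr p).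
Proof. by move=> eu ev; subst u' v'; apply: (hcontr_map TP). Qed.

Lemma relabels_contr_eq k u v u' v' s t r : relabels s t r -> contractible k u v s ->
  on_port k r u = u' -> on_port k r v = v' ->
  contractible k u' v' t /\ relabels (tcontr k u v s) (tcontr k u' v' t) (rel_glue k u v (mc t) r).
Proof. by move=> hr q <- <-; apply: relabels_contr. Qed.

(** Any presentation ends with some contraction ab up to a relabeling. It is placed with the chosen
    contraction uv on one [z], where the comparison is made in the total space. *)
Lemma confluent n k u v t0 (q : contractible k u v t0) E (q0 : P t0) p : determined n ->
  reaches n E q0 -> (k = Open -> gen (tcontr k u v t0) (bcontr k u v E) = 0) ->
  reaches n.+1 (bcontr k u v E) p -> p = hcontr TP q q0.
Proof.
move=> U hq0 hO /(reaches_last f_hom)[l [a [b [s0 [ql [r [h [D0 [p0 [hp0 eD ->]]]]]]]]]].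
have [z [a' [b' [r0 [r1 [h0 h1 [eu ev] [ea eb] [qk qz ne [eo ec eC]]]]]]]] := normalize K_infinite q ql h.
set S := tglue k u v z in h1 eo ec eC *; set T := tglue l a' b' z in h0 eo ec eC *.
have [qa hr1] := relabels_contr_eq h1 ql ea eb.
have [qu hr0] := relabels_contr_eq h0 q eu ev.
apply: (@transfer _ _ _ _ _ _ _ h hr1 hr0) => //.
rewrite (hcontr_map_eq h1 ql qa hr1 p0 ea eb) (hcontr_map_eq h0 q qu hr0 q0 eu ev).
have hE1 := reaches_map h1 hp0; have hE0 := reaches_map h0 hq0.
have [oE0 _] := reaches_ok hE0; have [oE _] := reaches_ok hq0; have [oD0 _] := reaches_ok hp0.
have [oE1 _] := reaches_ok hE1.
have b0 := bmap_contr h0 q (reaches_part hq0); rewrite eu ev in b0.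
have b1 := bmap_contr h1 ql (reaches_part hp0); rewrite ea eb in b1.
have [[pl _] _] := ok_contr ql oD0.
have [m _ _] := (relabelsE _ _ _).1 h; have [m0 _ _] := (relabelsE _ _ _).1 hr0.
have e10 : bcontr l a' b' (bmap (mc s0) r1 D0) = bcontr k u v (bmap (mc t0) r0 E).
  by rewrite -b0 -b1 eD (bmap_cycle_ext pl ec) (bmap_comp m m0 pl).
case/and3P: (qk) => uv uz vz; case/and3P: (qz) => ab az bz.
have hcl := core_closed K_infinite f_hom U uv ab uz vz az bz (erefl S) (erefl T) hE1 hE0 qa qu ne e10.
have hop := core_open K_infinite f_hom U uv ab uz vz az bz (erefl S) (erefl T) hE1 hE0 qa qu e10.
have [/hcl //|ek] : k = Closed \/ k = Open by case: (k); auto.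
(* With [k] open the common result has genus 0. By [ok_contr] a closed contraction would contribute
   1 to it, and an open one between different blocks as well; so [l] is open and each pair lies
   inside one block. *)
have g0 : gen (tcontr k u v T) (bcontr k u v (bmap (mc t0) r0 E)) = 0.
  by have [okE _] := ok_contr q oE; have [_ e] := ok_map hr0 okE; rewrite -b0 e hO.
have [_ g1] := ok_contr qa oE1; have [_ g2] := ok_contr qu oE0.
have et : tcontr l a' b' S = tcontr k u v T.
  rewrite !tcontrE !tglue_up; congr up; apply: tglueC => e.
  case/and4P: (ne (esym e)) => ? ? ? ?.
  by rewrite ![a' == _]eq_sym ![b' == _]eq_sym; apply/and4P.
rewrite e10 et g0 in g1; rewrite g0 ek in g2.
have [el|el] : l = Closed \/ l = Open by case: (l); auto.
  by rewrite el addn1 in g1.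
apply: hop => //; apply/eqP.
  by rewrite el in g1; case: eqP g1 => //= _; rewrite addn1.
by case: eqP g2 => //= _; rewrite addn1.
Qed.

(** The contraction from [uncontract] lives over an isomorphic index, so both values are first moved
    there; each then equals the contraction of one and the same element of degree n. *)
Lemma determined_all n : determined n.
Proof.
elim: n => [|n IH] t D p p' hp hp'.
  have [o [_ ->]] := reaches_last f_hom hp; have [o' [_ ->]] := reaches_last f_hom hp'.
  by rewrite (OC_eq o o').
have [oD dD] := reaches_ok hp.
have [|t' [r [k [u [v [t0 [E [hr q oE [et eD hO]]]]]]]]] := uncontract K_infinite oD; first by rewrite dD.
apply: (@hmap_inj _ _ _ hr); move: (reaches_map hr hp) (reaches_map hr hp').
have dE : degree t0 E = n.
  by have := degree_contr q oE; rewrite et eD (degree_map hr oD) dD => -[].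
have [q0 hq0] := reaches_total K_infinite TP f oE dE.
move: (hmap SP hr p) (hmap SP hr p'); rewrite -eD; move: hO; rewrite -eD; clear hr; subst t' => hO a a' ha ha'.
by rewrite (confluent q IH hq0 hO ha) (confluent q IH hq0 hO ha').
Qed.

End Confluence.

(** * The induced morphism *)

Section Universal.
Variable K : choiceType.
Hypothesis K_infinite : forall A : {fset K}, exists x : K, x \notin A.
Variables (P : arity K -> Type) (SP : cyclic_str P) (TP : modular_str SP).
Variable f : forall t, OC t -> P t.
Hypothesis f_hom : cyclic_hom (OC_cyclic K) SP f.

Local Notation reaches := (reaches TP f).

Implicit Types (u v : K) (s t : arity K) (k : kind).

Lemma extension_exists t (x : ModOC t) :
  exists p : P t, reaches (degree t (blocks x)) (blocks x) p.
Proof. exact: (reaches_total K_infinite TP f (blocks_ok x).1 erefl). Qed.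

(** The value is known to exist only as a proposition, and [P t] is an arbitrary type, so a
    description principle selects it. Uniqueness makes the choice irrelevant. *)
Definition extension t (x : ModOC t) : P t :=
  proj1_sig (constructive_indefinite_description _ (extension_exists x)).

Lemma extensionP t (x : ModOC t) : reaches (degree t (blocks x)) (blocks x) (extension x).
Proof. exact: (proj2_sig (constructive_indefinite_description _ _)). Qed.

Lemma extension_eq n t (x : ModOC t) p : reaches n (blocks x) p -> extension x = p.
Proof.
move=> h; have [_ en] := reaches_ok h; move: h; rewrite -en.
exact: (determined_all K_infinite f_hom (extensionP x)).
Qed.

Lemma extension_hom : modular_hom (mod_modular K) TP extension.
Proof.
split; first split.
- by move=> s t r hr x; apply: extension_eq; rewrite blocks_map; apply: reaches_map (extensionP x).
- move=> k u v s t j x y; apply: extension_eq; rewrite blocks_join.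
  exact: (reaches_join K_infinite f_hom j (extensionP x) (extensionP y)).
- by move=> k u v t q x; apply: extension_eq; rewrite blocks_contr; apply: reaches_contr (extensionP x).
Qed.

Lemma extension_unit t (x : OC t) : extension (unitOC x) = f x.
Proof. by apply: extension_eq; rewrite blocks_unit; apply: reaches_base. Qed.

(** Induction on the presentation: [reaches] has one clause for units, one for relabelings and one
    for contractions, and [h] respects all three. *)
Lemma extension_unique (h : forall t, ModOC t -> P t) : modular_hom (mod_modular K) TP h ->
  (forall t (x : OC t), h t (unitOC x) = f x) -> forall t (x : ModOC t), h t x = extension x.
Proof.
move=> [[h_map _] h_contr] h_unit t x.
suff H n D p : reaches n D p -> forall y : ModOC t, blocks y = D -> h t y = p.
  exact: H (extensionP x) x erefl.
elim=> {n t x D p} [t o|n s t r hr D p hp IH|n k u v t q D p hp IH] y ey.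
- by rewrite -h_unit; congr (h t _); apply: ModOC_ext; rewrite ey blocks_unit.
- have [oD _] := reaches_ok hp; have e := blocks_toM oD.
  rewrite -(IH _ e) -h_map; congr (h t _); apply: ModOC_ext; rewrite ey; by rewrite blocks_map e.
- have [oD _] := reaches_ok hp; have e := blocks_toM oD.
  rewrite -(IH _ e) -h_contr; congr (h _ _); apply: ModOC_ext; by rewrite ey blocks_contr e.
Qed.

End Universal.

Theorem proposition33 (K : choiceType)
    (K_infinite : forall A : {fset K}, exists x : K, x \notin A) :
  exists (S : cyclic_str (@ModOC K)) (T : modular_str S)
         (e : forall t : arity K, OC t -> ModOC t),
    [/\ ModOC_formulas T, ModOC_unit_formula e
      & modular_completion (OC_cyclic K) T e].
Proof.
exists (mod_cyclic K), (mod_modular K), (@unitOC K).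
split; [exact: mod_formulas|exact: unit_formula|split; first exact: unit_hom].
move=> P SP TP f f_hom; exists (extension K_infinite TP f); split.
- exact: extension_hom.
- exact: extension_unit.
- exact: extension_unique.
Qed.
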